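(* \textbf{Part 1 (non uniqueness).} There exists a bounded measurable, compactly supported vector field $a\in L^\infty(\mathbb{R}\times\mathbb{R}^2;\mathbb{R}^2)$ such that $a(t,\cdot)$ is divergence free in $\mathbb{R}^2$ (in the sense of distributions) for a.e. $t\in\mathbb{R}$, for which there exist two distinct maps $\phi,\psi:\mathbb{R}\times\mathbb{R}\times\mathbb{R}^2\to\mathbb{R}^2$ (distinct meaning that for some $\alpha\neq 1$ and some $t\in\mathbb{R}$ the maps $\phi(t,\alpha,\cdot)$ and $\psi(t,\alpha,\cdot)$ differ on a set of positive Lebesgue measure) such that: (a) for every $t\in\mathbb{R}$, every $\alpha\neq1$ and every $x\in\mathbb{R}^2$, $$\phi(t,\alpha,x)=x+\int_0^t a(s+\alpha,\phi(s,\alpha,x))\,ds,\qquad \psi(t,\alpha,x)=x+\int_0^t a(s+\alpha,\psi(s,\alpha,x))\,ds;$$ (b) for every $\alpha\neq1$ and every $t\in\mathbb{R}$, $\phi(t,\alpha,\cdot)$ and $\psi(t,\alpha,\cdot)$ both preserve the Lebesgue measure; (c) for every $t_1,t_2,\alpha\in\mathbb{R}$ with $\alpha\neq1$ and $t_2+\alpha\neq1$, and every $x\in\mathbb{R}^2$, $$\phi(t_1,\alpha+t_2,\phi(t_2,\alpha,x))=\phi(t_1+t_2,\alpha,x)\quad\text{and}\quad\psi(t_1,\alpha+t_2,\psi(t_2,\alpha,x))=\psi(t_1+t_2,\alpha,x).$$ Moreover, for this $a$ there exists a nontrivial (i.e. not a.e. zero) weak solution $u\in L^\infty([0,\infty)\times\mathbb{R}^2)$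 of $$\partial_t u+\langle a;\nabla_x u\rangle=0\quad\text{and}\quad u(0,\cdot)=0,$$ which explicitly means that, for every $h\in C_c^\infty([0,\infty)\times\mathbb{R}^2)$, $$\int_0^\infty\int_{\mathbb{R}^2}u(t,x)\left(\partial_t h(t,x)+\langle a(t,x);\nabla_x h(t,x)\rangle\right)dx\,dt=0.$$ \textbf{Part 2 (non existence).} There exists a bounded measurable, compactly supported vector field $\tilde a\in L^\infty(\mathbb{R}\times\mathbb{R}^2;\mathbb{R}^2)$, with $\tilde a(t,\cdot)$ divergence free in $\mathbb{R}^2$ (in the sense of distributions) for a.e. $t\in\mathbb{R}$, which generates no measure preserving flow satisfying the group property; that is, there is no map $\varphi:\mathbb{R}\times\mathbb{R}\times\mathbb{R}^2\to\mathbb{R}^2$ such that simultaneously: (a') for every $\alpha\neq1$, for a.e. $x\in\mathbb{R}^2$ and for every $t\in\mathbb{R}$, $\varphi(t,\alpha,x)=x+\int_0^t\tilde a(s+\alpha,\varphi(s,\alpha,x))\,ds$; (b') for every $\alpha\neq1$ and every $t\in\mathbb{R}$, $\varphi(t,\alpha,\cdot)$ is measurable and preserves the Lebesgue measure; (c') for every $t_1,t_2,\alpha\in\mathbb{R}$ with $\alpha\neq1$ and $t_2+\alpha\neq1$, and a.e. $x\in\mathbb{R}^2$, $\varphi(t_1,\alpha+t_2,\varphi(t_2,\alpha,x))=\varphi(t_1+t_2,\alpha,x)$.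
   Context: $|\cdot|$ denotes Lebesgue measure. A measurable map $f:\mathbb{R}^2\to\mathbb{R}^2$ preserves the Lebesgue measure if $|f^{-1}(A)|=|A|$ for every measurable set $A\subset\mathbb{R}^2$. The vector fields $a,\tilde a$ are understood as specific bounded Borel/measurable functions defined everywhere. The value $\phi(t,\alpha,x)$ is the position at time $\alpha+t$ of the trajectory that is at $x$ at time $\alpha$. The notation $\langle\cdot;\cdot\rangle$ is the Euclidean scalar product. $C_c^\infty([0,\infty)\times\mathbb{R}^2)$ is the set of smooth functions with compact support in $[0,\infty)\times\mathbb{R}^2$ (not necessarily vanishing at $t=0$). *)

(* Defs.v *)
From HB Require Import structures.
From mathcomp Require Import all_boot all_order all_algebra.
From mathcomp Require Import all_classical all_reals all_analysis.

Set Implicit Arguments.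
Unset Strict Implicit.
Unset Printing Implicit Defensive.

Import Order.TTheory GRing.Theory Num.Theory.
Import numFieldNormedType.Exports.

Local Open Scope classical_set_scope.
Local Open Scope ring_scope.

Notation leb2 R :=
  ((@lebesgue_measure R \x @lebesgue_measure R)%E) (only parsing).

Notation leb3 R :=
  ((@lebesgue_measure R \x (@lebesgue_measure R \x @lebesgue_measure R))%E)
  (only parsing).

(* [leb2] lives on the Borel sets; the Lebesgue measurable sets of the plane are
   the Caratheodory measurable sets of its outer measure, and the Lebesgue
   measure of such a set is its outer measure. *)
Definition lebesgue_measurable2 {R : realType} (A : set (R * R)) : Prop :=
  ((leb2 R)^*)%mu.-cara.-measurable A.

Definition area {R : realType} (A : set (R * R)) : \bar R :=
  ((leb2 R)^*)%mu A.

(* Measurability of [f] is part of the definition. *)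
Definition preserves_lebesgue {R : realType} (f : R * R -> R * R) : Prop :=
  forall A, lebesgue_measurable2 A ->
    lebesgue_measurable2 (f @^-1` A) /\ area (f @^-1` A) = area A.

Definition dot2 {R : realType} (v w : R * R) : R := v.1 * w.1 + v.2 * w.2.

Definition grad2 {R : realType} (g : R * R -> R) (x : R * R) : R * R :=
  ('D_(1, 0) g x, 'D_(0, 1) g x).

(* Class C^k: all iterated directional derivatives up to order k exist and are
   continuous. *)
Fixpoint Ck {R : realType} {V : normedModType R} (k : nat) (f : V -> R) : Prop :=
  continuous f /\
  if k is j.+1 then
    forall v, (forall x, derivable f x v) /\ Ck j (fun x => 'D_v f x)
  else True.

Definition compactly_supported {T : topologicalType} {W : zmodType}
  (f : T -> W) : Prop := compact (closure [set z | f z != 0]).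

Definition test_function {R : realType} {V : normedModType R} (f : V -> R) :=
  (forall k, Ck k f) /\ compactly_supported f.

Definition divergence_free {R : realType} (b : R * R -> R * R) : Prop :=
  forall g : R * R -> R, test_function g ->
    (\int[leb2 R]_x (dot2 (b x) (grad2 g x))%:E = 0)%E.

(* L^oo fields are represented by everywhere defined, everywhere bounded Borel
   functions: trajectories depend on pointwise values. *)
Definition admissible_field {R : realType} (a : R * (R * R) -> R * R) : Prop :=
  [/\ measurable_fun setT a,
      exists M : R, forall z, `|a z| <= M,
      compactly_supported a &
      {ae @lebesgue_measure R, forall t, divergence_free (fun x => a (t, x))}].

Definition segment_to {R : realType} (t : R) : set R :=
  [set` `[Num.min 0 t, Num.max 0 t]].

(* The oriented integral from 0 to t, for t of either sign. *)
Definition oriented_integral {R : realType} (f : R -> R) (t : R) : R :=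
  Num.sg t * \int[lebesgue_measure]_(s in segment_to t) f s.

(* Integrability is explicit because [Rintegral] is total. Borel measurability
   of the integrand is no restriction: [a] is Borel and a curve satisfying the
   equation at all times up to [t] is continuous up to [t]. *)
Definition integral_curve_at {R : realType} (a : R * (R * R) -> R * R)
    (alpha : R) (x : R * R) (gamma : R -> R * R) (t : R) : Prop :=
  let f s := a (s + alpha, gamma s) in
  [/\ (@lebesgue_measure R).-integrable (segment_to t) (fun s => ((f s).1)%:E),
      (@lebesgue_measure R).-integrable (segment_to t) (fun s => ((f s).2)%:E) &
      gamma t = x + (oriented_integral (fun s => (f s).1) t,
                     oriented_integral (fun s => (f s).2) t)].

Definition everywhere_flow {R : realType} (a : R * (R * R) -> R * R)
    (phi : R -> R -> R * R -> R * R) : Prop :=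
  [/\ forall t alpha x, alpha != 1 ->
        integral_curve_at a alpha x (fun s => phi s alpha x) t,
      forall alpha t, alpha != 1 -> preserves_lebesgue (phi t alpha) &
      forall t1 t2 alpha x, alpha != 1 -> t2 + alpha != 1 ->
        phi t1 (alpha + t2) (phi t2 alpha x) = phi (t1 + t2) alpha x].

Definition ae_flow {R : realType} (a : R * (R * R) -> R * R)
    (phi : R -> R -> R * R -> R * R) : Prop :=
  [/\ forall alpha, alpha != 1 ->
        {ae leb2 R, forall x, forall t,
           integral_curve_at a alpha x (fun s => phi s alpha x) t},
      forall alpha t, alpha != 1 -> preserves_lebesgue (phi t alpha) &
      forall t1 t2 alpha, alpha != 1 -> t2 + alpha != 1 ->
        {ae leb2 R, forall x,
           phi t1 (alpha + t2) (phi t2 alpha x) = phi (t1 + t2) alpha x}].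

Definition distinct_flows {R : realType}
    (phi psi : R -> R -> R * R -> R * R) : Prop :=
  exists alpha t, alpha != 1 /\
    (0 < area [set x | phi t alpha x != psi t alpha x])%E.

Definition half_space {R : realType} : set (R * (R * R)) := [set z | 0 <= z.1].

Definition Linfty_half_space {R : realType} (u : R * (R * R) -> R) : Prop :=
  measurable_fun half_space u /\
  exists M : R, {ae leb3 R, forall z, half_space z -> `|u z| <= M}.

(* The test functions on [0, +oo[ x R^2 are the restrictions of the test
   functions on R x R^2. *)
Definition weak_transport_zero {R : realType} (a : R * (R * R) -> R * R)
    (u : R * (R * R) -> R) : Prop :=
  forall h : R * (R * R) -> R, test_function h ->
    (\int[lebesgue_measure]_(t in `[0%R, +oo[) \int[leb2 R]_x
       (u (t, x) * (derive1 (fun s => h (s, x)) t +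
          dot2 (a (t, x)) (grad2 (fun y => h (t, y)) x)))%:E = 0)%E.

(* Main.v *)
From HB Require Import structures.
Require Import Defs.
From mathcomp Require Import all_boot all_order all_algebra.
From mathcomp Require Import all_classical all_reals all_analysis.
From mathcomp Require Import measurable_realfun zify ring lra.

Set Implicit Arguments.
Unset Strict Implicit.
Unset Printing Implicit Defensive.

Import Order.TTheory GRing.Theory Num.Theory.
Import numFieldNormedType.Exports.

Local Open Scope classical_set_scope.
Local Open Scope ring_scope.

(** The two examples are built from one field on the time interval [[0, 1[] that mixes
    the unit square. At the scale with columns and rows of width [w] it first turns by half a
    turn every rectangle made of the two middle columns of a block of four in one row,
    and then every one of the two squares of each such rectangle. The reflections cancel, and
    the net effect is that the two middle columns of each block are exchanged by
    translation ([two_stages]). The next scale is half as large and takes half the time,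
    at bounded speed. Since exchanging the middle columns and then doubling inside both
    halves of a block is doubling inside the block, the infinite composition of the
    exchanges is the doubling of the first coordinate modulo [1] ([traj_fold], [traj1E]).
    Thus the flow is a measure preserving bijection before time [1], but at time [1] it
    becomes a measure preserving map which is two-to-one: it takes the same value at a
    point and at the point translated by [1 / 2], exchanged by [half_swap].

    A half-turn is realized by the rotation at constant speed along the sides of concentric
    squares. This rotation is piecewise linear and made of shears, whence it preserves area
    ([mp_sqrot]), and its trajectories are locally to the right affine. Consequently the chain
    rule ([traj_chain]) needs only the fundamental theorem of calculus on segments, and the
    field is divergence free because its flow preserves area ([stage_divergence_free]).

    Non-uniqueness: run the field up to time [1] and then run it backwards
    ([mirror_field]). A trajectory can be continued after time [1] by its own mirror image,
    or by the mirror image of the trajectory of the exchanged point, as both arrive at the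
    same place. The two choices give two measure preserving flows ([mirror_ode],
    [mirror_everywhere_flow]) that differ by [half_swap] at time [2]. A density of opposite
    signs on the two halves, carried along the backward part, becomes at time [1] a
    function of zero mean against every function composed with the limit map; it can
    therefore be continued by [0] to earlier times ([mirror_transport]).

    Non-existence: run the field up to time [1] and stop. Before time [1] the trajectory
    of a point with irrational coordinates is unique ([stage_unique]): by induction on the
    stages, and by continuous induction inside a stage, because near each of its points the
    field either vanishes or is a shear, up to a discontinuity across a diagonal that
    trajectories enter from one side only ([departs_square]). Hence any flow sends almost
    every point of the square at time [2] to its image under the limit map, and the group
    law would provide a left inverse of a two-to-one map ([no_ae_flow]). *)

(** * Measure preserving maps of the plane *)

Section MeasurablePiecewise.
Context d1 (S1 : measurableType d1) d2 (S2 : measurableType d2) (I : countType)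
  (P : I -> set S1) (F : S1 -> S2) (FI : I -> S1 -> S2).

(** A map glued from countably many measurable maps along a measurable cover; all the
    flows and fields below are glued in this way. *)
Lemma measurable_piecewise : (forall i, measurable (P i)) ->
  (forall z, exists i, P i z) -> (forall i, measurable_fun setT (FI i)) ->
  (forall i z, P i z -> F z = FI i z) -> measurable_fun setT F.
Proof.
move=> mP cP mF FE _ B mB; rewrite setTI.
have -> : F @^-1` B = \bigcup_i (P i `&` (FI i @^-1` B)).
  apply/seteqP; split => [z Bz|z [i _ [Pi]]] /=; last by rewrite -FE.
  by have [i Pi] := cP z; exists i => //=; split => //=; rewrite -FE.
apply: countable_bigcupT_measurable => // i.
by apply: measurableI => //; rewrite -[X in measurable X]setTI; exact: mF.
Qed.

End MeasurablePiecewise.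

Section MeasurePreserving.
Context {R : realType}.
Notation leb := (@lebesgue_measure R).
Notation leb2 := ((@lebesgue_measure R \x @lebesgue_measure R)%E).
Implicit Types (f g : R * R -> R * R) (k c : R).

Lemma measurable_affine k c : measurable_fun [set: R] (fun x : R => k * x + c).
Proof. by apply: measurable_funD => //; apply: measurable_funM. Qed.

Lemma lebesgue_affine k c (A : set R) : 0 < k -> measurable A ->
  leb ((fun x => k * x + c) @^-1` A) = ((k^-1)%:E * leb A)%E.
Proof.
move=> k0 mA.
pose h : R -> R := fun x => k * x + c.
have mh : measurable_fun [set: measurableTypeR R] (h : measurableTypeR R -> measurableTypeR R).
  exact: measurable_affine.
have kn : 0 <= k by exact: ltW.
pose P : {measure set (measurableTypeR R) -> \bar R} :=
  measure_function_pushforward__canonical__measure_function_Measure leb mh.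
pose mu := mscale (NngNum kn) P.
have E : leb A = mu A.
  apply: lebesgue_measure_unique => // X /ocitvP[->|[x x12 ->]].
    by rewrite !measure0.
  rewrite /mu /= /mscale /P /= /pushforward /=.
  have -> : (fun t : R => k * t + c) @^-1` `]x.1, x.2]%classic = `](x.1 - c) / k, (x.2 - c) / k]%classic.
    apply/seteqP; split => t /=; rewrite /h !in_itv /= ltr_pdivrMr// ler_pdivlMr//;
      rewrite ltrBlDr lerBrDr mulrC //.
  rewrite !lebesgue_measure_itv/= !lte_fin x12.
  rewrite ltr_pM2r ?invr_gt0// ltrD2r x12 -!EFinB -EFinM; congr EFin.
  by field; exact: lt0r_neq0.
rewrite E /mu /= /mscale /P /= /pushforward /= muleA -EFinM mulVf ?mul1e//.
exact: lt0r_neq0.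
Qed.

(** Preservation of area on Borel sets; the passage to the Caratheodory measurable sets
    is [mp_preserves_lebesgue]. *)
Definition measure_preserving f := measurable_fun setT f /\
  forall B, measurable B -> leb2 (f @^-1` B) = leb2 B.

Lemma mp_preimage f B : measure_preserving f -> measurable B ->
  measurable (f @^-1` B).
Proof. by move=> [mf _] mB; rewrite -[X in measurable X]setTI; exact: mf. Qed.

Lemma mp_id : measure_preserving id.
Proof. by split=> // B mB; rewrite preimage_id. Qed.

Lemma mp_comp f g : measure_preserving f -> measure_preserving g ->
  measure_preserving (f \o g).
Proof.
move=> mf mg; split; first exact: measurableT_comp mf.1 mg.1.
move=> B mB; rewrite comp_preimage mg.2 ?mf.2//; exact: mp_preimage.
Qed.

(** By Fubini, since each vertical fibre is merely translated. Shears and translations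
    are the elementary maps from which all the others are composed. *)
Lemma mp_fiber_translation (h : R -> R) : measurable_fun setT h ->
  measure_preserving (fun z => (z.1, z.2 + h z.1)).
Proof.
move=> mh; split.
  apply: measurable_fun_pair => /=; first exact: measurable_fst.
  apply: measurable_funD; first exact: measurable_snd.
  by apply: measurableT_comp => //; exact: measurable_fst.
move=> B mB; rewrite /product_measure1; apply: eq_integral => x _ /=.
have -> : xsection ((fun z : R * R => (z.1, z.2 + h z.1)) @^-1` B) x =
    (fun y => 1 * y + h x) @^-1` (xsection B x).
  by apply/seteqP; split => y /=; rewrite /xsection /= !inE /= mul1r.
rewrite lebesgue_affine ?invr1 ?mul1e//; exact: measurable_xsection.
Qed.

Definition swap2 (z : R * R) : R * R := (z.2, z.1).

Lemma mp_swap : measure_preserving swap2.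
Proof.
have ms : measurable_fun setT swap2.
  by apply: measurable_fun_pair => /=; [exact: measurable_snd|exact: measurable_fst].
split; [by []|move=> B mB].
have ms' : measurable_fun [set: (measurableTypeR R * measurableTypeR R)%type]
    (swap2 : _ -> (measurableTypeR R * measurableTypeR R)%type) by exact: ms.
pose P :=
  measure_function_pushforward__canonical__measure_function_Measure leb2 ms'.
rewrite -[LHS]/(P B); apply/esym.
apply: (product_measure_unique (m' := P)) => // A A' mA mA'.
rewrite /P /= /pushforward /=.
have -> : swap2 @^-1` (A `*` A') = A' `*` A.
  by apply/seteqP; split => -[x y] [].
by rewrite product_measure1E//= muleC.
Qed.

Lemma mp_fiber_translation1 (h : R -> R) : measurable_fun setT h ->
  measure_preserving (fun z => (z.1 + h z.2, z.2)).
Proof.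
move=> mh; have := mp_comp mp_swap (mp_comp (mp_fiber_translation mh) mp_swap).
by congr measure_preserving.
Qed.

Lemma mp_translation (v : R * R) : measure_preserving (fun z => z + v).
Proof.
have := mp_comp (mp_fiber_translation (measurable_cst v.2))
  (mp_fiber_translation1 (measurable_cst v.1)).
by congr measure_preserving; apply/funext => -[x y].
Qed.


Section Piecewise.
Context {I : countType} (P : I -> set (R * R)) (L L' : I -> R * R -> R * R)
  (T : R * R -> R * R).
Hypotheses (mP : forall i, measurable (P i)) (cP : forall z, exists i, P i z)
  (tP : forall i j z, P i z -> P j z -> i = j)
  (mL : forall i, measure_preserving (L i))
  (mL' : forall i, measurable_fun setT (L' i))
  (TL : forall i z, P i z -> T z = L i z).

Let PI := fun n : nat => if pickle_inv n is Some i then P i else set0.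

Let cPI : \bigcup_n PI n = setT.
Proof.
apply/seteqP; split => // z _; have [i Pi] := cP z.
by exists (pickle i) => //; rewrite /PI pickleK_inv.
Qed.

(** A bijection that agrees, on each piece of a countable partition, with an invertible
    area preserving map: the preimage of a set is the disjoint union of its parts in the
    pieces, and the images of these parts are disjoint because the map is injective. *)
Lemma mp_piecewise : (forall i, cancel (L i) (L' i)) ->
  (forall i, cancel (L' i) (L i)) -> bijective T -> measure_preserving T.
Proof.
move=> LK LK' [T' TK TK'].
have mT : measurable_fun setT T.
  apply: (measurable_piecewise mP cP (FI := L)) => // i.
  exact: (mL i).1.
split; [by []|move=> B mB].
have mPI n : measurable (PI n) by rewrite /PI; case: pickle_inv.
have tPI : trivIset setT PI.
  apply/trivIsetP => i j _ _ ij; apply/seteqP; split => // z [].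
  rewrite /PI; case Ei : (pickle_inv i) => [i'|//]; case Ej : (pickle_inv j) => [j'|//].
  move=> Pi Pj; have /eqP := ij; apply.
  have := @pickle_invK I i; have := @pickle_invK I j. rewrite Ei Ej /= => <- <-.
  by rewrite (tP Pi Pj).
pose QI n := T' @^-1` PI n.
have QE n : QI n = if pickle_inv n is Some i then L' i @^-1` P i else set0.
  rewrite /QI /PI; case: pickle_inv => [i|]; last by rewrite preimage_set0.
  apply/seteqP; split => z /= Pz.
    by have := TL Pz; rewrite TK' => ->; rewrite LK.
  by have := TL Pz; rewrite LK' => <-; rewrite TK.
have mQI n : measurable (QI n).
  rewrite QE; case: pickle_inv => [i|//]; rewrite -[X in measurable X]setTI.
  exact: mL'.
have tQI : trivIset setT QI.
  apply/trivIsetP => i j _ _ ij; rewrite -preimage_setI.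
  by move/trivIsetP : tPI => /(_ _ _ Logic.I Logic.I ij) ->; rewrite preimage_set0.
have cQI : \bigcup_n QI n = setT by rewrite -preimage_bigcup cPI preimage_setT.
have mTB : measurable (T @^-1` B) by rewrite -[X in measurable X]setTI; exact: mT.
have split_measure (F : nat -> set (R * R)) (A : set (R * R)) :
    (forall n, measurable (F n)) -> trivIset setT F -> \bigcup_n F n = setT ->
    measurable A -> leb2 A = (\sum_(n <oo) leb2 (F n `&` A))%E.
  move=> mF tF cF mA; rewrite -{1}(setTI A) -cF setI_bigcupl.
  apply: measure_semi_bigcup.
  - by move=> n; exact (measurableI _ _ (mF n) mA).
  - exact: trivIset_setIr.
  - by rewrite -setI_bigcupl cF setTI; exact mA.
rewrite (split_measure _ _ mPI tPI cPI mTB) (split_measure _ _ mQI tQI cQI mB).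
apply: eq_eseriesr => n _; rewrite QE /PI; case: pickle_inv => [i|]; last by rewrite !set0I.
have -> : P i `&` T @^-1` B = L i @^-1` (L' i @^-1` P i `&` B).
  apply/seteqP; split => z /= [].
    by move=> Pi; rewrite (TL Pi) LK.
  by rewrite LK => Pi; rewrite (TL Pi).
rewrite (mL i).2//; apply: measurableI => //.
by rewrite -[X in measurable X]setTI; exact: mL'.
Qed.

End Piecewise.

End MeasurePreserving.

(** * From Borel sets to Lebesgue measurable sets *)

Section PreservesLebesgue.
Context {R : realType}.
Notation leb2 := ((@lebesgue_measure R \x @lebesgue_measure R)%E).
Implicit Types (f g : R * R -> R * R).

Lemma area_borel (B : set (R * R)) : measurable B -> area B = leb2 B.
Proof. by move=> mB; rewrite /area measurable_mu_extE. Qed.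

(** The preimages of a Borel cover form a Borel cover of the same total area. *)
Lemma area_preimage_le f A : measure_preserving f ->
  (area (f @^-1` A) <= area A)%E.
Proof.
move=> mf; apply: le_ereal_inf_tmp => _ [F [mF AF] <-].
apply: ereal_inf_lbound; exists (fun k => f @^-1` F k).
  split=> [i|]; first exact (mp_preimage mf (mF i)).
  by rewrite -preimage_bigcup; exact: preimage_subset.
by apply: eq_eseriesr => k _; exact (mf.2 _ (mF k)).
Qed.

Lemma area_le A B : A `<=` B -> (@area R A <= area B)%E.
Proof. exact: le_mu_ext. Qed.

Lemma area_ge0 A : (0 <= @area R A)%E.
Proof. exact: mu_ext_ge0. Qed.

(** Intersect Borel covers whose areas approach the outer measure. *)
Lemma area_hull A : exists G : set (R * R),
  [/\ measurable G, A `<=` G & leb2 G = area A].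
Proof.
have [Ay|Afin] := eqVneq (area A) +oo%E.
  exists setT; split => //; apply/eqP; rewrite Ay eq_le leey /= -Ay.
  by rewrite -area_borel//; exact: area_le.
have fin : area A \is a fin_num.
  by rewrite ge0_fin_numE ?area_ge0// lt_neqAle Afin leey.
have step n : exists G : set (R * R), [/\ measurable G, A `<=` G &
    (leb2 G <= area A + (n.+1%:R^-1)%:E)%E].
  have [|_ [F [mF AF] <-] lF] := @lb_ereal_inf_adherent R _ n.+1%:R^-1 _ fin.
    by rewrite invr_gt0.
  exists (\bigcup_k F k); split => //.
    by apply: bigcupT_measurable => k; exact: mF.
  apply: le_trans (ltW lF); apply: measure_sigma_subadditive => //.
  by apply: bigcupT_measurable => k; exact: mF.
pose G n := sval (cid (step n)).
have GP n : [/\ measurable (G n), A `<=` G n &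
    (leb2 (G n) <= area A + (n.+1%:R^-1)%:E)%E] by rewrite /G; case: cid.
have mG : measurable (\bigcap_n G n).
  by apply: bigcapT_measurable => n; have [] := GP n.
exists (\bigcap_n G n); split => //; first by move=> x Ax n _; have [_ AG _] := GP n; exact: AG.
apply/eqP; rewrite eq_le; apply/andP; split; last first.
  by rewrite -area_borel//; apply: area_le => x Ax n _; have [_ AG _] := GP n; exact: AG.
apply/lee_addgt0Pr => e e0.
have [n ne] : exists n : nat, n.+1%:R^-1 < e.
  by have [n _ /(_ _ (leqnn n))] := near_infty_natSinv_lt (PosNum e0); exists n.
have [mGn _ Gn] := GP n; apply: (le_trans _ (le_trans Gn _)).
  by apply: le_measure; rewrite ?inE//; exact: bigcap_inf.
by rewrite leeD2l// lee_fin ltW.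
Qed.

Lemma lebesgue_measurable2_null (N : set (R * R)) : area N = 0%E ->
  lebesgue_measurable2 N.
Proof.
move=> N0; apply: le_caratheodory_measurable => X.
set u := (X in (X + _ <= _)%E); have -> : u = 0%E.
  apply/eqP; rewrite eq_le; apply/andP; split; last exact: area_ge0.
  by rewrite -N0; apply: area_le; exact: subIsetr.
rewrite add0e; apply: le_mu_ext; exact: subIsetl.
Qed.

Let F (k : nat) : set (R * R) :=
  `[- k%:R, k%:R]%classic `*` `[- k%:R, k%:R]%classic.

Let F_T : \bigcup_k F k = setT.
Proof.
apply/seteqP; split => // -[x y] _.
exists (Num.truncn (Num.max `|x| `|y|)).+1 => //; rewrite /F /= !in_itv /= -!ler_norml.
have := truncnS_gt (Num.max `|x| `|y|); set k := (_.+1)%:R => h.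
by split; apply: ltW (le_lt_trans _ h); rewrite le_max lexx ?orbT.
Qed.

Let mF k : measurable (F k). Proof. exact: measurableX. Qed.

Let finF k : (leb2 (F k) < +oo)%E.
Proof.
rewrite product_measure1E//= !lebesgue_measure_itv /=; case: ifP => _.
  by rewrite -!EFinD -EFinM ltry.
by rewrite mul0e ltry.
Qed.

(** Cut the plane into squares; inside each of them remove from the square a Borel hull of
    the complement of [A]. What is lost is null by the Caratheodory criterion. *)
Lemma lebesgue_measurable2_decomp A : lebesgue_measurable2 A ->
  exists B N : set (R * R), [/\ measurable B, area N = 0%E & A = B `|` N].
Proof.
move=> cA.
have hull k : exists G : set (R * R), [/\ measurable G, F k `\` A `<=` G &
    leb2 G = area (F k `\` A)] by exact: area_hull.
pose G k := sval (cid (hull k)).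
have GP k : [/\ measurable (G k), F k `\` A `<=` G k &
    leb2 (G k) = area (F k `\` A)] by rewrite /G; case: cid.
exists (\bigcup_k (F k `\` G k)), (\bigcup_k (F k `&` G k `&` A)); split.
- by apply: bigcupT_measurable => k; apply: measurableD => //; have [] := GP k.
- apply/eqP; rewrite eq_le area_ge0 andbT.
  apply: (le_trans (outer_measure_sigma_subadditive (leb2^*)%mu _)).
  rewrite eseries0// => k _ _; have [mG AG GE] := GP k.
  have uvw : (area (F k `&` G k) = area (F k `&` G k `&` A) +
    area (F k `&` G k `&` ~` A))%E by exact: cA.
  have finA : area (F k `\` A) \is a fin_num.
    rewrite ge0_fin_numE ?area_ge0//; apply: le_lt_trans (finF k).
    by rewrite -area_borel//; apply: area_le; exact: subDsetl.
  move: uvw; set u := area (F k `&` G k); set v := area (_ `&` A).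
  set w := area (_ `&` _) => uvw.
  have uF : (u <= area (F k `\` A))%E.
    by rewrite -GE -area_borel//; apply: area_le; exact: subIsetr.
  have wF : (area (F k `\` A) <= w)%E.
    by apply: area_le => z [Fz Az]; split => //; split => //; apply: AG.
  apply/eqP; rewrite eq_le; apply/andP; split; last exact: area_ge0.
  have := le_trans uF wF; rewrite uvw.
  have wfin : w \is a fin_num.
    rewrite ge0_fin_numE; last exact: area_ge0.
    apply: le_lt_trans (finF k).
    rewrite -area_borel//; apply: area_le => z [[]] //.
  by rewrite -leeBrDr// subee.
- rewrite -bigcupU; apply/seteqP; split => [z Az|z [k _ [[Fz Gz]|[]//]]].
    have : (\bigcup_k F k) z by rewrite F_T.
    move=> [k _ Fz]; exists k => //.
    by case: (pselect (G k z)) => Gz; [right|left].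
  have [_ AG _] := GP k; apply: contrapT => Az; apply: Gz; exact: AG.
Qed.

(** The preimage of a null set is null by [area_preimage_le], and a measurable set is
    a Borel set up to a null set. *)
Lemma mp_preserves_lebesgue f : measure_preserving f -> preserves_lebesgue f.
Proof.
move=> mf A /lebesgue_measurable2_decomp[B [N [mB N0 ->]]].
have fN0 : area (f @^-1` N) = 0%E.
  by apply/eqP; rewrite eq_le area_ge0 andbT -N0; exact: area_preimage_le.
have mfB := mp_preimage mf mB.
have addN (B' N' : set (R * R)) : area N' = 0%E -> area (B' `|` N') = area B'.
  move=> N'0; apply/eqP; rewrite eq_le; apply/andP; split.
    by apply: (le_trans (outer_measureU2 (leb2^*)%mu _ _)); rewrite [X in (_ + X)%E]N'0 adde0.
  by apply: area_le; exact: subsetUl.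
rewrite preimage_setU; split; last first.
  by rewrite !addN// !area_borel// mf.2.
apply: caratheodory_measurable_setU; last exact: lebesgue_measurable2_null.
exact: caratheodory_measurable_mu_ext.
Qed.

End PreservesLebesgue.

(** * Rotation along concentric squares *)

Section Rotation.
Context {R : realType}.
Implicit Types (z w : R * R) (r t s x y : R).

Definition qturn z : R * R := (- z.2, z.1).
Definition qturnV z : R * R := (z.2, - z.1).

(** The boundary of the square of radius [r], travelled counterclockwise from the corner
    [(r, - r)] at [x = - 1]; each side takes time [2], so that a quarter turn adds [2] to
    [x] and the period is [8]. *)
Definition sqcurve r x : R * R :=
  let m := Num.truncn ((x + 1) / 2) in iter m qturn (r, r * (x - 2 * m%:R)).

Definition sqnorm z : R := Num.max `|z.1| `|z.2|.

(** The quarter of the plane seen from the origin through the right side of the squares;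
    it contains its lower boundary ray but not its upper one, so that the four quarter
    turns of it partition the punctured plane. *)
Definition right_sector z : bool := - z.1 <= z.2 < z.1.

Definition sqangle z : R :=
  if right_sector z then z.2 / z.1
  else if right_sector (qturnV z) then 2 - z.1 / z.2
  else if right_sector (- z) then 4 + z.2 / z.1
  else 6 - z.1 / z.2.

Definition sqrot t z : R * R := sqcurve (sqnorm z) (sqangle z + t).

(** The velocity of the rotation: parallel to the side of the square through [z]. It
    jumps across the diagonals, which is why trajectories are only one-sidedly affine. *)
Definition sqvel z : R * R :=
  if right_sector z || right_sector (- z) then (0, z.1) else (- z.2, 0).

Lemma qturnK : cancel qturn qturnV.
Proof. by case=> x y; rewrite /qturn /qturnV /= opprK. Qed.

Lemma qturnVK : cancel qturnV qturn.
Proof. by case=> x y; rewrite /qturn /qturnV /= opprK. Qed.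

Lemma qturn4 z : qturn (qturn (qturn (qturn z))) = z.
Proof. by case: z => x y; rewrite /qturn /= !opprK. Qed.

Lemma qturn2 z : qturn (qturn z) = - z.
Proof. by case: z => x y. Qed.

Lemma qturnD z w : qturn (z + w) = qturn z + qturn w.
Proof. by case: z w => [x y] [x' y']; rewrite /qturn /= opprD. Qed.

Lemma qturnZ r z : qturn (r *: z) = r *: qturn z.
Proof. by case: z => [x y]; rewrite /qturn /= -mulrN. Qed.

Lemma qturn_iterD m z w : iter m qturn (z + w) = iter m qturn z + iter m qturn w.
Proof. by elim: m => //= m ->; rewrite qturnD. Qed.

Lemma qturn_iterZ m r z : iter m qturn (r *: z) = r *: iter m qturn z.
Proof. by elim: m => //= m ->; rewrite qturnZ. Qed.

Lemma sqcurve_piece (m : nat) r x : 2 * m%:R - 1 <= x <= 2 * m%:R + 1 ->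
  sqcurve r x = iter m qturn (r, r * (x - 2 * m%:R)).
Proof.
move=> /andP[mx]; rewrite le_eqVlt => /predU1P[->|xm]; rewrite /sqcurve.
  have -> : Num.truncn ((2 * m%:R + 1 + 1) / 2 : R) = m.+1.
    have -> : (2 * m%:R + 1 + 1) / 2 = m.+1%:R :> R by rewrite -[m.+1%:R]natr1; lra.
    exact: natrK.
  by rewrite iterSr -[m.+1%:R]natr1 /qturn /=; congr (iter m _ (_, _)); ring.
suff -> : Num.truncn ((x + 1) / 2) = m by [].
have m0 : 0 <= m%:R :> R by [].
have x0 : 0 <= (x + 1) / 2 by lra.
apply/eqP; rewrite truncn_eq//.
by rewrite -[m.+1%:R]natr1; lra.
Qed.

Lemma nat_bracket x : -1 <= x -> exists m : nat, 2 * m%:R - 1 <= x < 2 * m%:R + 1.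
Proof.
move=> x1; exists (Num.truncn ((x + 1) / 2)).
have h : 0 <= (x + 1) / 2 by lra.
have := truncn_itv h; set m := Num.truncn _; rewrite -[m.+1%:R]natr1; lra.
Qed.

Lemma sqcurveS r x : -1 <= x -> sqcurve r (x + 2) = qturn (sqcurve r x).
Proof.
move=> /nat_bracket[m mx]; rewrite (@sqcurve_piece m.+1) -?[m.+1%:R]natr1; last by lra.
by rewrite (@sqcurve_piece m) /=; [do 3 congr (_ _); ring|lra].
Qed.

Lemma sqcurve_base r x : -1 <= x <= 1 -> sqcurve r x = (r, r * x).
Proof. by move=> h; rewrite (@sqcurve_piece 0) ?mulr0 ?subr0//=; lra. Qed.

Lemma sqcurve8 r x : -1 <= x -> sqcurve r (x + 8) = sqcurve r x.
Proof.
move=> x1; have -> : x + 8 = x + 2 + 2 + 2 + 2 by ring.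
by rewrite !sqcurveS ?qturn4//; lra.
Qed.

Lemma sqcurve8n r x (n : nat) : -1 <= x -> sqcurve r (x + n%:R * 8) = sqcurve r x.
Proof.
move=> x1; elim: n => [|n IH]; first by rewrite mul0r addr0.
rewrite -[n.+1%:R]natr1 mulrDl mul1r addrA sqcurve8//.
by have : 0 <= n%:R :> R by []; lra.
Qed.

Lemma sqnorm_ge0 z : 0 <= sqnorm z.
Proof. by rewrite /sqnorm le_max normr_ge0. Qed.

Lemma sqnorm_qturn z : sqnorm (qturn z) = sqnorm z.
Proof. by rewrite /sqnorm /qturn /= normrN maxC. Qed.

Lemma sqnorm_curve r x : 0 <= r -> -1 <= x -> sqnorm (sqcurve r x) = r.
Proof.
move=> r0 /nat_bracket[m mx]; rewrite (@sqcurve_piece m); last by lra.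
have -> w : sqnorm (iter m qturn w) = sqnorm w.
  by elim: m {mx} => //= m IH; rewrite sqnorm_qturn.
rewrite /sqnorm /=; set y := x - _; rewrite (ger0_norm r0); apply/max_idPl.
have : `|y| <= 1 by rewrite ler_norml /y; lra.
by rewrite normrM (ger0_norm r0) => h; rewrite ler_piMr.
Qed.

Lemma sqnorm_eq0 z : sqnorm z = 0 -> z = 0.
Proof.
case: z => x y; rewrite /sqnorm /= => h.
have : `|x| <= 0 by rewrite -h le_max lexx.
have : `|y| <= 0 by rewrite -h le_max lexx orbT.
by rewrite !normr_le0 => /eqP -> /eqP ->.
Qed.

Lemma sqangle_qturn z : z != 0 -> right_sector z ->
  [/\ sqangle z = z.2 / z.1, sqangle (qturn z) = 2 + z.2 / z.1,
    sqangle (qturn (qturn z)) = 4 + z.2 / z.1 &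
    sqangle (qturn (qturn (qturn z))) = 6 + z.2 / z.1].
Proof.
case: z => x y _; rewrite /sqangle /right_sector /qturn /qturnV /= => xy.
have NN : - (- x, - y) = (x, y) :> R * R by rewrite -[LHS]/(- - x, - - y) !opprK.
rewrite !opprK xy; split => //.
- rewrite (_ : (_ <= x < _) = false); last by lra.
  by rewrite mulNr opprK.
- rewrite (_ : (_ <= - y < - x) = false); last by lra.
  rewrite (_ : (_ <= _ < - y) = false); last by lra.
  by rewrite invrN mulrNN.
- rewrite (_ : (_ <= - x < y) = false); last by lra.
  rewrite (_ : (x <= - y < _) = false); last by lra.
  rewrite (_ : (_ <= x < _) = false); last by lra.
  by rewrite invrN mulrN opprK.
Qed.

Lemma sqangle_curve0 r x : 0 < r -> -1 <= x < 7 -> sqangle (sqcurve r x) = x.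
Proof.
move=> r0 x17.
have key y : -1 <= y < 1 -> [/\ sqangle (sqcurve r y) = y,
  sqangle (sqcurve r (y + 2)) = y + 2, sqangle (sqcurve r (y + 4)) = y + 4 &
  sqangle (sqcurve r (y + 6)) = y + 6].
  move=> y1; have -> : y + 6 = y + 2 + 2 + 2 by ring.
  have -> : y + 4 = y + 2 + 2 by ring.
  rewrite !sqcurveS; try lra; rewrite sqcurve_base; last by lra.
  have rs : right_sector (r, r * y).
    rewrite /right_sector /=; apply/andP; split; last by rewrite gtr_pMr//; lra.
    by rewrite -mulN1r mulrC ler_pM2l//; lra.
  have [|A B C D] := @sqangle_qturn (r, r * y) _ rs.
    by apply/eqP => -[r00 _]; move: r0; rewrite r00 ltxx.
  have e : r * y / r = y by rewrite mulrC mulKf//; exact: lt0r_neq0.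
  by rewrite A B C D /= e; split; ring.
have [h1|h1] := ltP x 1; first by have [] := key x; [lra|].
have [h3|h3] := ltP x 3; first by have [|_ + _ _] := key (x - 2); [lra|rewrite subrK].
have [h5|h5] := ltP x 5; first by have [|_ _ + _] := key (x - 4); [lra|rewrite subrK].
by have [|_ _ _] := key (x - 6); [lra|rewrite subrK].
Qed.

Lemma sqangle_curve r x : 0 < r -> -1 <= x ->
  exists n : nat, x = sqangle (sqcurve r x) + n%:R * 8.
Proof.
move=> r0 x1; have h : 0 <= (x + 1) / 8 by lra.
have := truncn_itv h; set n := Num.truncn _ => nx; exists n.
have {2}-> : x = (x - n%:R * 8) + n%:R * 8 by rewrite subrK.
rewrite sqcurve8n; last by lra.
by rewrite sqangle_curve0 ?subrK//; move: nx; rewrite -[n.+1%:R]natr1; lra.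
Qed.

Lemma right_sector_cover z : z != 0 -> [\/ right_sector z, right_sector (qturnV z),
  right_sector (- z) | right_sector (qturn z)].
Proof.
case: z => x y; rewrite /right_sector /qturn /qturnV /= ?opprK => z0.
have {}z0 : x != 0 \/ y != 0.
  have [x0|x0] := eqVneq x 0; [right|by left].
  by apply: contra_neq z0 => y0; rewrite x0 y0.
have [h1|h1] := boolP (- x <= y < x); first by constructor 1.
have [h2|h2] := boolP (- y <= - x < y); first by constructor 2.
have [h3|h3] := boolP (x <= - y < - x); first by constructor 3.
by constructor 4; case: z0 => /eqP z0; lra.
Qed.

(** The pair ([sqnorm], [sqangle]) is a system of polar coordinates for squares. *)
Lemma sqpolar z : z = sqcurve (sqnorm z) (sqangle z) /\ -1 <= sqangle z < 7.
Proof.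
have [->|z0] := eqVneq z 0.
  have -> : sqnorm 0 = 0 :> R by rewrite /sqnorm /= normr0 maxxx.
  rewrite /sqangle /right_sector /qturnV /= !oppr0 ltxx andbF mul0r subr0.
  split; last by lra.
  have -> : (6 : R) = 0 + 2 + 2 + 2 by ring.
  by rewrite !sqcurveS ?sqcurve_base /qturn /= ?(mulr0, oppr0)//; lra.
have base w : right_sector w -> [/\ w = sqcurve (sqnorm w) (w.2 / w.1), w != 0 &
    -1 <= w.2 / w.1 < 1].
  case: w => x y; rewrite /right_sector /= => xy.
  have x0 : 0 < x by lra.
  have yx : -1 <= y / x < 1 by rewrite ler_pdivlMr// ltr_pdivrMr//; lra.
  split => //; last by apply/eqP => -[]; lra.
  rewrite sqcurve_base; last by lra.
  have -> : sqnorm (x, y) = x.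
    by rewrite /sqnorm /= (gtr0_norm x0); apply/max_idPl; rewrite ler_norml; lra.
  by rewrite mulrC divfK//; exact: lt0r_neq0.
pose Q w := w = sqcurve (sqnorm w) (sqangle w) /\ -1 <= sqangle w < 7.
have turns w : right_sector w -> [/\ Q w, Q (qturn w), Q (qturn (qturn w)) &
    Q (qturn (qturn (qturn w)))].
  move=> h; have [E w0 w1] := base _ h; have [A1 A2 A3 A4] := sqangle_qturn w0 h.
  rewrite /Q A1 A2 A3 A4 !sqnorm_qturn; set y := _ / _ in w1 E *.
  have -> : 6 + y = y + 2 + 2 + 2 by ring.
  have -> : 4 + y = y + 2 + 2 by ring.
  have -> : 2 + y = y + 2 by ring.
  by rewrite !sqcurveS -?E//; try lra; split; split => //; lra.
rewrite -/(Q z); have [h|h|h|h] := right_sector_cover z0.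
- by have [] := turns _ h.
- by have [_ + _ _] := turns _ h; rewrite qturnVK.
- by have [_ _ + _] := turns _ h; rewrite qturn2 opprK.
- by have [_ _ _] := turns _ h; rewrite qturn4.
Qed.

Lemma sqnorm_rot t z : 0 <= t -> sqnorm (sqrot t z) = sqnorm z.
Proof.
by move=> t0; have [_ h] := sqpolar z; rewrite sqnorm_curve ?sqnorm_ge0//; lra.
Qed.

Lemma sqrot_add s t z : 0 <= s -> 0 <= t -> sqrot s (sqrot t z) = sqrot (t + s) z.
Proof.
move=> s0 t0; rewrite {1}/sqrot sqnorm_rot// /sqrot addrA.
have [_ zz] := sqpolar z.
have [r0|] := ltP 0 (sqnorm z).
  have [|n nE] := @sqangle_curve (sqnorm z) (sqangle z + t) r0; first by lra.
  rewrite {2}nE addrAC sqcurve8n//.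
  by have [_ h] := sqpolar (sqcurve (sqnorm z) (sqangle z + t)); lra.
move=> r0; have {}r0 : sqnorm z = 0 by apply/eqP; rewrite eq_le r0 sqnorm_ge0.
have c0 x : -1 <= x -> sqcurve 0 x = 0.
  move=> x1; apply: sqnorm_eq0; exact: sqnorm_curve.
rewrite r0 !c0//; try lra.
by have [_ h] := sqpolar (0 : R * R); lra.
Qed.

Lemma sqrot0 z : sqrot 0 z = z.
Proof. by rewrite /sqrot addr0; have [<- _] := sqpolar z. Qed.

Lemma sqrot8 z : sqrot 8 z = z.
Proof.
by have [h h'] := sqpolar z; rewrite {2}h /sqrot sqcurve8//; lra.
Qed.

(** Half a period is the point reflection: the only value of the rotation on which the
    final map of a mixing stage depends. *)
Lemma sqrot4 z : sqrot 4 z = - z.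
Proof.
have [h h'] := sqpolar z; rewrite {2}h -qturn2 /sqrot.
by rewrite (_ : _ + 4 = sqangle z + 2 + 2); [rewrite !sqcurveS//; lra|ring].
Qed.

Lemma sqrotK t : 0 <= t <= 8 -> cancel (sqrot t) (sqrot (8 - t)).
Proof.
move=> t8 z; by rewrite sqrot_add; [rewrite addrC subrK sqrot8|lra|lra].
Qed.

Lemma sqrotVK t : 0 <= t <= 8 -> cancel (sqrot (8 - t)) (sqrot t).
Proof. by move=> t8 z; rewrite sqrot_add; [rewrite subrK sqrot8|lra|lra]. Qed.

Lemma sqvel_qturn z : sqvel (qturn z) = qturn (sqvel z).
Proof.
case: z => x y; rewrite /sqvel /right_sector /qturn /= ?opprK.
case: ifPn => h; case: ifPn => h' //=; rewrite ?oppr0 //.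
  by congr pair; lra.
by congr pair; lra.
Qed.

Lemma sqvel_curve (m : nat) r x : 0 <= r -> 2 * m%:R - 1 <= x < 2 * m%:R + 1 ->
  sqvel (sqcurve r x) = iter m qturn (0, r).
Proof.
move=> r0 mx; rewrite (@sqcurve_piece m); last by lra.
have -> w : sqvel (iter m qturn w) = iter m qturn (sqvel w).
  by elim: m {mx} => //= m IH; rewrite sqvel_qturn IH.
congr (iter m qturn _); rewrite /sqvel /right_sector /=.
set y := x - _; have y1 : -1 <= y < 1 by rewrite /y; lra.
have [->|rn] := eqVneq r 0; first by rewrite !mul0r oppr0 ltxx lexx /= ?oppr0 if_same.
have rp : 0 < r by rewrite lt_neqAle eq_sym rn.
by have -> : - r <= r * y < r by apply/andP; split; nra.
Qed.

Lemma sqcurve_affine (m : nat) r x s :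
  2 * m%:R - 1 <= x <= 2 * m%:R + 1 -> 2 * m%:R - 1 <= x + s <= 2 * m%:R + 1 ->
  sqcurve r (x + s) = sqcurve r x + s *: iter m qturn (0, r).
Proof.
move=> h1 h2; rewrite (@sqcurve_piece m)// (@sqcurve_piece m)//.
rewrite -qturn_iterZ -qturn_iterD; congr (iter m qturn _).
rewrite -[RHS]/(r + s * 0, r * (x - 2 * m%:R) + s * r).
by congr pair; ring.
Qed.

(** A point stays for a while on its side of the square, and at a corner it enters the
    next side; both are covered by the half-open sectors. *)
Lemma sqrot_right z : exists2 e : R, 0 < e & forall s, 0 <= s < e ->
  sqrot s z = z + s *: sqvel z /\ sqvel (sqrot s z) = sqvel z.
Proof.
have [zE z1] := sqpolar z.
have [|m mz] := @nat_bracket (sqangle z); first by lra.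
exists (2 * m%:R + 1 - sqangle z); first by lra.
have vz : sqvel z = iter m qturn (0, sqnorm z).
  by rewrite {1}zE (@sqvel_curve m)// sqnorm_ge0.
move=> s s0; rewrite vz {2}zE /sqrot -(@sqcurve_affine m); [|lra|lra].
by split => //; rewrite (@sqvel_curve m) ?sqnorm_ge0//; lra.
Qed.

Lemma sqrot_left t z : 0 < t -> exists2 e : R, 0 < e & exists v, forall s, 0 <= s < e ->
  sqrot (t - s) z = sqrot t z - s *: v.
Proof.
move=> t0; have [zE z1] := sqpolar z.
have [m mz] : exists m : nat, 2 * m%:R - 1 < sqangle z + t <= 2 * m%:R + 1.
  have [|m mz] := @nat_bracket (sqangle z + t); first by lra.
  have [e|ne] := eqVneq (2 * m%:R - 1) (sqangle z + t).
    case: m => [|m] in mz e *; first by lra.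
    by exists m; move: e mz; rewrite -[m.+1%:R]natr1; lra.
  by exists m; move: mz; rewrite le_eqVlt (negPf ne) /=; lra.
exists (Num.min t (sqangle z + t - (2 * m%:R - 1))); first by rewrite lt_min; lra.
exists (iter m qturn (0, sqnorm z)) => s; rewrite lt_min => s0.
by rewrite /sqrot addrA -scaleNr -(@sqcurve_affine m)//; lra.
Qed.

End Rotation.

(** * The square rotation preserves area *)

Section RotationMeasure.
Context {R : realType}.
Implicit Types (z w : R * R) (r t s x y : R).

Lemma measurable_bool_set d (T : measurableType d) (b : T -> bool) :
  measurable_fun setT b -> measurable [set z | b z].
Proof.
move=> mb; have -> : [set z | b z] = setT `&` b @^-1` [set true].
  by rewrite setTI; apply/seteqP; split => z /=.
exact: mb.
Qed.

Lemma mp_shear c : measure_preserving (fun z : R * R => (z.1, z.2 + c * z.1)).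
Proof. by apply: (@mp_fiber_translation _ (fun x => c * x)); exact: measurable_funM. Qed.

Lemma mp_shear1 c : measure_preserving (fun z : R * R => (z.1 + c * z.2, z.2)).
Proof. by apply: (@mp_fiber_translation1 _ (fun x => c * x)); exact: measurable_funM. Qed.

Lemma mp_qturn : measure_preserving (@qturn R).
Proof.
have := mp_comp (mp_shear1 (- 1)) (mp_comp (mp_shear 1) (mp_shear1 (- 1))).
by congr measure_preserving; apply/funext => -[x y]; rewrite /qturn /=; congr pair; ring.
Qed.

Lemma mp_iter f m : measure_preserving f -> @measure_preserving R (iter m f).
Proof. by move=> mf; elim: m => [|m IH]; [exact: mp_id|exact: mp_comp]. Qed.

Lemma mp_qturnV : measure_preserving (@qturnV R).
Proof.
have := mp_iter 3 mp_qturn; congr measure_preserving.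
by apply/funext => -[x y]; rewrite /qturn /qturnV /= opprK.
Qed.

Lemma iter_cancel (T : Type) (f g : T -> T) m : cancel f g -> cancel (iter m f) (iter m g).
Proof. by move=> fK; elim: m => // m IH x; rewrite [iter m.+1 g _]iterSr /= fK IH. Qed.

(** The points of the sector [k] which after time [t] lie on the side [m]; the origin is
    a piece of its own. *)
Let piece t (km : option (nat * nat)) : set (R * R) :=
  if km is Some (k, m) then
    [set z | (k < 4)%N /\ let w := iter k qturnV z in
      - w.1 <= w.2 < w.1 /\ (2 * m%:R - 1 - 2 * k%:R - t) * w.1 <= w.2 <
        (2 * m%:R + 1 - 2 * k%:R - t) * w.1]
  else [set 0].

Let sqangle_sector (k : nat) z : (k < 4)%N -> let w := iter k qturnV z in
  right_sector w -> sqangle z = 2 * k%:R + w.2 / w.1 /\ sqnorm z = w.1.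
Proof.
move=> k4 w rs.
have zE : z = iter k qturn w by rewrite /w (iter_cancel _ qturnVK).
have w0 : w != 0 by apply/eqP => w0; move: rs; rewrite w0 /right_sector /=; lra.
split.
  have [A B C D] := sqangle_qturn w0 rs.
  rewrite zE; case: (k) k4 => [|[|[|[|//]]]] _ /=; rewrite ?A ?B ?C ?D; lra.
have -> : sqnorm z = sqnorm w.
  by rewrite zE; elim: (k) => //= n IH; rewrite sqnorm_qturn.
move: rs; rewrite /right_sector /sqnorm; move: (w) => -[x y] /= xy.
have x0 : 0 < x by lra.
by rewrite (gtr0_norm x0); apply/max_idPl; rewrite ler_norml; lra.
Qed.

Let shear (c : R) z := (z.1, z.2 + c * z.1).

Let lin t (km : option (nat * nat)) : R * R -> R * R :=
  if km is Some (k, m) then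
    iter m qturn \o shear (2 * k%:R + t - 2 * m%:R) \o iter k qturnV
  else id.

Let linV t (km : option (nat * nat)) : R * R -> R * R :=
  if km is Some (k, m) then
    iter k qturn \o shear (- (2 * k%:R + t - 2 * m%:R)) \o iter m qturnV
  else id.

Let shearK c : cancel (shear c) (shear (- c)).
Proof. by case=> x y; rewrite /shear /=; congr pair; ring. Qed.

Let mp_lin t km : measure_preserving (lin t km).
Proof.
case: km => [[k m]|]; last exact: mp_id.
apply: mp_comp; last exact: mp_iter _ mp_qturnV.
by apply: mp_comp; [exact: mp_iter _ mp_qturn|exact: mp_shear].
Qed.

Let mp_linV t km : measure_preserving (linV t km).
Proof.
case: km => [[k m]|]; last exact: mp_id.
apply: mp_comp; last exact: mp_iter _ mp_qturnV.
by apply: mp_comp; [exact: mp_iter _ mp_qturn|exact: mp_shear].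
Qed.

Let linK t km : cancel (lin t km) (linV t km).
Proof.
case: km => [[k m]|] z //=.
by rewrite (iter_cancel _ qturnK) shearK (iter_cancel _ qturnVK).
Qed.

Let linVK t km : cancel (linV t km) (lin t km).
Proof.
case: km => [[k m]|] z //=; rewrite (iter_cancel _ qturnK).
by rewrite -{1}(opprK (_ - _)) shearK (iter_cancel _ qturnVK).
Qed.

Let sqrot_piece t km z : 0 <= t -> piece t km z -> sqrot t z = lin t km z.
Proof.
case: km => [[k m]|] t0 /=; last first.
  by move=> ->; apply: sqnorm_eq0; rewrite sqnorm_rot// /sqnorm /= normr0 maxxx.
move=> [k4 [rs tw]]; have [A N] := sqangle_sector k4 rs.
set w := iter k qturnV z in rs tw A N *.
have w0 : 0 < w.1 by lra.
rewrite /sqrot A N (@sqcurve_piece _ m); last first.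
  have : (2 * m%:R - 1 - 2 * k%:R - t) <= w.2 / w.1 < (2 * m%:R + 1 - 2 * k%:R - t).
    by rewrite ler_pdivlMr// ltr_pdivrMr.
  lra.
congr (iter m qturn _); rewrite /shear; congr pair.
by field; exact: lt0r_neq0.
Qed.

Let piece_uniq t km km' z : piece t km z -> piece t km' z -> km = km'.
Proof.
have cover0 k m : ~ piece t (Some (k, m)) 0.
  move=> [k4 [+ _]]; have -> : iter k qturnV 0 = 0 :> R * R.
    by elim: (k) => //= n ->; rewrite /qturnV /= oppr0.
  by rewrite /=; lra.
have bracket (m m' : nat) x : 2 * m%:R - 1 <= x < 2 * m%:R + 1 ->
    2 * m'%:R - 1 <= x < 2 * m'%:R + 1 -> m = m'.
  move=> h h'.
  have mm : (m < m'.+1)%N by rewrite -(ltr_nat R) -[m'.+1%:R]natr1; lra.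
  have mm' : (m' < m.+1)%N by rewrite -(ltr_nat R) -[m.+1%:R]natr1; lra.
  by apply/eqP; rewrite eqn_leq -ltnS mm -ltnS mm'.
case: km km' => [[k m]|] [[k' m']|] //.
- move=> [k4 [rs tw]] [k4' [rs' tw']].
  have [A N] := sqangle_sector k4 rs.
  have [A' N'] := sqangle_sector k4' rs'.
  set w := iter k qturnV z in rs tw A N; set w' := iter k' qturnV z in rs' tw' A' N'.
  have w0 : 0 < w.1 by lra. have w0' : 0 < w'.1 by lra.
  have b : -1 <= w.2 / w.1 < 1 by rewrite ler_pdivlMr// ltr_pdivrMr//; lra.
  have b' : -1 <= w'.2 / w'.1 < 1 by rewrite ler_pdivlMr// ltr_pdivrMr//; lra.
  have kk : k = k' by apply: (bracket _ _ (sqangle z)); [rewrite A|rewrite A']; lra.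
  have c : (2 * m%:R - 1 - 2 * k%:R - t) <= w.2 / w.1 < (2 * m%:R + 1 - 2 * k%:R - t).
    by rewrite ler_pdivlMr// ltr_pdivrMr.
  have c' : (2 * m'%:R - 1 - 2 * k'%:R - t) <= w'.2 / w'.1 < (2 * m'%:R + 1 - 2 * k'%:R - t).
    by rewrite ler_pdivlMr// ltr_pdivrMr.
  by congr (Some (_, _)) => //; apply: (bracket _ _ (sqangle z + t)); [rewrite A|rewrite A']; lra.
- by move=> + z0; rewrite z0 => /cover0.
- by move=> z0; rewrite z0 => /cover0.
Qed.

Let piece_cover t z : 0 <= t -> exists km, piece t km z.
Proof.
move=> t0; have [->|z0] := eqVneq z 0; first by exists None.
have [zE z1] := sqpolar z.
have [|k kz] := @nat_bracket _ (sqangle z); first by lra.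
have [|m mz] := @nat_bracket _ (sqangle z + t); first by lra.
have r0 : 0 < sqnorm z.
  by rewrite lt_neqAle sqnorm_ge0 andbT eq_sym; apply: contra_neq z0 => /sqnorm_eq0.
have k4 : (k < 4)%N by rewrite -(ltr_nat R); lra.
exists (Some (k, m)); split => //.
have -> : iter k qturnV z = (sqnorm z, sqnorm z * (sqangle z - 2 * k%:R)).
  by rewrite {1}zE (@sqcurve_piece _ k) ?(iter_cancel _ qturnK)//; lra.
set N := sqnorm z in r0 *; rewrite /= [N * _]mulrC.
have le c y : (c * N <= y * N) = (c <= y) by rewrite ler_pM2r.
have lt c y : (y * N < c * N) = (y < c) by rewrite ltr_pM2r.
rewrite -{1}[N]mul1r -mulNr -{4}[N]mul1r !le !lt.
by split; lra.
Qed.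

Let measurable_piece t km : measurable (piece t km).
Proof.
case: km => [[k m]|]; last first.
  have -> : piece t None = [set 0] `*` [set 0].
    by apply/seteqP; split => [[x y] [-> ->]|[x y] [/= -> ->]].
  exact: measurableX.
rewrite /piece; case: (ltnP k 4) => k4; last first.
  by rewrite (_ : mkset _ = set0)//; apply/seteqP; split => // z [].
pose B : set (R * R) := [set w | [&& - w.1 <= w.2, w.2 < w.1,
   (2 * m%:R - 1 - 2 * k%:R - t) * w.1 <= w.2 &
   w.2 < (2 * m%:R + 1 - 2 * k%:R - t) * w.1]].
rewrite (_ : mkset _ = iter k qturnV @^-1` B); last first.
  apply/seteqP; split => z /=; rewrite /B /=.
    by move=> [_ [/andP[-> ->] /andP[-> ->]]].
  by move=> /and4P[-> -> -> ->].
have mB : measurable B; last exact: mp_preimage (mp_iter k mp_qturnV) mB.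
have m1 : measurable_fun setT (@fst R R) by exact: measurable_fst.
have m2 : measurable_fun setT (@snd R R) by exact: measurable_snd.
have mc c : measurable_fun setT (fun w : R * R => c * w.1) by exact: measurable_funM.
apply: measurable_bool_set; apply: measurable_and.
  by apply: measurable_fun_ler => //; exact: measurable_funN.
apply: measurable_and; first exact: measurable_fun_ltr.
apply: measurable_and; first exact: measurable_fun_ler.
exact: measurable_fun_ltr.
Qed.

(** Inside a sector the rotation is the linear shear along the side: the height on a side
    grows at a speed proportional to the distance of that side. Hence on each piece the
    rotation is a quarter-turn, a shear and a quarter-turn. *)
Lemma mp_sqrot t : 0 <= t <= 8 -> measure_preserving (@sqrot R t).
Proof.
move=> t8; have t0 : 0 <= t by lra.
apply: (@mp_piecewise _ _ (piece t) (lin t) (linV t)) => //.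
- by move=> z; exact: piece_cover.
- by move=> km km' z; exact: piece_uniq.
- by move=> km; exact: (mp_linV t km).1.
- by move=> km z; exact: sqrot_piece.
- by exists (sqrot (8 - t)); [exact: sqrotK|exact: sqrotVK].
Qed.

End RotationMeasure.

(** * Rotating disjoint rectangular cells *)

Section AffineChart.
Context {R : realType}.
Notation leb := (@lebesgue_measure R).
Notation leb2 := ((@lebesgue_measure R \x @lebesgue_measure R)%E).

Lemma lebesgue2_scale_fiber k c (B : set (R * R)) : 0 < k -> measurable B ->
  leb2 ((fun z : R * R => (z.1, k * z.2 + c)) @^-1` B) = ((k^-1)%:E * leb2 B)%E.
Proof.
move=> k0 mB; rewrite /product_measure1 -ge0_integralZl//.
- apply: eq_integral => x _ /=.
  have -> : xsection ((fun z : R * R => (z.1, k * z.2 + c)) @^-1` B) x =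
      (fun y => k * y + c) @^-1` (xsection B x).
    by apply/seteqP; split => y /=; rewrite /xsection /= !inE /=.
  rewrite lebesgue_affine//; exact: measurable_xsection.
- exact (measurable_fun_xsection leb mB).
- by rewrite lee_fin invr_ge0 ltW.
Qed.

Definition scale_chart (c : R * R) (p q : R) (z : R * R) : R * R :=
  (p * z.1 + c.1, q * z.2 + c.2).
Definition scale_chartV (c : R * R) (p q : R) (z : R * R) : R * R :=
  ((z.1 - c.1) / p, (z.2 - c.2) / q).

Context (c : R * R) (p q : R).
Hypotheses (p0 : 0 < p) (q0 : 0 < q).

Lemma scale_chartK : cancel (scale_chart c p q) (scale_chartV c p q).
Proof.
case=> x y; rewrite /scale_chart /scale_chartV /=.
by congr pair; field; exact: lt0r_neq0.
Qed.

Lemma scale_chartVK : cancel (scale_chartV c p q) (scale_chart c p q).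
Proof.
case=> x y; rewrite /scale_chart /scale_chartV /=.
by congr pair; field; exact: lt0r_neq0.
Qed.

Lemma measurable_scale_chart : measurable_fun setT (scale_chart c p q).
Proof.
apply: measurable_fun_pair => /=; apply: measurable_funD => //;
  exact: measurable_funM.
Qed.

Lemma measurable_scale_chartV : measurable_fun setT (scale_chartV c p q).
Proof.
apply: measurable_fun_pair => /=; apply: measurable_funM => //;
  exact: measurable_funB.
Qed.

Lemma lebesgue2_scale_chart (B : set (R * R)) : measurable B ->
  leb2 (scale_chart c p q @^-1` B) = (((p * q)^-1)%:E * leb2 B)%E.
Proof.
move=> mB.
pose Y k d := fun z : R * R => (z.1, k * z.2 + d).
have mY k d : measurable_fun setT (Y k d).
  apply: measurable_fun_pair => /=; first exact: measurable_fst.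
  by apply: measurable_funD => //; apply: measurable_funM => //; exact: measurable_snd.
have -> : scale_chart c p q @^-1` B =
    Y q c.2 @^-1` (swap2 @^-1` (Y p c.1 @^-1` (swap2 @^-1` B))) by [].
have pre k d A : measurable A -> measurable (Y k d @^-1` A).
  by move=> mA; rewrite -[X in measurable X]setTI; exact: mY.
have sw (A : set (R * R)) : measurable A -> measurable (swap2 @^-1` A).
  exact: mp_preimage mp_swap.
rewrite lebesgue2_scale_fiber//; last exact (sw _ (pre _ _ _ (sw _ mB))).
rewrite mp_swap.2; last exact (pre _ _ _ (sw _ mB)).
rewrite lebesgue2_scale_fiber//; last exact (sw _ mB).
by rewrite mp_swap.2// muleA -EFinM invfM [_^-1 * _]mulrC.
Qed.

(** The chart scales area by the constant factor [p * q], which cancels in a conjugation. *)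
Lemma mp_chart_conj f : measure_preserving f ->
  measure_preserving (scale_chart c p q \o f \o scale_chartV c p q).
Proof.
move=> mf; have pq : 0 < p * q by exact: mulr_gt0.
have scaleV (A : set (R * R)) : measurable A ->
    leb2 (scale_chartV c p q @^-1` A) = ((p * q)%:E * leb2 A)%E.
  move=> mA; have mVA : measurable (scale_chartV c p q @^-1` A).
    by rewrite -[X in measurable X]setTI; exact: measurable_scale_chartV.
  have := lebesgue2_scale_chart mVA.
  have -> : scale_chart c p q @^-1` (scale_chartV c p q @^-1` A) = A.
    by apply/seteqP; split => z /=; rewrite scale_chartK.
  by move=> ->; rewrite muleA -EFinM mulfV ?mul1e//; exact: lt0r_neq0.
split.
  apply: measurableT_comp measurable_scale_chartV.
  exact: measurableT_comp measurable_scale_chart mf.1.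
move=> B mB.
have mCB : measurable (scale_chart c p q @^-1` B).
  by rewrite -[X in measurable X]setTI; exact: measurable_scale_chart.
rewrite comp_preimage scaleV; last exact (mp_preimage mf mCB).
rewrite comp_preimage mf.2// lebesgue2_scale_chart// muleA -EFinM mulfV ?mul1e//.
exact: lt0r_neq0.
Qed.

End AffineChart.

Section Tile.
Context {R : realType} {I : countType} (D : set I) (c : I -> R * R) (p q : R).
Hypotheses (p0 : 0 < p) (q0 : 0 < q).
Implicit Types (z w : R * R) (s t : R) (i : I).

Notation chart i := (scale_chart (c i) p q).
Notation chartV i := (scale_chartV (c i) p q).

Definition tile_cell i z : Prop := D i /\ sqnorm (chartV i z) < 1.

(** Each cell is a rectangle with half sides [p] and [q], turned by the square rotation
    read in the chart that maps it to the square of radius [1]. *)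
Definition tile_flow t z : R * R :=
  if pselect (exists i, tile_cell i z) is left e then
    let i := sval (cid e) in chart i (sqrot t (chartV i z))
  else z.

Definition tile_vel z : R * R :=
  if pselect (exists i, tile_cell i z) is left e then
    let v := sqvel (chartV (sval (cid e)) z) in (p * v.1, q * v.2)
  else 0.

Hypothesis disj : forall i j z, tile_cell i z -> tile_cell j z -> i = j.

Lemma tile_flowE i t z : tile_cell i z -> tile_flow t z = chart i (sqrot t (chartV i z)).
Proof.
move=> iz; rewrite /tile_flow; case: pselect => [e|[]]; last by exists i.
by case: cid => j jz /=; rewrite (disj jz iz).
Qed.

Lemma tile_velE i z : tile_cell i z ->
  tile_vel z = (p * (sqvel (chartV i z)).1, q * (sqvel (chartV i z)).2).
Proof.
move=> iz; rewrite /tile_vel; case: pselect => [e|[]]; last by exists i.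
by case: cid => j jz /=; rewrite (disj jz iz).
Qed.

Lemma tile_flow_id t z : ~ (exists i, tile_cell i z) -> tile_flow t z = z.
Proof. by rewrite /tile_flow; case: pselect. Qed.

Lemma tile_vel0 z : ~ (exists i, tile_cell i z) -> tile_vel z = 0.
Proof. by rewrite /tile_vel; case: pselect. Qed.

Lemma tile_cell_flow i t z : 0 <= t -> tile_cell i z -> tile_cell i (tile_flow t z).
Proof.
move=> t0 iz; have [Di zi] := iz; split => //.
by rewrite (tile_flowE t iz) scale_chartK// sqnorm_rot.
Qed.

Lemma tile_flow_add s t z : 0 <= s -> 0 <= t ->
  tile_flow s (tile_flow t z) = tile_flow (t + s) z.
Proof.
move=> s0 t0; case: (pselect (exists i, tile_cell i z)) => [[i iz]|nz].
  rewrite (tile_flowE s (tile_cell_flow t0 iz)) !(tile_flowE _ iz).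
  by rewrite scale_chartK// sqrot_add.
by rewrite !(tile_flow_id _ nz).
Qed.

Lemma tile_flow0 z : tile_flow 0 z = z.
Proof.
case: (pselect (exists i, tile_cell i z)) => [[i iz]|nz]; last exact: tile_flow_id.
by rewrite (tile_flowE _ iz) sqrot0 scale_chartVK.
Qed.

Lemma tile_flow8 z : tile_flow 8 z = z.
Proof.
case: (pselect (exists i, tile_cell i z)) => [[i iz]|nz]; last exact: tile_flow_id.
by rewrite (tile_flowE _ iz) sqrot8 scale_chartVK.
Qed.

Lemma tile_flow4 i z : tile_cell i z ->
  tile_flow 4 z = (2 * (c i).1 - z.1, 2 * (c i).2 - z.2).
Proof.
move=> iz; rewrite (tile_flowE _ iz) sqrot4 /scale_chart /scale_chartV /=.
by congr pair; field; exact: lt0r_neq0.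
Qed.

Lemma tile_flowK t : 0 <= t <= 8 -> cancel (tile_flow t) (tile_flow (8 - t)).
Proof.
by move=> t8 z; rewrite tile_flow_add; [rewrite addrC subrK tile_flow8|lra|lra].
Qed.

Lemma tile_flowVK t : 0 <= t <= 8 -> cancel (tile_flow (8 - t)) (tile_flow t).
Proof. by move=> t8 z; rewrite tile_flow_add; [rewrite subrK tile_flow8|lra|lra]. Qed.

Let piece (i : option I) : set (R * R) :=
  if i is Some i then tile_cell i else [set z | ~ exists i, tile_cell i z].

Let piece_cover z : exists k : option I, piece k z.
Proof.
case: (pselect (exists i, tile_cell i z)) => [[i iz]|nz]; first by exists (Some i).
by exists None.
Qed.

Let piece_uniq (i j : option I) z : piece i z -> piece j z -> i = j.
Proof.
case: i j => [i|] [j|] //=; first by move=> iz jz; rewrite (disj iz jz).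
  by move=> iz []; exists i.
by move=> + jz; case; exists j.
Qed.

Lemma measurable_tile_cell i : measurable (tile_cell i).
Proof.
case: (pselect (D i)) => Di; last first.
  by rewrite (_ : tile_cell i = set0)//; apply/seteqP; split => // z [].
have -> : tile_cell i = [set z | sqnorm (chartV i z) < 1].
  by apply/seteqP; split => [z []//|z].
have m := measurable_scale_chartV (c i) p q.
apply: measurable_bool_set; apply: measurable_fun_ltr => //.
apply: measurable_maxr; apply: measurableT_comp => //.
  exact: measurableT_comp measurable_fst m.
exact: measurableT_comp measurable_snd m.
Qed.

Let measurable_piece (i : option I) : measurable (piece i).
Proof.
case: i => [i|]; first exact: measurable_tile_cell.
have -> : piece None = ~` \bigcup_i (tile_cell i).
  by apply/seteqP; split => z /= h []; [move=> i _ iz; apply: h; exists i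
    |move=> i iz; apply: h; exists i].
apply: measurableC; apply: countable_bigcupT_measurable => // i.
exact: measurable_tile_cell.
Qed.

(** Cells are invariant, so the flow is a bijection glued from conjugates of rotations
    and from the identity. *)
Lemma mp_tile_flow t : 0 <= t <= 8 -> measure_preserving (tile_flow t).
Proof.
move=> t8; have t8' : 0 <= 8 - t <= 8 by lra.
pose L (s : R) (i : option I) :=
  if i is Some i then chart i \o sqrot s \o chartV i else id.
have mL s (i : option I) : 0 <= s <= 8 -> measure_preserving (L s i).
  move=> s8; case: i => [i|]; last exact: mp_id.
  exact: mp_chart_conj (mp_sqrot s8).
apply: (@mp_piecewise _ _ piece (L t) (L (8 - t))) => //.
- by move=> i; exact: mL.
- by move=> i; exact: (mL _ i t8').1.
- by move=> [i|] z /=; [move=> iz; rewrite (tile_flowE _ iz)|exact: tile_flow_id].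
- by move=> [i|] z //=; rewrite scale_chartK// sqrotK// scale_chartVK.
- by move=> [i|] z //=; rewrite scale_chartK// sqrotVK// scale_chartVK.
- by exists (tile_flow (8 - t)); [exact: tile_flowK|exact: tile_flowVK].
Qed.

Lemma measurable_sqvel : measurable_fun setT (@sqvel R).
Proof.
have m1 : measurable_fun setT (@fst R R) by exact: measurable_fst.
have m2 : measurable_fun setT (@snd R R) by exact: measurable_snd.
apply: measurable_fun_ifT.
- apply: measurable_or; apply: measurable_and.
  + by apply: measurable_fun_ler => //; exact: measurable_funN.
  + exact: measurable_fun_ltr.
  + apply: measurable_fun_ler; first exact: (measurable_funN (measurable_funN m1)).
    exact: measurable_funN.
  + by apply: measurable_fun_ltr; exact: measurable_funN.
- exact: measurable_fun_pair.
- by apply: measurable_fun_pair => //; exact: measurable_funN.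
Qed.

Lemma measurable_tile_vel : measurable_fun setT tile_vel.
Proof.
apply: (measurable_piecewise measurable_piece piece_cover (F := tile_vel) (FI := fun i : option I =>
  if i is Some i then fun z => (p * (sqvel (chartV i z)).1, q * (sqvel (chartV i z)).2)
  else cst 0)).
  move=> [i|] //; have m := measurableT_comp measurable_sqvel (measurable_scale_chartV (c i) p q).
  apply: measurable_fun_pair; apply: measurable_funM => //.
    exact: measurableT_comp measurable_fst m.
  exact: measurableT_comp measurable_snd m.
by move=> [i|] z /=; [move=> iz; rewrite (tile_velE iz)|exact: tile_vel0].
Qed.

Lemma sqvel_norm z : `|(sqvel z).1| <= sqnorm z /\ `|(sqvel z).2| <= sqnorm z.
Proof.
rewrite /sqvel /sqnorm; case: ifP => _ /=; rewrite ?normrN ?normr0 !le_max !lexx ?normr_ge0 ?orbT //.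
Qed.

Lemma tile_vel_bound z : `|(tile_vel z).1| <= p /\ `|(tile_vel z).2| <= q.
Proof.
case: (pselect (exists i, tile_cell i z)) => [[i iz]|nz]; last first.
  by rewrite tile_vel0//= normr0; split; exact: ltW.
rewrite (tile_velE iz) /= !normrM (gtr0_norm p0) (gtr0_norm q0).
have [v1 v2] := sqvel_norm (chartV i z); have [_ z1] := iz.
split; apply: ler_piMr (ltW _) _ => //.
  exact: le_trans v1 (ltW z1).
exact: le_trans v2 (ltW z1).
Qed.

Lemma tile_flow_right z : exists2 e : R, 0 < e & forall s, 0 <= s < e ->
  tile_flow s z = z + s *: tile_vel z /\ tile_vel (tile_flow s z) = tile_vel z.
Proof.
case: (pselect (exists i, tile_cell i z)) => [[i iz]|nz]; last first.
  by exists 1 => // s s0; rewrite tile_flow_id// tile_vel0// scaler0 addr0.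
have [e e0 h] := sqrot_right (chartV i z); exists e => // s s0.
have [A B] := h s s0; have s0' : 0 <= s by lra.
rewrite (tile_velE (tile_cell_flow s0' iz)) (tile_flowE _ iz) (tile_velE iz).
rewrite scale_chartK// B A; split => //; rewrite /scale_chart /scale_chartV.
move: (sqvel _) => [v1 v2]; rewrite -[RHS]/(z.1 + s * (p * v1), z.2 + s * (q * v2)) /=.
by rewrite /GRing.scale /=; congr pair; field; exact: lt0r_neq0.
Qed.

Lemma tile_flow_left t z : 0 < t -> exists2 e : R, 0 < e & exists v, forall s, 0 <= s < e ->
  tile_flow (t - s) z = tile_flow t z - s *: v.
Proof.
move=> t0.
case: (pselect (exists i, tile_cell i z)) => [[i iz]|nz]; last first.
  by exists 1 => //; exists 0 => s s0; rewrite !tile_flow_id// scaler0 subr0.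
have [e e0 [[v1 v2] h]] := sqrot_left (chartV i z) t0; exists e => //.
exists (p * v1, q * v2) => s s0.
rewrite !(tile_flowE _ iz) h// /scale_chart.
move: (sqrot t _) => [w1 w2].
rewrite -[RHS]/(p * w1 + (c i).1 - s * (p * v1), q * w2 + (c i).2 - s * (q * v2)) /=.
by rewrite /GRing.scale /=; congr pair; ring.
Qed.

End Tile.

(** * Primitives of measurable functions *)

Section RealInduction.
Context {R : realType}.

(** Induction along an interval: a property that propagates to the right for a while, and
    that passes to left limits, holds up to the end. *)
Lemma real_induction (P : R -> Prop) (u w : R) : u <= w -> P u ->
  (forall t, u <= t < w -> P t -> exists2 e : R, 0 < e &
     forall t', t < t' < t + e -> t' <= w -> P t') ->
  (forall t, u < t <= w -> (forall t', u <= t' < t -> P t') -> P t) -> P w.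
Proof.
move=> uw Pu Pr Pl.
pose S := [set t | u <= t <= w /\ forall s, u <= s <= t -> P s].
have Su : S u.
  split; first by rewrite lexx.
  by move=> s us; have -> : s = u by lra.
have ubS : ubound S w by move=> t [/andP[]].
have hub : has_ubound S by exists w.
have um : u <= sup S by exact: (ub_le_sup hub Su).
have mw : sup S <= w by apply: ge_sup => //; exists u.
have below s : u <= s < sup S -> P s.
  move=> /andP[us sm]; have [t [tw tP] st] := sup_gt (ex_intro _ u Su) sm.
  by apply: tP; lra.
have Pm : P (sup S).
  have [<-//|um'] := eqVneq u (sup S).
  by apply: Pl => //; rewrite lt_neqAle um' um.
have [<-//|mw'] := eqVneq (sup S) w.
have umw : u <= sup S < w by rewrite um lt_neqAle mw' mw.
have [e e0 he] := Pr (sup S) umw Pm.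
pose t := Num.min w (sup S + e / 2).
have mt : sup S < t by rewrite /t lt_min lt_neqAle mw' mw /=; lra.
have tw : t <= w by rewrite /t ge_min lexx.
have te : t < sup S + e by rewrite /t gt_min; apply/orP; right; lra.
suff : S t by move=> /(ub_le_sup hub); rewrite leNgt mt.
split; first by lra.
move=> s /andP[us st]; have [sm|] := ltP s (sup S); first by apply: below; rewrite us.
rewrite le_eqVlt => /predU1P[<-//|ms]; apply: he; lra.
Qed.

End RealInduction.

Section Primitive.
Context {R : realType}.
Notation leb := (@lebesgue_measure R).
Implicit Types (F g : R -> R) (s t u w K : R).

Definition segint g s t : R := \int[leb]_(x in `[s, t]) g x.

Lemma bounded_integrable g K s t : measurable_fun setT g ->
  (forall x, s <= x <= t -> `|g x| <= K) -> leb.-integrable `[s, t] (EFin \o g).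
Proof.
move=> mg gK; apply: measurable_bounded_integrable => //.
- rewrite /= lebesgue_measure_itv/= ; case: ifP => _; last exact: ltry.
  by rewrite -EFinB ltry.
- exact: measurable_funTS.
- exists K; split; first exact: num_real.
  move=> x Kx y /=; rewrite in_itv /= => yst.
  exact: le_trans (gK _ yst) (ltW Kx).
Qed.

Lemma segint_point g s : segint g s s = 0.
Proof. by rewrite /segint set_itv1 Rintegral_set1. Qed.

Lemma segint_cat g s m t : leb.-integrable `[s, t] (EFin \o g) ->
  s <= m <= t -> segint g s t = segint g s m + segint g m t.
Proof.
move=> ig /andP[sm mt]; rewrite /segint.
have := @Rintegral_itvB R g (BLeft s) (BRight t) m ig.
rewrite !bnd_simp => /(_ sm mt) /eqP; rewrite subr_eq => /eqP ->.
rewrite addrC Rintegral_itv_obnd_cbnd//.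
by apply: integrableS ig => //; apply: subset_itvr; rewrite bnd_simp.
Qed.

Lemma segint_bound g K s t : measurable_fun setT g -> s <= t ->
  (forall x, s <= x <= t -> `|g x| <= K) -> `|segint g s t| <= K * (t - s).
Proof.
move=> mg st gK; have ig := bounded_integrable mg gK.
apply: le_trans (le_normr_Rintegral _ ig) _ => //.
have -> : K * (t - s) = \int[leb]_(x in `[s, t]) (cst K x).
  rewrite Rintegral_cst//= lebesgue_measure_itv/= lte_fin.
  case: ltP => [_|ts]; first by rewrite -EFinB.
  by rewrite (_ : t = s) ?subrr//; apply/eqP; rewrite eq_le st ts.
apply: le_Rintegral => //.
- by apply: (bounded_integrable (K := K)) => [|x /gK]; [exact: measurableT_comp|rewrite normr_id].
- by apply: (bounded_integrable (K := `|K|)) => // x _ /=.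
Qed.

(** The Caratheodory form of a differential equation [F' = g]. *)
Definition primitive_on F g u w : Prop :=
  forall s t, u <= s -> s <= t -> t <= w -> F t - F s = segint g s t.

(** The trajectories below satisfy their equation only locally to the right of each time,
    and are continuous from the left; [real_induction] turns this into an identity on
    the whole interval. *)
Lemma primitive_of_right F g K u w : measurable_fun setT g ->
  (forall x, u <= x <= w -> `|g x| <= K) ->
  (forall t, u <= t < w -> exists2 e : R, 0 < e &
     forall t', t < t' < t + e -> F t' - F t = segint g t t') ->
  (forall t, u < t <= w -> forall r : R, 0 < r -> exists2 e : R, 0 < e &
     forall t', t - e < t' < t -> `|F t' - F t| <= r) ->
  primitive_on F g u w.
Proof.
move=> mg gK Fr Fl s t us st tw.
have K0 : 0 <= K by apply: le_trans (gK s _); [exact: normr_ge0|lra].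
have ig a b : u <= a -> b <= w -> leb.-integrable `[a, b] (EFin \o g).
  by move=> ua bw; apply: (bounded_integrable mg (K := K)) => x xab; apply: gK; lra.
apply: (@real_induction _ (fun x => F x - F s = segint g s x) s t st).
- by rewrite subrr segint_point.
- move=> x /andP[sx xt] Fx; have [|e e0 he] := Fr x; first by lra.
  exists e => // y xy yt; rewrite (@segint_cat g s x y); [|apply: ig; lra|lra].
  by rewrite -Fx -he//; ring.
- move=> x /andP[sx xt] below; apply/eqP; rewrite -subr_eq0 -normr_le0.
  apply/ler_addgt0Pr => r r0; rewrite add0r.
  have [||e e0 he] := Fl x _ (r / 2); [lra|lra|].
  have rK : 0 < r / (2 * (K + 1)) by apply: divr_gt0 => //; lra.
  pose d := Num.min (Num.min e (x - s)) (r / (2 * (K + 1))).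
  have d0 : 0 < d by rewrite /d !lt_min; lra.
  have de : d <= e by rewrite /d !ge_min lexx.
  have dx : d <= x - s by rewrite /d !ge_min lexx orbT.
  have dr : d <= r / (2 * (K + 1)) by rewrite /d !ge_min lexx orbT.
  pose y := x - d / 2.
  have yb := below y; rewrite (@segint_cat g s y x); [|by apply: ig; lra|by rewrite /y; lra].
  have -> : F x - F s - (segint g s y + segint g y x) = (F x - F y) - segint g y x.
    by rewrite -yb; [ring|rewrite /y; lra].
  apply: le_trans (ler_normB _ _) _.
  have h1 : `|F x - F y| <= r / 2 by rewrite distrC; apply: he; rewrite /y; lra.
  have h2 : `|segint g y x| <= K * (x - y).
    by apply: segint_bound => //; [rewrite /y; lra|move=> v vy; apply: gK; rewrite /y in vy; lra].
  have h3 : K * (x - y) <= r / 2.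
    rewrite /y opprB addrC subrK.
    have : d * (2 * (K + 1)) <= r by rewrite -ler_pdivlMr//; lra.
    nra.
  lra.
Qed.

Lemma primitive_cat F g u m w : leb.-integrable `[u, w] (EFin \o g) ->
  u <= m <= w -> primitive_on F g u m -> primitive_on F g m w -> primitive_on F g u w.
Proof.
move=> ig umw A B s t us st tw.
have [tm|mt] := leP t m; first exact: A.
have [ms|sm] := leP m s; first exact: B.
rewrite (@segint_cat _ s m t); last by lra.
  by rewrite -A ?lexx// 1?ltW// -B ?lexx// ?ltW//; ring.
by apply: integrableS ig => //; apply: subset_itv; rewrite bnd_simp.
Qed.

Lemma Rintegral_isometry (h : R -> R) g (D : set R) : measurable_fun setT h ->
  (forall A, measurable A -> leb (h @^-1` A) = leb A) -> measurable D ->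
  leb.-integrable (h @^-1` D) (EFin \o (g \o h)) -> measurable_fun setT g ->
  \int[leb]_(x in h @^-1` D) g (h x) = \int[leb]_(x in D) g x.
Proof.
move=> mh lh mD ig mg; rewrite /Rintegral; congr fine.
have mh' : measurable_fun [set: measurableTypeR R] (h : measurableTypeR R -> measurableTypeR R) by [].
have mg' : measurable_fun [set: measurableTypeR R] ((EFin \o g) : measurableTypeR R -> \bar R).
  exact: measurableT_comp.
have := integral_pushforward mh' mg' ig mD.
rewrite /comp /= => <-; apply: eq_measure_integral => A mA _.
exact: lh.
Qed.

Lemma leb_shift (c : R) A : measurable A -> leb ((fun x => x + c) @^-1` A) = leb A.
Proof.
move=> mA; have := @lebesgue_affine _ 1 c A ltr01 mA; rewrite invr1 mul1e => <-.
by congr (leb _); apply/seteqP; split => x /=; rewrite mul1r.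
Qed.

Lemma leb_reflect (c : R) A : measurable A -> leb ((fun x => c - x) @^-1` A) = leb A.
Proof.
move=> mA; have -> : (fun x => c - x) @^-1` A = -%R @^-1` ((fun x => x + c) @^-1` A).
  by apply/seteqP; split => x /=; rewrite addrC.
rewrite -(leb_shift c mA) -[in RHS]lebesgue_measureN//.
by rewrite -[X in measurable X]setTI; apply: measurable_funD.
Qed.

Lemma segint_shift g c s t : measurable_fun setT g ->
  leb.-integrable `[s, t] (EFin \o (fun x => g (x + c))) ->
  segint (fun x => g (x + c)) s t = segint g (s + c) (t + c).
Proof.
move=> mg ig; rewrite /segint.
have E : (fun x => x + c) @^-1` `[s + c, t + c] = `[s, t]%classic :> set R.
  by apply/seteqP; split => x /=; rewrite !in_itv /= !lerD2r.
have mh : measurable_fun setT (fun x : R => x + c) by exact: measurable_funD.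
have := @Rintegral_isometry _ g `[s + c, t + c]%classic mh (@leb_shift c).
by rewrite E => <-.
Qed.

Lemma segint_reflect g c s t : measurable_fun setT g ->
  leb.-integrable `[s, t] (EFin \o (fun x => g (c - x))) ->
  segint (fun x => g (c - x)) s t = segint g (c - t) (c - s).
Proof.
move=> mg ig; rewrite /segint.
have E : (fun x => c - x) @^-1` `[c - t, c - s] = `[s, t]%classic :> set R.
  by apply/seteqP; split => x /=; rewrite !in_itv /=; lra.
have mh : measurable_fun setT (fun x : R => c - x) by exact: measurable_funB.
have := @Rintegral_isometry _ g `[c - t, c - s]%classic mh (@leb_reflect c).
by rewrite E => <-.
Qed.

Lemma oriented_integralE F g K alpha t : measurable_fun setT g ->
  (forall x, `|g x| <= K) -> (forall u w, primitive_on F g u w) ->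
  leb.-integrable (segment_to t) (EFin \o (fun s => g (s + alpha))) /\
  oriented_integral (fun s => g (s + alpha)) t = F (t + alpha) - F alpha.
Proof.
move=> mg gK Fg.
have mga : measurable_fun setT (fun s => g (s + alpha)).
  by apply: measurableT_comp => //; exact: measurable_funD.
have ig a b : leb.-integrable `[a, b] (EFin \o (fun s => g (s + alpha))).
  by apply: (bounded_integrable (K := K)).
split; first exact: ig.
rewrite /oriented_integral /segment_to.
have [t0|t0|<-] := ltgtP 0 t.
- rewrite gtr0_sg// mul1r.
  rewrite -[Rintegral _ _ _]/(segint (fun s => g (s + alpha)) 0 t) segint_shift// add0r.
  by rewrite -(Fg alpha (t + alpha))//; lra.
- rewrite ltr0_sg// mulN1r.
  rewrite -[Rintegral _ _ _]/(segint (fun s => g (s + alpha)) t 0) segint_shift// add0r.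
  rewrite -(Fg (t + alpha) alpha)//; last by lra.
  by rewrite opprB.
- by rewrite sgr0 mul0r add0r subrr.
Qed.

(** Running a curve backwards; this is what makes the reflected trajectories solutions of
    the field with the opposite sign. *)
Lemma primitive_reflect F g K c u w : measurable_fun setT g -> (forall x, `|g x| <= K) ->
  primitive_on F g u w ->
  primitive_on (fun t => F (c - t)) (fun t => - g (c - t)) (c - w) (c - u).
Proof.
move=> mg gK Fg s t cs st tc.
have mgc : measurable_fun setT (fun x : R => g (c - x)).
  by apply: measurableT_comp => //; exact: measurable_funB.
have ig : leb.-integrable `[s, t] (EFin \o (fun x => g (c - x))).
  by apply: (bounded_integrable (K := K)).
have -> : segint (fun t => - g (c - t)) s t = - segint (fun t => g (c - t)) s t.
  rewrite /segint -[RHS]mulN1r -RintegralZl//.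
  by apply: eq_Rintegral => x _; rewrite mulN1r.
by rewrite segint_reflect// -(Fg (c - t) (c - s)); [ring|lra|lra|lra].
Qed.

End Primitive.

(** * One-sided regularity and differentiable functions *)

Section LeftContinuous.
Context {R : realType}.

(** Round the first variable down to a grid of mesh tending to zero: the rounded functions
    are glued from slices and converge pointwise. *)
Lemma measurable_left_continuous d (T : measurableType d) (f : R * T -> R) :
  (forall s, measurable_fun setT (fun x => f (s, x))) ->
  (forall (s : R) x (r : R), 0 < r -> exists2 e : R, 0 < e &
     forall s' : R, s - e < s' <= s -> `|f (s', x) - f (s, x)| <= r) ->
  measurable_fun setT f.
Proof.
move=> mf lf.
have aux (a b c e : R) : a < b + c -> c < e -> a - e < b by move=> *; lra.
pose lo (k : nat) (j : int) : R := j%:~R / k.+1%:R.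
pose h (k : nat) (z : R * T) := f (lo k (Num.floor (z.1 * k.+1%:R)), z.2).
have k0 (k : nat) : 0 < k.+1%:R :> R by [].
apply: (@measurable_fun_cvg _ _ _ _ h).
- move=> k; pose P (j : int) : set (R * T) := `[lo k j, lo k (j + 1)[%classic `*` setT.
  apply: (measurable_piecewise (P := P) (FI := fun j z => f (lo k j, z.2))).
  + by move=> j; apply: measurableX.
  + move=> [s x]; exists (Num.floor (s * k.+1%:R)); split => //=.
    by rewrite in_itv /= /lo ler_pdivrMr// ltr_pdivlMr// floor_itv.
  + by move=> j; apply: measurableT_comp (mf (lo k j)) _; exact: measurable_snd.
  + move=> j [s x] [/=]; rewrite in_itv /= /lo ler_pdivrMr// ltr_pdivlMr// => sj _.
    by rewrite /h (floor_def sj).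
- move=> [s x] _; apply/cvgrPdist_le => r r0.
  have [e e0 he] := lf s x r r0.
  near=> k; rewrite distrC /h /=; apply: he.
  have := floor_itv (s * k.+1%:R); rewrite /lo; set j := Num.floor _.
  move=> /andP[sj js]; rewrite ler_pdivrMr// sj andbT.
  have {}js : s < j%:~R / k.+1%:R + k.+1%:R^-1.
    by rewrite -[X in _ + X]mul1r -mulrDl ltr_pdivlMr//; move: js; rewrite intrD.
  have : k.+1%:R^-1 < e by near: k; exact: (near_infty_natSinv_lt (PosNum e0)).
  exact: aux js.
Unshelve. all: by end_near. Qed.

Lemma lipschitz_of_right (F : R -> R) (M u w : R) : u <= w ->
  (forall t, u <= t < w -> exists2 e : R, 0 < e &
     forall t', t < t' < t + e -> `|F t' - F t| <= M * (t' - t)) ->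
  (forall t, u < t <= w -> forall r : R, 0 < r -> exists2 e : R, 0 < e &
     forall t', t - e < t' < t -> `|F t' - F t| <= r) ->
  `|F w - F u| <= M * (w - u).
Proof.
move=> uw Fr Fl; apply: (@real_induction _ (fun t => `|F t - F u| <= M * (t - u)) u w uw).
- by rewrite !subrr normr0 mulr0.
- move=> t tw Ft; have [e e0 he] := Fr t tw; exists e => // t' tt' _.
  have := he t' tt'; have := ler_normD (F t' - F t) (F t - F u); rewrite subrKA.
  by nra.
- move=> t tw below; apply/ler_addgt0Pr => r r0.
  have r2 : 0 < r / 2 by lra.
  have [e e0 he] := Fl t tw (r / 2) r2.
  have M0 : 0 < r / (2 * (`|M| + 1)) by apply: divr_gt0 => //; have := normr_ge0 M; lra.
  pose d := Num.min (Num.min e (t - u)) (r / (2 * (`|M| + 1))).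
  have d0 : 0 < d by rewrite /d !lt_min; lra.
  have de : d <= e by rewrite /d !ge_min lexx.
  have dx : d <= t - u by rewrite /d !ge_min lexx orbT.
  have dr : d <= r / (2 * (`|M| + 1)) by rewrite /d !ge_min lexx orbT.
  have dr' : d * (2 * (`|M| + 1)) <= r.
    by rewrite -ler_pdivlMr//; have := normr_ge0 M; lra.
  have h1 : `|F (t - d / 2) - F u| <= M * (t - d / 2 - u) by apply: below; lra.
  have h2 : `|F (t - d / 2) - F t| <= r / 2 by apply: he; lra.
  have h3 : `|F t - F u| <= `|F (t - d / 2) - F u| + `|F (t - d / 2) - F t|.
    have -> : F t - F u = (F (t - d / 2) - F u) - (F (t - d / 2) - F t) by ring.
    exact: ler_normB.
  have h4 : - (M * d) <= `|M| * d by rewrite -mulNr ler_pM2r// -normrN ler_norm.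
  nra.
Qed.

End LeftContinuous.

Section ChainRule.
Context {R : realType}.
Implicit Types (H : R * (R * R) -> R) (y : R * (R * R)) (v : R * R).

(** Only derivatives in directions whose time component is [1] are needed, since they are
    the ones taken along the graph of a trajectory. *)
Record C1_with_gradient H H0 H1 H2 : Prop := {
  C1_cont : continuous H;
  C1_cont0 : continuous H0;
  C1_cont1 : continuous H1;
  C1_cont2 : continuous H2;
  C1_derive : forall y v, is_derive y (1, v) H (H0 y + v.1 * H1 y + v.2 * H2 y) }.

Definition along (H0 H1 H2 : R * (R * R) -> R) v y := H0 y + v.1 * H1 y + v.2 * H2 y.

Variables (H H0 H1 H2 : R * (R * R) -> R).
Hypothesis C1 : C1_with_gradient H H0 H1 H2.

Let line (y : R * (R * R)) (v : R * R) (t : R) : R * (R * R) := y + t *: (1, v).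

Let line_cont y v : continuous (line y v).
Proof.
move=> t; apply: cvgD; first exact: cvg_cst.
by apply: cvgZl; exact: cvg_id.
Qed.

Let along_cont v : continuous (along H0 H1 H2 v).
Proof.
move=> y; apply: cvgD; first apply: cvgD.
- exact: (C1_cont0 C1).
- by apply: cvgM; [exact: cvg_cst|exact: (C1_cont1 C1)].
- by apply: cvgM; [exact: cvg_cst|exact: (C1_cont2 C1)].
Qed.

Let line_derive y v (t : R) : is_derive t (1 : R) (H \o line y v) (along H0 H1 H2 v (line y v t)).
Proof.
have [dH dE] := C1_derive C1 (line y v t) v.
have E : (fun h : R => h^-1 *: ((H \o line y v) (h *: 1 + t) - (H \o line y v) t)) =
   (fun h : R => h^-1 *: (H (h *: (1, v) + line y v t) - H (line y v t))).
  apply/funext => h /=; congr (_ *: (H _ - _)).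
  by rewrite /line [h *: 1]mulr1 scalerDl addrCA.
split; first by rewrite /derivable E.
by rewrite /derive E -[LHS]/('D_(1, v) H (line y v t)) dE.
Qed.

Lemma line_ftc y v s t : s < t ->
  segint (fun x => along H0 H1 H2 v (y + x *: (1, v))) s t =
  H (y + t *: (1, v)) - H (y + s *: (1, v)).
Proof.
move=> st; rewrite /segint /Rintegral.
have cline : continuous (along H0 H1 H2 v \o line y v).
  by move=> x; apply: continuous_comp; [exact: line_cont|exact: along_cont].
have cH : continuous (H \o line y v).
  by move=> x; apply: continuous_comp; [exact: line_cont|exact: (C1_cont C1)].
rewrite (@continuous_FTC2 _ _ (H \o line y v))//.
- exact: continuous_subspaceT.
- split => //.
  + by move=> x _; have [] := line_derive y v x.
  + exact/cvg_at_right_filter/cH.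
  + exact/cvg_at_left_filter/cH.
- by move=> x _; rewrite derive1E; have [_ ->] := line_derive y v x.
Qed.

End ChainRule.

(** * Concatenation of infinitely many stages *)

Definition left_affine {R : realType} (c : R -> R * R) (t : R) : Prop :=
  exists2 e : R, 0 < e & exists v : R * R, forall h, 0 <= h < e -> c (t - h) = c t - h *: v.

(** Countably many autonomous flows [G n], with inverses [GV n] and velocities [b n], to
    be run one after the other during the intervals [[T n, T n.+1[], which fill [[0, 1[].
    Everything happens inside [Q], and velocities are bounded by [M], which is what gives
    the trajectories a limit at time [1]. *)
Record stages {R : realType} (G GV : nat -> R -> R * R -> R * R)
    (b : nat -> R * R -> R * R) (T : nat -> R) (M : R) (Q : set (R * R)) : Prop := {
  st_T0 : T 0%N = 0;
  st_lt : forall n, T n < T n.+1;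
  st_T1 : forall n, T n < 1;
  st_Tlim : forall e : R, 0 < e -> exists n, 1 - e < T n;
  st_G0 : forall n z, G n 0 z = z;
  st_GK : forall n (s : R), 0 <= s <= T n.+1 - T n -> cancel (G n s) (GV n s);
  st_GVK : forall n (s : R), 0 <= s <= T n.+1 - T n -> cancel (GV n s) (G n s);
  st_mpG : forall n (s : R), 0 <= s <= T n.+1 - T n -> measure_preserving (G n s);
  st_mpGV : forall n (s : R), 0 <= s <= T n.+1 - T n -> measure_preserving (GV n s);
  st_right : forall n (s : R) z, 0 <= s < T n.+1 - T n -> exists2 e : R, 0 < e &
    forall h, 0 <= h < e -> G n (s + h) z = G n s z + h *: b n (G n s z) /\
      b n (G n (s + h) z) = b n (G n s z);
  st_left : forall n (s : R) z, 0 < s <= T n.+1 - T n -> left_affine (fun s => G n s z) s;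
  st_leftV : forall n (s : R) z, 0 < s <= T n.+1 - T n -> left_affine (fun s => GV n s z) s;
  st_b1 : forall n z, `|(b n z).1| <= M;
  st_b2 : forall n z, `|(b n z).2| <= M;
  st_mb : forall n, measurable_fun setT (b n);
  st_bQ : forall n z, ~ Q z -> b n z = 0;
  st_GQ : forall n (s : R) z, 0 <= s <= T n.+1 - T n -> Q z -> Q (G n s z);
  st_GQ' : forall n (s : R) z, 0 <= s <= T n.+1 - T n -> ~ Q z -> G n s z = z }.

Section Composition.
Context {R : realType}.
Variables (G GV : nat -> R -> R * R -> R * R) (b : nat -> R * R -> R * R)
  (T : nat -> R) (M : R) (Q : set (R * R)).
Hypothesis S : stages G GV b T M Q.
Implicit Types (n : nat) (s t : R) (z x : R * R).

(** The time that the stage [n] has been running at time [t]. *)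
Definition clamp n t : R := Num.max 0 (Num.min (t - T n) (T n.+1 - T n)).

Fixpoint pos n t z : R * R := if n is k.+1 then G k (clamp k t) (pos k t z) else z.

Fixpoint posV n t z : R * R := if n is k.+1 then posV k t (GV k (clamp k t) z) else z.

(** The sequence of positions is stationary for [t < 1], so that the limit matters only
    from time [1] on, where it exists by [traj_lipschitz]. *)
Definition traj t z : R * R :=
  (limn (fun n => (pos n t z).1), limn (fun n => (pos n t z).2)).

Definition trajV t z : R * R :=
  (limn (fun n => (posV n t z).1), limn (fun n => (posV n t z).2)).

Definition field (y : R * (R * R)) : R * R :=
  if pselect (exists n, T n <= y.1 < T n.+1) is left e
  then b (sval (cid e)) y.2 else 0.

Let T_le n m : (n <= m)%N -> T n <= T m.
Proof.
move=> /subnK <-; elim: (m - n)%N => // k IH; rewrite addSn.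
exact: le_trans IH (ltW (st_lt S _)).
Qed.

Let T_ge0 n : 0 <= T n. Proof. by rewrite -(st_T0 S); exact: T_le. Qed.

Let d_gt0 n : 0 < T n.+1 - T n. Proof. by rewrite subr_gt0; exact: st_lt S n. Qed.

Lemma T_bracket t : 0 <= t < 1 -> exists n, T n <= t < T n.+1.
Proof.
move=> /andP[t0 t1]; have [|n nt] := st_Tlim S (e := 1 - t); first by lra.
have {}nt : t < T n by move: nt; rewrite opprB addrC subrK.
elim: n nt => [|n IH] nt; first by move: nt; rewrite (st_T0 S); lra.
by have [/IH//|Tn] := ltP t (T n); exists n; rewrite Tn.
Qed.

Lemma T_above t : t < 1 -> exists n, t <= T n.
Proof.
move=> t1; have [|n nt] := st_Tlim S (e := 1 - t); first by lra.
by exists n; lra.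
Qed.

Lemma T_bracket_uniq n m t : T n <= t < T n.+1 -> T m <= t < T m.+1 -> n = m.
Proof.
move=> nt mt; apply/eqP; rewrite eqn_leq; apply/andP; split; rewrite leqNgt;
  apply/negP => /T_le; lra.
Qed.

Lemma fieldE n t x : T n <= t < T n.+1 -> field (t, x) = b n x.
Proof.
move=> nt; rewrite /field; case: pselect => [e|[]]; last by exists n.
by case: cid => m /= mt; rewrite (T_bracket_uniq mt nt).
Qed.

Lemma field0 t x : ~ (0 <= t < 1) -> field (t, x) = 0.
Proof.
move=> nt; rewrite /field; case: pselect => // -[n /= tn].
by exfalso; apply: nt; have := T_ge0 n; have := st_T1 S n.+1; lra.
Qed.

Lemma field_outside t x : ~ Q x -> field (t, x) = 0.
Proof.
move=> nQ; case: (pselect (0 <= t < 1)) => [/T_bracket[n nt]|]; last exact: field0.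
by rewrite (fieldE _ nt) (st_bQ S).
Qed.

Lemma field_bound y : `|(field y).1| <= M /\ `|(field y).2| <= M.
Proof.
rewrite /field; case: pselect => [e|_].
  by split; [exact: st_b1 S _ _|exact: st_b2 S _ _].
have := st_b1 S 0%N 0; rewrite /= normr0 => h.
by split; apply: le_trans h; exact: normr_ge0.
Qed.

Lemma measurable_field : measurable_fun setT field.
Proof.
pose P (k : option nat) : set (R * (R * R)) := (if k is Some n then
  `[T n, T n.+1[%classic else ~` \bigcup_n `[T n, T n.+1[%classic) `*` setT.
apply: (measurable_piecewise (P := P) (FI := fun k y => if k is Some n then b n y.2 else 0)).
- move=> [n|]; apply: measurableX => //; apply: measurableC.
  exact: bigcupT_measurable.
- move=> [t x]; case: (pselect (exists n, T n <= t < T n.+1)) => [[n nt]|nt].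
    by exists (Some n); split; rewrite //= in_itv.
  exists None; split => // -[n _ /=]; rewrite in_itv /= => tn.
  by apply: nt; exists n.
- by move=> [n|] //; apply: measurableT_comp (st_mb S n) _; exact: measurable_snd.
- move=> [n|] [t x] [/=]; first by rewrite in_itv /= => nt _; exact: fieldE.
  move=> nt _; rewrite /field; case: pselect => //= -[n tn]; exfalso; apply: nt.
  by exists n => //=; rewrite in_itv.
Qed.

Lemma clamp_itv n t : 0 <= clamp n t <= T n.+1 - T n.
Proof.
rewrite /clamp le_max lexx /= ge_max ge_min lexx orbT andbT.
exact: ltW (d_gt0 n).
Qed.

Lemma clamp_in n t : T n <= t <= T n.+1 -> clamp n t = t - T n.
Proof. by move=> nt; rewrite /clamp min_l; [rewrite max_r //; lra|lra]. Qed.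

Lemma clamp_before n t : t <= T n -> clamp n t = 0.
Proof.
by move=> nt; rewrite /clamp max_l// ge_min; apply/orP; left; lra.
Qed.

Lemma clamp_after n t : T n.+1 <= t -> clamp n t = T n.+1 - T n.
Proof. by move=> nt; have := d_gt0 n => dn; rewrite /clamp min_r; [rewrite max_r //; lra|lra]. Qed.

Let GV0 n z : GV n 0 z = z.
Proof.
rewrite -{1}(st_G0 S n z); apply: (st_GK S); rewrite lexx /=.
exact: ltW (d_gt0 n).
Qed.

Lemma pos_stable n m t z : t <= T n -> (n <= m)%N -> pos m t z = pos n t z.
Proof.
move=> tn /subnK <-; elim: (m - n)%N => // k IH; rewrite addSn /=.
rewrite clamp_before ?(st_G0 S)//; apply: le_trans tn _; apply: T_le.
exact: leq_addl.
Qed.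

Lemma posV_stable n m t z : t <= T n -> (n <= m)%N -> posV m t z = posV n t z.
Proof.
move=> tn /subnK <-; elim: (m - n)%N => // k IH; rewrite addSn /=.
rewrite clamp_before ?GV0//; apply: le_trans tn _; apply: T_le.
exact: leq_addl.
Qed.

Let limn_stable (u : nat -> R) n l : (forall m, (n <= m)%N -> u m = l) -> u @ \oo --> l.
Proof.
move=> h; apply/cvgrPdist_le => e e0; exists n => // m /= nm.
by rewrite h// subrr normr0 ltW.
Qed.

Lemma traj_pos n t z : t <= T n -> traj t z = pos n t z.
Proof.
move=> tn; rewrite [RHS]surjective_pairing /traj; congr pair; apply/cvg_lim => //;
  by apply: (@limn_stable _ n) => m nm; rewrite (pos_stable _ tn nm).
Qed.

Lemma trajV_pos n t z : t <= T n -> trajV t z = posV n t z.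
Proof.
move=> tn; rewrite [RHS]surjective_pairing /trajV; congr pair; apply/cvg_lim => //;
  by apply: (@limn_stable _ n) => m nm; rewrite (posV_stable _ tn nm).
Qed.

Lemma pos_after n t t' z : T n <= t -> T n <= t' -> pos n t z = pos n t' z.
Proof.
elim: n => // n IH nt nt' /=; rewrite !clamp_after// IH//.
  exact: le_trans (ltW (st_lt S n)) nt.
exact: le_trans (ltW (st_lt S n)) nt'.
Qed.

Lemma posK n t : cancel (pos n t) (posV n t).
Proof. by elim: n => // n IH z /=; rewrite (st_GK S) ?clamp_itv. Qed.

Lemma posVK n t : cancel (posV n t) (pos n t).
Proof. by elim: n => // n IH z /=; rewrite IH (st_GVK S) ?clamp_itv. Qed.

Lemma mp_pos n t : measure_preserving (pos n t).
Proof.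
elim: n => [|n IH]; first exact: mp_id.
exact: mp_comp (st_mpG S (clamp_itv n t)) IH.
Qed.

Lemma mp_posV n t : measure_preserving (posV n t).
Proof.
elim: n => [|n IH]; first exact: mp_id.
exact: mp_comp IH (st_mpGV S (clamp_itv n t)).
Qed.

Lemma trajK t : t < 1 -> cancel (traj t) (trajV t).
Proof.
by move=> /T_above[n tn] z; rewrite (traj_pos _ tn) (trajV_pos _ tn) posK.
Qed.

Lemma trajVK t : t < 1 -> cancel (trajV t) (traj t).
Proof.
by move=> /T_above[n tn] z; rewrite (traj_pos _ tn) (trajV_pos _ tn) posVK.
Qed.

Lemma mp_traj t : t < 1 -> measure_preserving (traj t).
Proof.
move=> /T_above[n tn]; have := mp_pos n t; congr measure_preserving.
by apply/funext => z; rewrite (traj_pos _ tn).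
Qed.

Lemma mp_trajV t : t < 1 -> measure_preserving (trajV t).
Proof.
move=> /T_above[n tn]; have := mp_posV n t; congr measure_preserving.
by apply/funext => z; rewrite (trajV_pos _ tn).
Qed.

Lemma traj_le0 t z : t <= 0 -> traj t z = z.
Proof. by move=> t0; rewrite (@traj_pos 0%N)// (st_T0 S). Qed.

Lemma trajV_le0 t z : t <= 0 -> trajV t z = z.
Proof. by move=> t0; rewrite (@trajV_pos 0%N)// (st_T0 S). Qed.

Lemma traj_stage n t z : T n <= t <= T n.+1 ->
  traj t z = G n (t - T n) (traj (T n) z).
Proof.
move=> /andP[nt tn]; rewrite (traj_pos _ tn) /= clamp_in ?nt//.
by rewrite (@traj_pos n)// (@pos_after n t (T n)).
Qed.

Lemma traj_after t z : 1 <= t -> traj t z = traj 1 z.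
Proof.
move=> t1; have E n : pos n t z = pos n 1 z.
  by apply: pos_after; have := st_T1 S n; lra.
by rewrite /traj; congr (limn _, limn _); apply/funext => n; rewrite E.
Qed.

Lemma traj_outside t z : ~ Q z -> traj t z = z.
Proof.
move=> nQ; have E n : pos n t z = z.
  by elim: n => //= n ->; apply: (st_GQ' S) => //; exact: clamp_itv.
rewrite [RHS]surjective_pairing /traj; congr pair; apply/cvg_lim => //;
  by apply: (@limn_stable _ 0%N) => m _; rewrite E.
Qed.

Lemma traj_inside t z : t < 1 -> Q z -> Q (traj t z).
Proof.
move=> /T_above[n tn] Qz; rewrite (traj_pos _ tn); elim: n {tn} => //= n IH.
by apply: (st_GQ S) => //; exact: clamp_itv.
Qed.

Definition flow_right t z := exists2 e, 0 < e & forall h, 0 <= h < e ->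
  traj (t + h) z = traj t z + h *: field (t, traj t z) /\
  field (t + h, traj (t + h) z) = field (t, traj t z).

Lemma traj_right t z : flow_right t z.
Proof.
have [t0|t0] := ltP t 0.
  exists (- t); first by lra.
  move=> h h0; rewrite !traj_le0; [|lra|lra].
  by rewrite !field0 ?scaler0 ?addr0//; lra.
have [t1|t1] := ltP t 1; last first.
  exists 1 => // h h0; rewrite traj_after ?[traj t z]traj_after//; last by lra.
  by rewrite !field0 ?scaler0 ?addr0//; lra.
have [|n nt] := @T_bracket t; first by rewrite t0.
have [|e e0 he] := st_right S (n := n) (s := t - T n) (traj (T n) z); first by lra.
exists (Num.min e (T n.+1 - t)); first by rewrite lt_min; lra.
move=> h; rewrite lt_min => h0; have [|A B] := he h; first by lra.
have nth : T n <= t + h < T n.+1 by lra.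
rewrite (fieldE _ nt) (fieldE _ nth) (@traj_stage n t); last by lra.
by rewrite (@traj_stage n (t + h)) ?[t + h - _]addrAC; [split|lra].
Qed.

Lemma traj_left t z : t < 1 -> left_affine (traj ^~ z) t.
Proof.
move=> t1; have [t0|t0] := leP t 0.
  by exists 1 => //; exists 0 => h h0; rewrite !traj_le0 ?scaler0 ?subr0//; lra.
have [n nt] : exists n, T n < t <= T n.+1.
  have [|n nt] := @T_bracket t; first by lra.
  have [e|ne] := eqVneq (T n) t; last by exists n; move: nt; rewrite le_eqVlt (negPf ne) /=; lra.
  case: n => [|n] in e nt *; first by move: e; rewrite (st_T0 S); lra.
  by exists n; have := st_lt S n; lra.
have [|e e0 [v hv]] := st_left S (n := n) (s := t - T n) (traj (T n) z); first by lra.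
exists (Num.min e (t - T n)); first by rewrite lt_min; lra.
exists v => h; rewrite lt_min => h0.
rewrite (@traj_stage n (t - h)); last by lra.
rewrite (@traj_stage n t); last by lra.
by rewrite -hv; [congr (G n _ _); ring|lra].
Qed.

Lemma left_affine_cont (c : R -> R * R) t : left_affine c t -> forall r : R, 0 < r ->
  exists2 e, 0 < e & forall t', t - e < t' <= t ->
    `|(c t').1 - (c t).1| <= r /\ `|(c t').2 - (c t).2| <= r.
Proof.
move=> [e e0 [v hv]] r r0; pose K := `|v.1| + `|v.2| + 1.
have v1 := normr_ge0 v.1; have v2 := normr_ge0 v.2.
have K0 : 0 < K by rewrite /K; lra.
exists (Num.min e (r / K)); first by rewrite lt_min e0 divr_gt0.
move=> t' /andP[]; rewrite ltrBlDl -ltrBlDr lt_min => /andP[te tr] tt.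
have := hv (t - t'); rewrite subKr => -> //; last by lra.
have {}tr : (t - t') * K < r by rewrite -ltr_pdivlMr.
have -> : (c t - (t - t') *: v).1 - (c t).1 = - ((t - t') * v.1) by rewrite /= addrAC subrr add0r.
have -> : (c t - (t - t') *: v).2 - (c t).2 = - ((t - t') * v.2) by rewrite /= addrAC subrr add0r.
rewrite !normrN !normrM (ger0_norm (_ : 0 <= t - t')); last by lra.
by rewrite /K in tr; split; nra.
Qed.

Lemma traj_lipschitz s t z : s <= t -> t < 1 ->
  `|(traj t z).1 - (traj s z).1| <= M * (t - s) /\
  `|(traj t z).2 - (traj s z).2| <= M * (t - s).
Proof.
move=> st t1; split.
- apply: (@lipschitz_of_right _ (fun t => (traj t z).1)) => //.
  + move=> x xt; have [e e0 he] := @traj_right x z.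
    exists e => // y xy; have [|A _] := he (y - x); first by lra.
    have yE : x + (y - x) = y by ring.
    move: A; rewrite yE => ->; rewrite /= addrAC subrr add0r.
    rewrite [X in `|X|]/(_ * _) normrM mulrC ler_pM// ?(field_bound _).1//.
    by rewrite ger0_norm//; lra.
  + move=> x xt r r0; have [|e e0 he] := left_affine_cont (@traj_left x z _) r0; first by lra.
    exists e => // y xy; have [|A1 A2] := he y; [lra|exact: A1].
- apply: (@lipschitz_of_right _ (fun t => (traj t z).2)) => //.
  + move=> x xt; have [e e0 he] := @traj_right x z.
    exists e => // y xy; have [|A _] := he (y - x); first by lra.
    have yE : x + (y - x) = y by ring.
    move: A; rewrite yE => ->; rewrite /= addrAC subrr add0r.
    rewrite [X in `|X|]/(_ * _) normrM mulrC ler_pM// ?(field_bound _).2//.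
    by rewrite ger0_norm//; lra.
  + move=> x xt r r0; have [|e e0 he] := left_affine_cont (@traj_left x z _) r0; first by lra.
    exists e => // y xy; have [|A1 A2] := he y; [lra|exact: A2].
Qed.


Let T_cvg : T @ \oo --> (1 : R).
Proof.
apply/cvgrPdist_le => e e0; have [n nT] := st_Tlim S e0; exists n => // m /= nm.
have aux (a c d : R) : 1 - d < a -> a <= c -> c < 1 -> `|1 - c| <= d.
  by move=> *; rewrite ger0_norm; lra.
exact: aux nT (T_le nm) (st_T1 S m).
Qed.

Let M_ge0 : 0 <= M.
Proof. by apply: le_trans (st_b1 S 0%N 0); exact: normr_ge0. Qed.

Let lipschitz_cvg (u : nat -> R) :
  (forall n m, (n <= m)%N -> `|u m - u n| <= M * (T m - T n)) -> cvgn u.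
Proof.
move=> lu; pose v n := u n + M * T n.
have cv : cvgn v.
  apply: nondecreasing_is_cvgn.
    move=> n m nm; have := lu _ _ nm; rewrite ler_norml /v; lra.
  exists (u 0%N + M * 2) => _ [n _ <-].
  have := lu 0%N n isT; rewrite ler_norml (st_T0 S) /v => /andP[_ h].
  have : M * T n <= M by rewrite ler_piMr// ltW// (st_T1 S).
  lra.
have -> : u = v \- (fun n => M * T n) by apply/funext => n; rewrite /v /= addrK.
apply: is_cvgB => //; apply: is_cvgM; first exact: is_cvg_cst.
by apply/cvg_ex; exists 1.
Qed.

Let traj_T_cvg z : cvgn (fun n => (traj (T n) z).1) /\ cvgn (fun n => (traj (T n) z).2).
Proof.
by split; apply: lipschitz_cvg => n m nm;
  have [] := @traj_lipschitz (T n) (T m) z (T_le nm) (st_T1 S m).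
Qed.

Let pos_T n t z : 1 <= t -> pos n t z = traj (T n) z.
Proof.
move=> t1; rewrite (@traj_pos n)//; apply: pos_after => //.
exact: ltW (lt_le_trans (st_T1 S n) t1).
Qed.

Lemma traj_cvg t z : (fun n => (pos n t z).1) @ \oo --> (traj t z).1 /\
  (fun n => (pos n t z).2) @ \oo --> (traj t z).2.
Proof.
have [t1|t1] := ltP t 1.
  have [n tn] := T_above t1; rewrite (traj_pos z tn).
  by split; apply: (@limn_stable _ n) => m nm; rewrite (pos_stable z tn nm).
have [c1 c2] := traj_T_cvg z.
have E1 : (fun n => (pos n t z).1) = (fun n => (traj (T n) z).1).
  by apply/funext => n; rewrite pos_T.
have E2 : (fun n => (pos n t z).2) = (fun n => (traj (T n) z).2).
  by apply/funext => n; rewrite pos_T.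
have -> : traj t z = (limn (fun n => (traj (T n) z).1), limn (fun n => (traj (T n) z).2)).
  by rewrite -E1 -E2.
by rewrite E1 E2.
Qed.

Lemma traj_lipschitz1 t z : t < 1 ->
  `|(traj 1 z).1 - (traj t z).1| <= M * (1 - t) /\
  `|(traj 1 z).2 - (traj t z).2| <= M * (1 - t).
Proof.
move=> t1; have [c1 c2] := traj_cvg 1 z.
have [n0 tn0] := T_above t1.
have lip n : (n0 <= n)%N -> `|(pos n 1 z).1 - (traj t z).1| <= M * (1 - t) /\
    `|(pos n 1 z).2 - (traj t z).2| <= M * (1 - t).
  move=> n0n; have tn := le_trans tn0 (T_le n0n); rewrite pos_T//.
  have [h1 h2] := traj_lipschitz z tn (st_T1 S n).
  have h : M * (T n - t) <= M * (1 - t).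
    by apply: ler_wpM2l => //; have := st_T1 S n; lra.
  by split; [exact: le_trans h1 h|exact: le_trans h2 h].
have key (u : nat -> R) (l a K : R) : u @ \oo --> l ->
    (forall n, (n0 <= n)%N -> `|u n - a| <= K) -> `|l - a| <= K.
  move=> ul uK; apply/ler_addgt0Pr => r r0.
  have /cvgrPdist_le /(_ r r0) [n1 _ hn1] := ul.
  have h1 := hn1 (maxn n0 n1) (leq_maxr _ _).
  have h2 := uK (maxn n0 n1) (leq_maxl _ _).
  have -> : l - a = (u (maxn n0 n1) - a) + (l - u (maxn n0 n1)) by ring.
  by apply: le_trans (ler_normD _ _) _; exact: lerD.
by split; [apply: key c1 _|apply: key c2 _] => n /lip [].
Qed.

Lemma traj_left_cont t z (r : R) : 0 < r -> exists2 e : R, 0 < e & forall t', t - e < t' <= t ->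
  `|(traj t' z).1 - (traj t z).1| <= r /\ `|(traj t' z).2 - (traj t z).2| <= r.
Proof.
move=> r0; have [t1|t1|->] := ltgtP t 1.
- by have [e e0 he] := left_affine_cont (traj_left z t1) r0; exists e.
- exists (t - 1); first by lra.
  move=> t' tt; rewrite (traj_after z (ltW t1)) (@traj_after t'); last by lra.
  by rewrite !subrr normr0; split; exact: ltW.
- exists (r / (M + 1)); first by apply: divr_gt0 => //; have := M_ge0; lra.
  move=> t' /andP[h]; rewrite le_eqVlt => /predU1P[->|t1'].
    by rewrite !subrr normr0; split; exact: ltW.
  have [h1 h2] := traj_lipschitz1 z t1'.
  have : (1 - t') * (M + 1) < r by rewrite -ltr_pdivlMr; have := M_ge0; lra.
  by split; rewrite distrC; nra.
Qed.

Let measurable_stage (F : nat -> R -> R * R -> R * R) :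
  (forall n s, 0 <= s <= T n.+1 - T n -> measurable_fun setT (F n s)) ->
  (forall n s z, 0 < s <= T n.+1 - T n -> left_affine (fun s => F n s z) s) ->
  forall n, measurable_fun setT (fun y : R * (R * R) => F n (clamp n y.1) y.2).
Proof.
move=> mF lF n.
have lc t z (r : R) : 0 < r -> exists2 e : R, 0 < e & forall t', t - e < t' <= t ->
    `|(F n (clamp n t') z).1 - (F n (clamp n t) z).1| <= r /\
    `|(F n (clamp n t') z).2 - (F n (clamp n t) z).2| <= r.
  move=> r0; have r0' := ltW r0; have [tn|tn] := leP t (T n).
    exists 1 => // t' tt; rewrite !clamp_before ?subrr ?normr0//; lra.
  have [tn'|tn'] := leP t (T n.+1); last first.
    exists (t - T n.+1); first by lra.
    by move=> t' tt; rewrite !clamp_after ?subrr ?normr0//; lra.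
  have [|e e0 he] := left_affine_cont (lF n (t - T n) z _) r0; first by lra.
  exists (Num.min e (t - T n)); first by rewrite lt_min; lra.
  move=> t' /andP[]; rewrite ltrBlDl -ltrBlDr lt_min => tt tt'.
  by rewrite !clamp_in; [apply: he; lra|lra|lra].
have m1 s : measurable_fun setT (fun x => (F n (clamp n s) x).1).
  by apply: measurableT_comp measurable_fst _; exact: mF (clamp_itv n s).
have m2 s : measurable_fun setT (fun x => (F n (clamp n s) x).2).
  by apply: measurableT_comp measurable_snd _; exact: mF (clamp_itv n s).
have M1 := @measurable_left_continuous _ _ _ (fun y => (F n (clamp n y.1) y.2).1) m1.
have M2 := @measurable_left_continuous _ _ _ (fun y => (F n (clamp n y.1) y.2).2) m2.
have {}M1 : measurable_fun setT (fun y : R * (R * R) => (F n (clamp n y.1) y.2).1).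
  by apply: M1 => s x r /(lc s x)[e e0 he]; exists e => // t' /he[].
have {}M2 : measurable_fun setT (fun y : R * (R * R) => (F n (clamp n y.1) y.2).2).
  by apply: M2 => s x r /(lc s x)[e e0 he]; exists e => // t' /he[].
have := measurable_fun_pair M1 M2; congr measurable_fun.
by apply/funext => y; rewrite -surjective_pairing.
Qed.

Lemma measurable_pos n : measurable_fun setT (fun y : R * (R * R) => pos n y.1 y.2).
Proof.
elim: n => [|n IH] /=; first exact: measurable_snd.
have mG : measurable_fun setT (fun y : R * (R * R) => G n (clamp n y.1) y.2).
  apply: measurable_stage; last exact: st_left S.
  by move=> k s sk; exact: (st_mpG S sk).1.
have mp : measurable_fun setT (fun y : R * (R * R) => (y.1, pos n y.1 y.2)).
  by apply: measurable_fun_pair => //; exact: measurable_fst.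
exact: measurableT_comp mG mp.
Qed.

Lemma measurable_posV n : measurable_fun setT (fun y : R * (R * R) => posV n y.1 y.2).
Proof.
elim: n => [|n IH] /=; first exact: measurable_snd.
have mG : measurable_fun setT (fun y : R * (R * R) => GV n (clamp n y.1) y.2).
  apply: measurable_stage; last exact: st_leftV S.
  by move=> k s sk; exact: (st_mpGV S sk).1.
have mp : measurable_fun setT (fun y : R * (R * R) => (y.1, GV n (clamp n y.1) y.2)).
  by apply: measurable_fun_pair => //; exact: measurable_fst.
exact: measurableT_comp IH mp.
Qed.

(** Limits of left continuous curves depending measurably on the starting point. *)
Lemma measurable_traj : measurable_fun setT (fun y : R * (R * R) => traj y.1 y.2).
Proof.
have := @measurable_fun_pair _ _ _ (R * (R * R))%type R R
  (fun y => (traj y.1 y.2).1) (fun y => (traj y.1 y.2).2).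
apply.
- apply: (@measurable_fun_cvg _ _ _ _ (fun n (y : R * (R * R)) => (pos n y.1 y.2).1)).
    by move=> n; exact: measurableT_comp measurable_fst (measurable_pos n).
  by move=> y _; have [] := traj_cvg y.1 y.2.
- apply: (@measurable_fun_cvg _ _ _ _ (fun n (y : R * (R * R)) => (pos n y.1 y.2).2)).
    by move=> n; exact: measurableT_comp measurable_snd (measurable_pos n).
  by move=> y _; have [] := traj_cvg y.1 y.2.
Qed.

Lemma measurable_trajV : measurable_fun setT
  (fun y : R * (R * R) => if y.1 < 1 then trajV y.1 y.2 else y.2).
Proof.
have m1 : measurable_fun setT (fun y : R * (R * R) => y.1 < 1).
  by apply: measurable_fun_ltr => //; exact: measurable_fst.
pose h n (y : R * (R * R)) := if y.1 < 1 then posV n y.1 y.2 else y.2.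
have mh n : measurable_fun setT (h n).
  by apply: measurable_fun_ifT => //; exact: measurable_posV.
have ch y : exists n, forall m, (n <= m)%N ->
    h m y = if y.1 < 1 then trajV y.1 y.2 else y.2.
  rewrite /h; case: ltP => [/T_above[n tn]|_]; last by exists 0%N.
  by exists n => m nm; rewrite (trajV_pos _ tn) (posV_stable _ tn nm).
pose V (y : R * (R * R)) := if y.1 < 1 then trajV y.1 y.2 else y.2.
suff : measurable_fun setT (fun y => ((V y).1, (V y).2)).
  by congr measurable_fun; apply/funext => y; rewrite -surjective_pairing.
apply: measurable_fun_pair.
- apply: (@measurable_fun_cvg _ _ _ _ (fun n y => (h n y).1)).
    by move=> n; exact: measurableT_comp measurable_fst (mh n).
  by move=> y _; have [n hn] := ch y; apply: (@limn_stable _ n) => m /hn ->.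
- apply: (@measurable_fun_cvg _ _ _ _ (fun n y => (h n y).2)).
    by move=> n; exact: measurableT_comp measurable_snd (mh n).
  by move=> y _; have [n hn] := ch y; apply: (@limn_stable _ n) => m /hn ->.
Qed.

Lemma measurable_traj_time z : measurable_fun setT (fun t => traj t z).
Proof.
have mz : measurable_fun setT (fun t : R => (t, z)).
  by apply: measurable_fun_pair => //; exact: measurable_cst.
exact: measurableT_comp measurable_traj mz.
Qed.

(** Locally to the right a trajectory is a segment on which the field is constant, so the
    one-dimensional fundamental theorem of calculus along this segment suffices. *)
Lemma traj_chain H H0 H1 H2 (B : R) z u w : C1_with_gradient H H0 H1 H2 ->
  measurable_fun setT H0 -> measurable_fun setT H1 -> measurable_fun setT H2 ->
  (forall y, `|H0 y| <= B) -> (forall y, `|H1 y| <= B) -> (forall y, `|H2 y| <= B) ->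
  primitive_on (fun t => H (t, traj t z))
    (fun t => along H0 H1 H2 (field (t, traj t z)) (t, traj t z)) u w.
Proof.
move=> C1 m0 m1 m2 b0 b1 b2.
have mtz : measurable_fun setT (fun t => (t, traj t z)).
  by apply: measurable_fun_pair => //; exact: measurable_traj_time.
have mf : measurable_fun setT (fun t => field (t, traj t z)).
  exact: measurableT_comp measurable_field mtz.
apply: (@primitive_of_right _ _ _ (B + M * B + M * B)).
- apply: measurable_funD; first apply: measurable_funD.
  + exact: measurableT_comp m0 mtz.
  + apply: measurable_funM; last exact: measurableT_comp m1 mtz.
    exact: measurableT_comp measurable_fst mf.
  + apply: measurable_funM; last exact: measurableT_comp m2 mtz.
    exact: measurableT_comp measurable_snd mf.
- move=> t _; have [f1 f2] := field_bound (t, traj t z).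
  apply: le_trans (ler_normD _ _) _; apply: lerD; last by rewrite normrM; exact: ler_pM.
  by apply: le_trans (ler_normD _ _) _; apply: lerD => //; rewrite normrM; exact: ler_pM.
- move=> t _; have [e e0 he] := traj_right t z; exists e => // t' tt'.
  pose v := field (t, traj t z); pose y0 : R * (R * R) := (0, traj t z - t *: v).
  have lineE (x : R) : t <= x <= t' -> (x, traj x z) = y0 + x *: (1, v) /\ field (x, traj x z) = v.
    move=> tx; have [|A A'] := he (x - t); first by lra.
    have xE : t + (x - t) = x by ring.
    rewrite xE in A A'; split; last by rewrite A'.
    rewrite A -/v -[RHS]/(0 + x * 1, traj t z - t *: v + x *: v) add0r mulr1.
    by rewrite scalerBl -!addrA; congr (_, _ + _); rewrite addrC.
  have tt : t < t' by lra.
  have [|-> _] := lineE t'; first by lra.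
  have [|-> _] := lineE t; first by lra.
  rewrite -(line_ftc C1 y0 v tt); apply: eq_Rintegral => x.
  rewrite inE /= in_itv /= => /lineE[E1 E2].
  by rewrite E2 E1.
- move=> t _ r r0.
  have /cvgrPdist_le /(_ r r0) := @C1_cont _ _ _ _ _ C1 (t, traj t z).
  move=> /nbhs_ballP[d /= d0 hd].
  have d2 : 0 < d / 2 by lra.
  have [e e0 he] := traj_left_cont t z d2.
  exists (Num.min e d); first by rewrite lt_min e0.
  move=> t' /andP[]; rewrite ltrBlDl -ltrBlDr lt_min => tt tt'.
  rewrite distrC; apply: (hd (t', traj t' z)).
  have [|h1 h2] := he t'; first by lra.
  split; first by rewrite /ball /= ger0_norm; lra.
  by split; rewrite /ball /= distrC; apply: le_lt_trans (_ : d / 2 < d); by [|lra].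
Qed.

End Composition.

(** * The cells of the mixing stages *)

Section Rational.
Context {R : realType}.
Implicit Types x y : R.

Definition rational_num x : Prop := exists q : rat, x = ratr q.

Lemma rational_nat (n : nat) : rational_num n%:R.
Proof. by exists n%:R; rewrite ratr_nat. Qed.

Lemma rationalD x y : rational_num x -> rational_num y -> rational_num (x + y).
Proof. by move=> [q ->] [r ->]; exists (q + r); rewrite rmorphD. Qed.

Lemma rationalN x : rational_num x -> rational_num (- x).
Proof. by move=> [q ->]; exists (- q); rewrite rmorphN. Qed.

Lemma rationalM x y : rational_num x -> rational_num y -> rational_num (x * y).
Proof. by move=> [q ->] [r ->]; exists (q * r); rewrite rmorphM. Qed.

Lemma rationalV x : rational_num x -> rational_num x^-1.
Proof. by move=> [q ->]; exists (q^-1); rewrite fmorphV. Qed.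

Definition irrational_coords (z : R * R) : Prop :=
  ~ rational_num z.1 /\ ~ rational_num z.2.

Lemma irrational_reflect (c z : R * R) : rational_num c.1 -> rational_num c.2 ->
  irrational_coords z -> irrational_coords (2 * c.1 - z.1, 2 * c.2 - z.2).
Proof.
have key a b : rational_num a -> ~ rational_num b -> ~ rational_num (2 * a - b).
  move=> ra rb rab; apply: rb.
  have -> : b = 2 * a + - (2 * a - b) by ring.
  by apply: rationalD; [apply: rationalM => //; exact: rational_nat|exact: rationalN].
by move=> r1 r2 [z1 z2]; split; exact: key.
Qed.

End Rational.

Section ConcreteStages.
Context {R : realType}.
Implicit Types (n m k j : nat) (z : R * R) (s t : R).

(** At the stages [n = 2m] and [n = 2m + 1] the square is cut into [4 * 2 ^ m] columns of
    this width and as many rows of this height. *)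
Definition width n : R := (2 ^+ (n./2 + 2))^-1.
(** The stage [n] lasts [width n]; the two stages of each scale last [2 / 2 ^ (m + 2)], and
    these durations sum to [1]. *)
Definition stage_time n : R := 1 - width n * (4 - (odd n)%:R).

Definition half_w n : R := if odd n then width n / 2 else width n.
Definition half_h n : R := width n / 2.

Definition cell_index : countType := (nat * bool * nat)%type.

(** A cell is given by its block [i.1.1] of four consecutive columns, its row [i.2], and,
    at odd stages, by which of the two middle columns of the block it lies in. *)
Definition cell_dom n : set cell_index := [set i |
  (i.1.1 < 2 ^ n./2)%N /\ (i.2 < 2 ^ (n./2 + 2))%N /\ (~~ odd n -> i.1.2 = false)].

(** Even stages turn the rectangle made of the two middle columns of a block in one row;
    odd stages turn the two squares of this rectangle separately. *)
Definition cell_center n (i : cell_index) : R * R :=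
  (width n * (4 * i.1.1%:R + (if odd n then 3 / 2 + i.1.2%:R else 2)),
   width n * (i.2%:R + 1 / 2)).

(** The factor [4 / width n] makes the stage perform exactly half a period. *)
Definition stage_flow n s : R * R -> R * R :=
  tile_flow (cell_dom n) (cell_center n) (half_w n) (half_h n) (4 / width n * s).
Definition stage_flowV n s : R * R -> R * R :=
  tile_flow (cell_dom n) (cell_center n) (half_w n) (half_h n) (8 - 4 / width n * s).
Definition stage_vel n z : R * R :=
  (4 / width n) *: tile_vel (cell_dom n) (cell_center n) (half_w n) (half_h n) z.

Definition open_square : set (R * R) := [set z | 0 < z.1 < 1 /\ 0 < z.2 < 1].

Notation in_cell n := (tile_cell (cell_dom n) (cell_center n) (half_w n) (half_h n)).

Lemma width_gt0 n : 0 < width n.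
Proof. by rewrite /width invr_gt0 exprn_gt0. Qed.

Lemma half_w_gt0 n : 0 < half_w n.
Proof. by have := width_gt0 n; rewrite /half_w; case: ifP => _; lra. Qed.

Lemma half_h_gt0 n : 0 < half_h n.
Proof. by have := width_gt0 n; rewrite /half_h; lra. Qed.

Lemma widthSS n : width n.+2 = width n / 2.
Proof. by rewrite /width /= addSn exprS invfM mulrC. Qed.

Lemma width_odd n : ~~ odd n -> width n.+1 = width n.
Proof. by rewrite /width /= uphalf_half => /negbTE ->. Qed.

Lemma stage_timeS n : stage_time n.+1 = stage_time n + width n.
Proof.
have h : odd n -> width n.+1 = width n / 2.
  by case: n => // n /= /width_odd ->; rewrite widthSS.
rewrite /stage_time /=; have [on|on] := boolP (odd n).
  by rewrite h//=; lra.
by rewrite width_odd//= ; lra.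
Qed.

Lemma stage_timeB n : stage_time n.+1 - stage_time n = width n.
Proof. by rewrite stage_timeS addrC addKr. Qed.

Lemma natrX2 n : (2 ^ n)%:R = 2 ^+ n :> R. Proof. exact: natrX. Qed.

Lemma width_pow n : width n * (2 ^ (n./2 + 2))%:R = 1.
Proof. by rewrite natrX2 /width mulVf// expf_neq0// pnatr_eq0. Qed.

Lemma width_pow4 n : width n * (4 * (2 ^ n./2)%:R) = 1.
Proof. by rewrite -[RHS](width_pow n) expnD natrM; congr (_ * _); rewrite mulrC. Qed.

Lemma in_cellP n (i : cell_index) z : in_cell n i z <-> cell_dom n i /\
  `|z.1 - (cell_center n i).1| < half_w n /\ `|z.2 - (cell_center n i).2| < half_h n.
Proof.
have p0 := half_w_gt0 n; have q0 := half_h_gt0 n.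
rewrite /tile_cell /sqnorm /scale_chartV /= gt_max !normrM !normfV.
rewrite (gtr0_norm p0) (gtr0_norm q0) !ltr_pdivrMr// !mul1r.
by split=> [[? /andP[]]|[? [-> ->]]].
Qed.

Lemma in_cell_grid n (i : cell_index) z : in_cell n i z <-> cell_dom n i /\
  (width n * i.2%:R < z.2 < width n * (i.2%:R + 1)) /\
  (if odd n then width n * (4 * i.1.1%:R + 1 + i.1.2%:R) < z.1 <
      width n * (4 * i.1.1%:R + 2 + i.1.2%:R)
   else width n * (4 * i.1.1%:R + 1) < z.1 < width n * (4 * i.1.1%:R + 3)).
Proof.
rewrite in_cellP /cell_center /half_w /half_h; case: ifP => on /=;
  rewrite !ltr_norml; split => -[Di [h1 h2]]; (split => //); split; lra.
Qed.

Lemma nat_lt_of_real (a b : nat) : (a%:R : R) < b%:R + 1 -> (a <= b)%N.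
Proof. by rewrite natr1 ltr_nat ltnS. Qed.

Lemma divmod4_uniq (u v x y : nat) : (x <= 1)%N -> (y <= 1)%N ->
  (4 * u + x = 4 * v + y)%N -> u = v /\ x = y.
Proof. by lia. Qed.

Lemma in_cell_disj n (i j : cell_index) z : in_cell n i z -> in_cell n j z -> i = j.
Proof.
have w0 := width_gt0 n.
have cmp (a b : R) : width n * a < width n * b -> a < b by rewrite ltr_pM2l.
move=> /in_cell_grid [[_ [_ Ei]] [yi xi]] /in_cell_grid [[_ [_ Ej]] [yj xj]].
have yij : i.2 = j.2.
  by apply/eqP; rewrite eqn_leq; apply/andP; split; apply: nat_lt_of_real; apply: cmp; lra.
case: i j yij Ei Ej xi xj {yi yj} => [[k b] l] [[k' b'] l'] /= ->.
case: ifP => on Ei Ej xi xj.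
  have E (u v : nat) : (4 * u + v)%:R = 4 * u%:R + v%:R :> R by rewrite natrD natrM.
  have /cmp h1 : width n * (4 * k%:R + 1 + b%:R) < width n * (4 * k'%:R + 2 + b'%:R) by lra.
  have /cmp h2 : width n * (4 * k'%:R + 1 + b'%:R) < width n * (4 * k%:R + 2 + b%:R) by lra.
  have kb : (4 * k + b = 4 * k' + b')%N.
    by apply/eqP; rewrite eqn_leq; apply/andP; split; apply: nat_lt_of_real; rewrite !E; lra.
  have [-> bb] := divmod4_uniq (leq_b1 b) (leq_b1 b') kb.
  by case: b b' bb {kb Ei Ej xi xj h1 h2} => -[].
rewrite Ei ?on// Ej ?on//; congr (_, _, _).
apply/eqP; rewrite eqn_leq; apply/andP; split; apply: nat_lt_of_real.
  have /cmp h : width n * (4 * k%:R + 1) < width n * (4 * k'%:R + 3) by lra.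
  lra.
have /cmp h : width n * (4 * k'%:R + 1) < width n * (4 * k%:R + 3) by lra.
lra.
Qed.

Lemma in_cell_square n (i : cell_index) z : in_cell n i z -> open_square z.
Proof.
have w0 := width_gt0 n; move=> /in_cell_grid [[kn [jn _]] [yi xi]].
have k0 : 0 <= i.1.1%:R :> R by []. have j0 : 0 <= i.2%:R :> R by [].
have b0 : 0 <= (i.1.2%:R : R) <= 1 by rewrite ler0n lern1 leq_b1.
have kn' : i.1.1%:R + 1 <= (2 ^ n./2)%:R :> R by rewrite natr1 ler_nat.
have jn' : i.2%:R + 1 <= (2 ^ (n./2 + 2))%:R :> R by rewrite natr1 ler_nat.
have J := ler_wpM2l (ltW w0) jn'; rewrite width_pow in J.
have K : width n * (4 * (i.1.1%:R + 1)) <= 1.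
  by rewrite -[leRHS](width_pow4 n) ler_pM2l// ler_pM2l.
have wk : 0 <= width n * i.1.1%:R by exact: mulr_ge0 (ltW w0) k0.
have wj : 0 <= width n * i.2%:R by exact: mulr_ge0 (ltW w0) j0.
have wb : 0 <= width n * i.1.2%:R <= width n.
  by have /andP[? ?] := b0; rewrite mulr_ge0 ?(ltW w0)//= ler_piMr ?(ltW w0).
by split; [case: ifP xi => _ xi; lra|lra].
Qed.


Lemma stage_time_lt1 n : stage_time n < 1.
Proof.
have w0 := width_gt0 n; rewrite /stage_time.
have : 0 < width n * (4 - (odd n)%:R).
  by apply: mulr_gt0 => //; case: (odd n); rewrite ?subr0 //= ; lra.
lra.
Qed.

Lemma width_le n : width n <= 2 / n.+1%:R.
Proof.
rewrite /width -[leLHS]mul1r ler_pdivlMr// mulrAC ler_pdivrMr ?exprn_gt0// mul1r -natrX2.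
rewrite -natrM ler_nat; have : (n./2 < 2 ^ n./2)%N by exact: ltn_expl.
by rewrite expnD -{1}(odd_double_half n); case: (odd n); lia.
Qed.

Lemma stage_time_lim (e : R) : 0 < e -> exists n, 1 - e < stage_time n.
Proof.
move=> e0; have e8 : 0 < e / 8 by lra.
have [n ne] : exists n, n.+1%:R^-1 < e / 8.
  by have [n _ /(_ _ (leqnn n))] := near_infty_natSinv_lt (PosNum e8); exists n.
have w1 : width n < e / 4.
  by apply: le_lt_trans (width_le n) _; move: ne; set u := _^-1 => ne; lra.
exists n; have w0 := width_gt0 n; rewrite /stage_time mulrBr.
have : 0 <= width n * (odd n)%:R by rewrite mulr_ge0// ltW.
lra.
Qed.

Notation disj n := (@in_cell_disj n).

Let speed n s : 0 <= s <= width n -> 0 <= 4 / width n * s <= 4.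
Proof.
have w0 := width_gt0 n => /andP[s0 sw]; apply/andP; split.
  by rewrite mulr_ge0// divr_ge0// ltW.
by rewrite mulrAC ler_pdivrMr// ler_pM2l.
Qed.

Let speed8 n s : 0 <= s <= width n -> 0 <= 4 / width n * s <= 8.
Proof. by move=> /speed; lra. Qed.

Let speed8' n s : 0 <= s <= width n -> 0 <= 8 - 4 / width n * s <= 8.
Proof. by move=> /speed; lra. Qed.

Let speed_gt0 n : 0 < 4 / width n.
Proof. by rewrite divr_gt0// width_gt0. Qed.

Lemma concrete_stages :
  stages stage_flow stage_flowV stage_vel stage_time 4 open_square.
Proof.
have p0 n := half_w_gt0 n; have q0 n := half_h_gt0 n; have w0 n := width_gt0 n.
have cell_or n z : (exists i, in_cell n i z) \/ ~ (exists i, in_cell n i z).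
  by case: (pselect (exists i, in_cell n i z)); [left|right].
split; first by rewrite /stage_time /width /= subr0 add0n expr2 -natrM; lra.
- by move=> n; rewrite stage_timeS ltrDl.
- exact: stage_time_lt1.
- exact: stage_time_lim.
- by move=> n z; rewrite /stage_flow mulr0 (tile_flow0 (p0 n) (q0 n) (disj n)).
- move=> n s; rewrite stage_timeB => /speed8 h.
  exact: (tile_flowK (p0 n) (q0 n) (disj n) h).
- move=> n s; rewrite stage_timeB => /speed8 h.
  exact: (tile_flowVK (p0 n) (q0 n) (disj n) h).
- by move=> n s; rewrite stage_timeB => /speed8 h; exact: (mp_tile_flow (p0 n) (q0 n) (disj n) h).
- by move=> n s; rewrite stage_timeB => /speed8' h; exact: (mp_tile_flow (p0 n) (q0 n) (disj n) h).
- move=> n s z; rewrite stage_timeB => s0.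
  have [e e0 he] := tile_flow_right (p0 n) (q0 n) (disj n) (stage_flow n s z).
  exists (e / (4 / width n)); first exact: divr_gt0.
  move=> h /andP[h0]; rewrite ltr_pdivlMr// mulrC => hh.
  have hp : 0 <= 4 / width n * h by rewrite mulr_ge0// ltW.
  have [|A B] := he (4 / width n * h); first by rewrite hp.
  have E : stage_flow n (s + h) z = tile_flow (cell_dom n) (cell_center n)
      (half_w n) (half_h n) (4 / width n * h) (stage_flow n s z).
    rewrite /stage_flow (tile_flow_add (p0 n) (q0 n) (disj n))//; last first.
      by rewrite mulr_ge0 ?(ltW (speed_gt0 _))//; lra.
    by rewrite mulrDr.
  by rewrite E /stage_vel B A; split=> //; rewrite scalerA mulrC.
- move=> n s z; rewrite stage_timeB => s0.
  have t0 : 0 < 4 / width n * s by rewrite mulr_gt0//; lra.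
  have [e e0 [v hv]] := tile_flow_left (disj n) z t0.
  exists (e / (4 / width n)); first exact: divr_gt0.
  exists ((4 / width n) *: v) => h /andP[h0]; rewrite ltr_pdivlMr// mulrC => hh.
  rewrite /stage_flow mulrBr hv; first by rewrite scalerA [h * _]mulrC.
  by rewrite mulr_ge0// ltW.
- move=> n s z; rewrite stage_timeB => s0.
  have [e e0 he] := tile_flow_right (p0 n) (q0 n) (disj n) (stage_flowV n s z).
  exists (Num.min s (e / (4 / width n))); first by rewrite lt_min divr_gt0//; lra.
  exists (- stage_vel n (stage_flowV n s z)) => h; rewrite lt_min => /andP[h0 /andP[hs]].
  rewrite ltr_pdivlMr// mulrC => hh.
  have hp : 0 <= 4 / width n * h by rewrite mulr_ge0// ltW.
  have [|A _] := he (4 / width n * h); first by rewrite hp.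
  have /speed8' /andP[sp _] : 0 <= s <= width n by lra.
  have E : stage_flowV n (s - h) z = tile_flow (cell_dom n) (cell_center n)
      (half_w n) (half_h n) (4 / width n * h) (stage_flowV n s z).
    rewrite /stage_flowV (tile_flow_add (p0 n) (q0 n) (disj n))//.
    by congr (tile_flow _ _ _ _ _ _); ring.
  by rewrite E A /stage_vel scalerN opprK scalerA mulrC.
- move=> n z; have [h1 _] := tile_vel_bound (p0 n) (q0 n) (disj n) z.
  rewrite /stage_vel /= [X in `|X|]/(_ * _) normrM (gtr0_norm (speed_gt0 n)).
  rewrite mulrAC ler_pdivrMr// ler_pM2l//; apply: le_trans h1 _.
  by rewrite /half_w; case: ifP => _ //; have := w0 n; lra.
- move=> n z; have [_ h1] := tile_vel_bound (p0 n) (q0 n) (disj n) z.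
  rewrite /stage_vel /= [X in `|X|]/(_ * _) normrM (gtr0_norm (speed_gt0 n)).
  rewrite mulrAC ler_pdivrMr// ler_pM2l//; apply: le_trans h1 _.
  by rewrite /half_h; have := w0 n; lra.
- move=> n; have m := measurable_tile_vel (disj n).
  apply: measurable_fun_pair => /=; apply: measurable_funM => //.
    exact: measurableT_comp measurable_fst m.
  exact: measurableT_comp measurable_snd m.
- move=> n z nQ; rewrite /stage_vel tile_vel0 ?scaler0//.
  by move=> [i /in_cell_square].
- move=> n s z; rewrite stage_timeB => /speed8/andP[s0 _] Qz.
  have [[i iz]|nz] := cell_or n z; last by rewrite /stage_flow tile_flow_id.
  exact: in_cell_square (tile_cell_flow (p0 n) (q0 n) (disj n) s0 iz).
- move=> n s z _ nQ; rewrite /stage_flow tile_flow_id//.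
  by move=> [i /in_cell_square].
Qed.

End ConcreteStages.

(** * Two consecutive stages exchange two columns *)

Section NetMap.
Context {R : realType}.
Implicit Types (n m k j a : nat) (z : R * R) (s t x y : R).

Notation width := (@width R).
Notation in_cell n := (tile_cell (cell_dom n) (@cell_center R n) (half_w n) (half_h n)).
Notation traj := (traj (@stage_flow R) (@stage_time R)).
Notation stages := (@concrete_stages R).

Lemma natr4 (u v : nat) : (4 * u + v)%:R = 4 * u%:R + v%:R :> R.
Proof. by rewrite natrD natrM. Qed.

(** The open column, or row, number [a] at the scale of stage [n]. Points with irrational
    coordinates lie in exactly one of them at every scale. *)
Definition grid n a x : Prop := width n * a%:R < x < width n * a.+1%:R.

Lemma grid_lt n a b x : width n * a%:R < x -> x < width n * b%:R -> (a < b)%N.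
Proof.
by move=> ax xb; rewrite -(ltr_nat R) -(ltr_pM2l (width_gt0 n)); exact: lt_trans ax xb.
Qed.

Lemma grid_uniq n a b x : grid n a x -> grid n b x -> a = b.
Proof.
by move=> /andP[a1 a2] /andP[b1 b2]; have := grid_lt a1 b2; have := grid_lt b1 a2; lia.
Qed.

Lemma rational_width n : rational_num (width n).
Proof.
rewrite /width; apply: rationalV; rewrite -natrX; exact: rational_nat.
Qed.

Lemma grid_exists n x : 0 < x < 1 -> ~ rational_num x ->
  exists2 a, (a < 2 ^ (n./2 + 2))%N & grid n a x.
Proof.
move=> x01 rx; have w0 := @width_gt0 R n; have xw0 : 0 <= x / width n by apply: divr_ge0; [lra|exact: ltW].
have := truncn_itv xw0; set a := Num.truncn _; rewrite ler_pdivlMr// ltr_pdivrMr//.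
rewrite ![_ * width n]mulrC => /andP[ax xa].
have ax' : width n * a%:R < x.
  rewrite lt_neqAle ax andbT; apply/eqP => xE; apply: rx; rewrite -xE.
  by apply: rationalM; [exact: rational_width|exact: rational_nat].
exists a; last by rewrite /grid ax'.
by apply: grid_lt ax' _; rewrite width_pow; lra.
Qed.

Lemma in_cell_natP n (i : cell_index) z : in_cell n i z <-> cell_dom n i /\
  grid n i.2 z.2 /\
  (if odd n then grid n (4 * i.1.1 + 1 + i.1.2) z.1
   else width n * (4 * i.1.1 + 1)%:R < z.1 < width n * (4 * i.1.1 + 3)%:R).
Proof.
rewrite in_cell_grid /grid -[i.2.+1%:R]natr1.
case: ifP => on; last by rewrite !natr4.
rewrite -[(_ + _ + _).+1%:R]natr1 natrD natr4.
by split => -[D [Y X]]; (split => //; split => //); lra.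
Qed.

Lemma not_in_cell n z a : grid n a z.1 -> (a %% 4 = 0 \/ a %% 4 = 3)%N ->
  ~ exists i, in_cell n i z.
Proof.
move=> az a03 [[[k b] j] /in_cell_natP [_ [_]]] /=; case: ifP => _.
  by move=> /(grid_uniq az) aE; have := leq_b1 b; lia.
move: az => /andP[az za] /andP[kz zk].
by have := grid_lt az zk; have := grid_lt kz za; lia.
Qed.

Lemma stage_rest n z : ~ (exists i, in_cell n i z) -> stage_flow n (width n) z = z.
Proof. exact: tile_flow_id. Qed.

Lemma stage_half n (i : cell_index) z : in_cell n i z -> stage_flow n (width n) z =
  (2 * (cell_center n i).1 - z.1, 2 * (cell_center n i).2 - z.2).
Proof.
move=> iz; have w0 := @width_gt0 R n.
rewrite /stage_flow divfK; last exact: lt0r_neq0.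
exact: (tile_flow4 (half_w_gt0 n) (half_h_gt0 n) (@in_cell_disj _ n) iz).
Qed.

Lemma rational_center n (i : cell_index) :
  rational_num (@cell_center R n i).1 /\ rational_num (@cell_center R n i).2.
Proof.
have rw := rational_width n.
split; rewrite /cell_center /=; apply: rationalM => //; apply: rationalD.
- by apply: rationalM; exact: rational_nat.
- case: ifP => _; last exact: rational_nat.
  apply: rationalD; last exact: rational_nat.
  by apply: rationalM; [|apply: rationalV]; exact: rational_nat.
- exact: rational_nat.
- by apply: rationalM; [|apply: rationalV]; exact: (rational_nat 1) || exact: rational_nat.
Qed.

(** A stage maps a point to itself or to its reflection in a rational point. *)
Lemma irrational_stage n z : irrational_coords z -> irrational_coords (stage_flow n (width n) z).
Proof.
move=> iz; case: (pselect (exists i, in_cell n i z)) => [[i ci]|nc].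
  rewrite (stage_half ci); have [r1 r2] := rational_center n i.
  exact: irrational_reflect.
by rewrite stage_rest.
Qed.

Lemma traj_next n z : traj (stage_time n.+1) z = stage_flow n (width n) (traj (stage_time n) z).
Proof.
rewrite (traj_stage stages (n := n)); last by rewrite stage_timeS lexx lerDl (ltW (width_gt0 n)).
by rewrite stage_timeB.
Qed.

Lemma traj_time0 z : traj (stage_time 0) z = z.
Proof. by apply: (traj_le0 stages); rewrite (st_T0 stages). Qed.

Lemma irrational_traj n z : irrational_coords z -> irrational_coords (traj (stage_time n) z).
Proof.
move=> iz; elim: n => [|n IH]; first by rewrite traj_time0.
by rewrite traj_next; exact: irrational_stage.
Qed.

(** The exchange of the columns [1] and [2] modulo [4]. *)
Definition swap_mid (a : nat) : nat :=
  if (a %% 4 == 1)%N then a.+1 else if (a %% 4 == 2)%N then a.-1 else a.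

Lemma swap_mid_fold a : (swap_mid a %/ 2 + 2 * (a %/ 2) = a + 2 * (a %/ 4))%N.
Proof. by rewrite /swap_mid; case: ifP => h1; [|case: ifP => h2]; lia. Qed.

(** The half-turn of a rectangle exchanges its two columns, reflecting both coordinates;
    the half-turns of the two squares undo the reflections. What remains is the
    horizontal translation that exchanges the two columns. *)
Lemma two_stages n z a : ~~ odd n -> irrational_coords z -> open_square z ->
  grid n a z.1 ->
  stage_flow n.+1 (width n.+1) (stage_flow n (width n) z) =
  (z.1 + width n * ((swap_mid a)%:R - a%:R), z.2).
Proof.
move=> on iz [z1 z2] az; have w0 := @width_gt0 R n.
have wS := @width_odd R n on.
have gS b y : grid n.+1 b y <-> grid n b y by rewrite /grid wS.
have halfS : uphalf n = n./2 by rewrite uphalf_half (negbTE on).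
have [a4|ne] := boolP ((a %% 4 == 0)%N || (a %% 4 == 3)%N).
  have a03 : (a %% 4 = 0 \/ a %% 4 = 3)%N by lia.
  rewrite (stage_rest (not_in_cell az a03)).
  have az' : grid n.+1 a z.1 by apply/gS.
  rewrite (stage_rest (not_in_cell az' a03)).
  have -> : swap_mid a = a by rewrite /swap_mid; case: a03 => ->.
  by rewrite subrr mulr0 addr0 -surjective_pairing.
have [j jn jz] := grid_exists n z2 iz.2.
pose k := (a %/ 4)%N; pose c := (a %% 4 == 2)%N.
have aE : a = (4 * k + 1 + c)%N by rewrite /k /c; lia.
have kn : (k < 2 ^ n./2)%N.
  have /andP[u _] := az; have /andP[_ v] := z1.
  have : (a < 2 ^ (n./2 + 2))%N by apply: grid_lt u _; rewrite width_pow.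
  by rewrite expnD; lia.
have aR : a%:R = 4 * k%:R + 1 + c%:R :> R by rewrite aE natrD natr4.
have c1 : in_cell n (k, false, j) z.
  apply/in_cell_natP; split => //; split => //; rewrite (negbTE on) /=.
  move: az; rewrite /grid -[a.+1%:R]natr1 !natr4 aR.
  by have : 0 <= width n * c%:R <= width n; [case: (c); rewrite ?mulr1 ?mulr0; lra|lra].
rewrite (stage_half c1) /cell_center (negbTE on) /=.
set z' := (_, _).
have c2 : in_cell n.+1 (k, ~~ c, j) z'.
  apply/in_cell_natP; rewrite /cell_dom /= halfS on; split; first by split => //; split => //.
  rewrite !gS /z' /grid /=; split.
    by move: jz; rewrite /grid -![j.+1%:R]natr1; lra.
  move: az; rewrite /grid -![_.+1%:R]natr1 aR natrD natr4.
  by case: (c) => /=; lra.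
rewrite (stage_half c2) /cell_center /= on wS /z' /=.
have -> : (swap_mid a)%:R - a%:R = (~~ c)%:R - c%:R :> R.
  have h1 : (swap_mid a + c = a + ~~ c)%N.
    have a12 : (a %% 4 = 1 \/ a %% 4 = 2)%N.
      move: (ltn_pmod a (isT : 0 < 4)%N) ne.
      by case: (a %% 4)%N => [|[|[|[|//]]]] //= _ _; [left|right].
    have a0 : (0 < a)%N by rewrite aE addnAC addn1.
    by rewrite /swap_mid /c; case: a12 => -> /=; rewrite ?addn0 ?addn1 ?prednK.
  have := congr1 (fun n : nat => n%:R : R) h1; rewrite !natrD; lra.
by congr pair; case: (c) => /=; lra.
Qed.

(** The doubling map of each block of four columns onto itself: the summand subtracts the
    left end of the block, and the width of the block on its right half. *)
Definition fold_value n a x : R := 2 * x + 4 * width n * ((a %/ 4)%:R - (a %/ 2)%:R).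

(** Doubling inside a block is the exchange of its two middle columns followed by
    doubling inside its two halves, by [swap_mid_fold]. So the composition of the
    exchanges performed so far with the doubling map of the current scale does not
    depend on the scale, and it is the doubling map of the unit interval. *)
Lemma traj_fold m z : irrational_coords z -> open_square z ->
  exists a x, [/\ traj (stage_time m.*2) z = (x, z.2), grid m.*2 a x &
   fold_value m.*2 a x = 2 * z.1 - (1 / 2 < z.1)%R%:R].
Proof.
move=> iz Qz; elim: m => [|m [a [x [E az F]]]].
  have [[z1 z2] [r1 r2]] := (Qz, iz).
  have [a an az] := grid_exists 0 z1 r1.
  exists a, z.1; split => //; first by rewrite traj_time0 -surjective_pairing.
  have w4 : width 0 = 1 / 4 by rewrite /width /= add0n expr2 -natrM mul1r.
  move: az; rewrite /fold_value /grid /= w4.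
  move: an; rewrite /= add0n => an.
  have a4 : (a < 4)%N by [].
  have e2 : (a %/ 2 = (1 < a))%N by case: (a) a4 => [|[|[|[|]]]].
  rewrite divn_small// e2.
  by case: a a4 {an e2} => [|[|[|[|//]]]] _ az /=; case: ltP => h /=; lra.
have om : ~~ odd m.*2 by rewrite odd_double.
have iz' := irrational_traj m.*2 iz.
have Q' : open_square (traj (stage_time m.*2) z).
  by apply: (traj_inside stages) => //; exact: stage_time_lt1.
have E2 : traj (stage_time m.+1.*2) z = (x + width m.*2 * ((swap_mid a)%:R - a%:R), z.2).
  rewrite doubleS !traj_next; rewrite (@two_stages _ _ a) ?E//=.
    by rewrite -E. by rewrite -E.
set x' := x + _ in E2.
have i2 := irrational_traj m.+1.*2 iz; rewrite E2 in i2.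
have Q2 : open_square (traj (stage_time m.+1.*2) z).
  by apply: (traj_inside stages) => //; exact: stage_time_lt1.
rewrite E2 in Q2.
have [a' _ az'] := grid_exists m.+1.*2 Q2.1 i2.1.
exists a', x'; split => //; rewrite -F.
have w0 := @width_gt0 R m.*2.
have wE : width m.+1.*2 = width m.*2 / 2 by rewrite doubleS widthSS.
have gx' : grid m.*2 (swap_mid a) x'.
  by move: az; rewrite /grid /x' -![_.+1%:R]natr1; lra.
have a'E : (a' %/ 2 = swap_mid a)%N.
  move: az' gx'; rewrite /grid wE /= => /andP[h1 h2] /andP[h3 h4].
  have {}h1 : width m.*2 * a'%:R < 2 * x' by lra.
  have {}h2 : 2 * x' < width m.*2 * a'.+1%:R by lra.
  have e1 : width m.*2 * (2 * swap_mid a)%:R < 2 * x' by rewrite natrM; lra.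
  have e2 : 2 * x' < width m.*2 * (2 * (swap_mid a).+1)%:R by rewrite natrM; lra.
  by have := grid_lt h1 e2; have := grid_lt e1 h2; lia.
rewrite /fold_value wE /x'.
have -> : (a' %/ 4 = swap_mid a %/ 2)%N by lia.
rewrite a'E.
have h : (swap_mid a %/ 2)%:R + 2 * (a %/ 2)%:R = a%:R + 2 * (a %/ 4)%:R :> R.
  by rewrite -!natrM -!natrD swap_mid_fold.
have -> : (swap_mid a %/ 2)%:R = a%:R + 2 * (a %/ 4)%:R - 2 * (a %/ 2)%:R :> R by rewrite -h addrK.
by field.
Qed.

Lemma fold_value_near n a x : grid n a x -> `|fold_value n a x - x| <= 4 * width n.
Proof.
have w0 := @width_gt0 R n.
rewrite /grid /fold_value -[a.+1%:R]natr1 ler_norml => ax.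
have mono (u v : nat) : (u <= v)%N -> width n * u%:R <= width n * v%:R.
  by move=> uv; rewrite ler_pM2l// ler_nat.
have h1 := mono _ _ (_ : (2 * (a %/ 4) <= a %/ 2)%N).
have h2 := mono _ _ (_ : (a %/ 2 <= 2 * (a %/ 4) + 1)%N).
have h3 := mono _ _ (_ : (2 * (a %/ 2) <= a)%N).
have h4 := mono _ _ (_ : (a <= 2 * (a %/ 2) + 1)%N).
have {}h1 := h1 ltac:(lia); have {}h2 := h2 ltac:(lia).
have {}h3 := h3 ltac:(lia); have {}h4 := h4 ltac:(lia).
rewrite natrM in h1; rewrite natrD natrM in h2; rewrite natrM in h3; rewrite natrD natrM in h4.
lra.
Qed.

End NetMap.

(** * The limit map *)

Section LimitMap.
Context {R : realType}.
Implicit Types (z : R * R) (x y r : R).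
Notation leb := (@lebesgue_measure R).
Notation leb2 := ((@lebesgue_measure R \x @lebesgue_measure R)%E).
Notation traj := (traj (@stage_flow R) (@stage_time R)).
Notation stages := (@concrete_stages R).

Lemma width_small r : 0 < r -> exists m : nat, width m.*2 < r :> R.
Proof.
move=> r0; have r2 : 0 < r / 2 by lra.
have [n ne] : exists n, n.+1%:R^-1 < r / 2.
  by have [n _ /(_ _ (leqnn n))] := near_infty_natSinv_lt (PosNum r2); exists n.
exists n; apply: le_lt_trans (width_le _) _.
have : n.*2.+1%:R^-1 <= n.+1%:R^-1 :> R.
  by rewrite lef_pV2 ?posrE// ler_nat ltnS -addnn leq_addr.
move: ne; set u := n.+1%:R^-1; set v := n.*2.+1%:R^-1; lra.
Qed.

(** The doubling map of a small block moves points little, so [traj_fold] passes to the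
    limit: the limit map doubles the first coordinate modulo [1], and is two-to-one. *)
Lemma traj1E z : irrational_coords z -> open_square z ->
  traj 1 z = (2 * z.1 - (1 / 2 < z.1)%R%:R, z.2).
Proof.
move=> iz Qz; set d := _ - _.
have near m : `|(traj 1 z).1 - d| <= 20 * width m.*2 /\
    `|(traj 1 z).2 - z.2| <= 20 * width m.*2.
  have [a [x [E ax F]]] := traj_fold m iz Qz.
  have [h1 h2] := traj_lipschitz1 stages z (stage_time_lt1 m.*2).
  have w0 := @width_gt0 R m.*2.
  have tE : 1 - stage_time m.*2 = 4 * width m.*2 :> R.
    by rewrite /stage_time odd_double subr0 subKr mulrC.
  rewrite E tE /= in h1 h2; have h3 := fold_value_near ax; rewrite F -/d in h3.
  split; last by lra.
  have -> : (traj 1 z).1 - d = ((traj 1 z).1 - x) - (d - x) by ring.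
  by apply: le_trans (ler_normB _ _) _; lra.
have small (u : R) : (forall m : nat, `|u| <= 20 * width m.*2) -> u = 0.
  move=> hu; apply/eqP; rewrite -normr_le0; apply/ler_addgt0Pr => e e0; rewrite add0r.
  have [|m hm] := @width_small (e / 20); first exact: divr_gt0.
  by apply: le_trans (hu m) _; rewrite mulrC -ler_pdivlMr// ltW.
rewrite [LHS]surjective_pairing; congr pair; apply/eqP; rewrite -subr_eq0; apply/eqP;
  by apply: small => m; have [] := near m.
Qed.

Definition bad_coords : set (R * R) := [set z | rational_num z.1 \/ rational_num z.2].

Lemma good_coords z : ~ bad_coords z -> irrational_coords z.
Proof. by rewrite /bad_coords /= => /not_orP. Qed.

Let Qset : set R := [set x | rational_num x].

Let Qset_countable : countable Qset.
Proof.
have -> : Qset = @ratr R @` setT.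
  by apply/seteqP; split => x /= [q]; [move=> ->; exists q|move=> _ <-; exists q].
exact: sub_countable (card_image_le _ _) (countableP _).
Qed.

Let measurable_Qset : measurable Qset.
Proof. by apply: countable_measurable Qset_countable => t; exact: measurable_set1. Qed.

Let bad_eq : bad_coords = (Qset `*` setT) `|` (setT `*` Qset).
Proof.
by apply/seteqP; split => -[x y] /=; [case; [left|right]|case => -[]; [left|right]].
Qed.

Lemma measurable_bad : measurable bad_coords.
Proof. by rewrite bad_eq; apply: measurableU; exact: measurableX. Qed.

Lemma leb2_bad : leb2 bad_coords = 0%E.
Proof.
have Q0 : leb Qset = 0%E := countable_lebesgue_measure0 Qset_countable.
have m1 : leb2 (Qset `*` setT) = 0%E by rewrite product_measure1E// [X in (X * _)%E]Q0 mul0e.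
have m2 : leb2 (setT `*` Qset) = 0%E by rewrite product_measure1E// [X in (_ * X)%E]Q0 mule0.
apply/eqP; rewrite eq_le measure_ge0 andbT bad_eq.
apply: (le_trans (measureU2 leb2 _ _)); [exact: measurableX|exact: measurableX|].
by rewrite [X in (X + _)%E]m1 [X in (_ + X)%E]m2 adde0.
Qed.

Lemma eq_measure_off_null (A B N : set (R * R)) : measurable A -> measurable B ->
  measurable N -> leb2 N = 0%E -> (forall z, ~ N z -> A z <-> B z) -> leb2 A = leb2 B.
Proof.
move=> mA mB mN N0 AB.
have key (C D : set (R * R)) : measurable C -> measurable D ->
    (forall z, ~ N z -> C z -> D z) -> (leb2 C <= leb2 D)%E.
  move=> mC mD CD; apply: (@le_trans _ _ (leb2 (D `|` N))).
    apply: le_measure; rewrite ?inE; [exact mC|exact (measurableU _ _ mD mN)|].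
    by move=> z Cz; case: (pselect (N z)) => Nz; [right|left; exact: CD].
  apply: (le_trans (measureU2 leb2 mD mN)).
  by rewrite [X in (_ + X)%E]N0 adde0.
apply/eqP; rewrite eq_le !key// => z Nz; [exact: (AB z Nz).2|exact: (AB z Nz).1].
Qed.

Lemma measurable_square : measurable (@open_square R).
Proof.
have -> : @open_square R = `]0, 1[%classic `*` `]0, 1[%classic.
  by apply/seteqP; split => -[x y]; rewrite /open_square /= !in_itv.
exact: measurableX.
Qed.

(** Off a null set the preimage of a part of the square consists of two copies of it, each
    compressed horizontally by the factor [2]. *)
Lemma mp_traj1 : measure_preserving (traj 1).
Proof.
have m1 : measurable_fun setT (traj 1).
  have mp : measurable_fun setT (fun z : R * R => (1 : R, z)).
    by apply: measurable_fun_pair => //; exact: measurable_cst.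
  exact: measurableT_comp (measurable_traj stages) mp.
split => [//|B mB].
pose Q := @open_square R; have mQ : measurable Q := measurable_square.
pose h c := scale_chart (c, 0) 2 1 : R * R -> R * R.
pose A c := h c @^-1` (B `&` Q).
have mBQ : measurable (B `&` Q) by exact: measurableI.
have mA c : measurable (A c).
  by rewrite -[X in measurable X]setTI; exact: measurable_scale_chart.
have lA c : leb2 (A c) = ((2^-1)%:E * leb2 (B `&` Q))%E.
  by rewrite lebesgue2_scale_chart ?mulr1.
have -> : leb2 (traj 1 @^-1` B) = leb2 ((B `\` Q) `|` (A 0 `|` A (- 1))).
  apply: (@eq_measure_off_null _ _ bad_coords).
  - by rewrite -[X in measurable X]setTI; exact: m1.
  - by apply: measurableU; [exact: measurableD|exact: measurableU].
  - exact: measurable_bad.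
  - exact: leb2_bad.
  - move=> z /good_coords gz; rewrite /A /h /scale_chart /=.
    case: (pselect (Q z)) => [Qz|nQ]; last first.
      rewrite (traj_outside stages)//; split; first by left.
      move=> [[]//|[[_ [h1 h2]]|[_ [h1 h2]]]]; exfalso; apply: nQ;
        by rewrite /= in h1 h2; split; lra.
    rewrite traj1E// !mul1r !addr0; have [z1 z2] := Qz.
    have n12 : z.1 != 2^-1.
      by apply/eqP => zE; apply: gz.1; rewrite zE; exact: rationalV (rational_nat 2).
    have [lt|ge] := ltP 2^-1 z.1 => /=.
      split; first by move=> Bz; right; right; split; [|rewrite /Q /open_square /=; split; lra].
      case=> [hz|[[_ [/= h1 _]]|[Bz _]]]; [by case: hz => _ /(_ Qz)|lra|exact: Bz].
    have {}ge : z.1 < 2^-1 by rewrite lt_neqAle n12.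
    rewrite subr0; split.
      by move=> Bz; right; left; split; [|rewrite /Q /open_square /=; split; lra].
    case=> [hz|[[Bz _]|[_ [/= h1 _]]]]; [by case: hz => _ /(_ Qz)|exact: Bz|lra].
have disj : A 0 `&` A (- 1) = set0.
  apply/seteqP; split => // z [[_ [h1 _]] [_ [h2 _]]].
  by rewrite /h /scale_chart /= in h1 h2; lra.
have disj' : (B `\` Q) `&` (A 0 `|` A (- 1)) = set0.
  apply/seteqP; split => // z [[_ nQ]] [[_ [h1 h2]]|[_ [h1 h2]]]; apply: nQ;
    by rewrite /h /scale_chart /= in h1 h2; split; lra.
have mBnQ : measurable (B `\` Q) by exact: measurableD.
have mAA : measurable (A 0 `|` A (- 1)) by exact: measurableU.
have -> : leb2 ((B `\` Q) `|` (A 0%R `|` A (- 1)%R)) = (leb2 (B `\` Q) + leb2 (A 0%R `|` A (- 1)%R))%E.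
  exact (measureU leb2 mBnQ mAA disj').
have -> : leb2 (A 0%R `|` A (- 1)%R) = (leb2 (A 0%R) + leb2 (A (- 1)%R))%E.
  exact (measureU leb2 (mA 0%R) (mA (- 1)%R) disj).
rewrite !lA -ge0_muleDl ?lee_fin ?invr_ge0// -EFinD.
have -> : 2^-1 + 2^-1 = 1 :> R by lra.
rewrite mul1e; apply/esym; exact (measureDI leb2 mB mQ).
Qed.

End LimitMap.

(** * Directional derivatives of test functions *)

Section Gateaux.
Context {R : realType} {V : normedModType R}.
Variable h : V -> R.
Hypothesis dh : forall v x, derivable h x v.
Hypothesis ch : forall v, continuous (fun x => 'D_v h x).
Implicit Types (x v w : V) (a t r : R).

Let line_derive x v t : is_derive t (1 : R) (fun s : R => h (x + s *: v)) ('D_v h (x + t *: v)).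
Proof.
have E : (fun k : R => k^-1 *: (((fun s : R => h (x + s *: v)) \o shift t) (k *: 1) -
      h (x + t *: v))) =
    (fun k : R => k^-1 *: ((h \o shift (x + t *: v)) (k *: v) - h (x + t *: v))).
  apply/funext => k /=; congr (_ *: (h _ - _)).
  by rewrite [k *: 1]mulr1 scalerDl addrCA.
split; first by rewrite /derivable E; exact: dh.
by rewrite /derive E.
Qed.

Lemma gateaux_mvt x v t : exists2 c : R, `|c| <= `|t| & h (x + t *: v) - h x = t * 'D_v h (x + c *: v).
Proof.
pose f (s : R) := h (x + s *: v).
have cf : continuous f.
  move=> s; apply: differentiable_continuous; apply/derivable1_diffP.
  by have [] := line_derive x v s.
have [t0|t0|->] := ltgtP t 0.
- have [c] := @MVT R f (fun s => 'D_v h (x + s *: v)) t 0 t0 (fun s _ => line_derive x v s)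
    (continuous_subspaceT cf).
  rewrite in_itv /= => ct; rewrite /f scale0r addr0 => E; exists c.
    by rewrite !ltr0_norm ?lerN2; lra.
  by rewrite -opprB E; ring.
- have [c] := @MVT R f (fun s => 'D_v h (x + s *: v)) 0 t t0 (fun s _ => line_derive x v s)
    (continuous_subspaceT cf).
  rewrite in_itv /= => ct; rewrite /f scale0r addr0 => E; exists c.
    by rewrite !gtr0_norm; lra.
  by rewrite E; ring.
- by exists 0 => //; rewrite scale0r addr0 subrr mul0r.
Qed.

(** Continuity of the directional derivatives is used through the mean value theorem, once
    in the direction [v] and once in the direction [w]. *)
Lemma gateaux_linear x v w a : 'D_(v + a *: w) h x = 'D_v h x + a * 'D_w h x.
Proof.
apply/eqP; rewrite -subr_eq0 -normr_le0; apply/ler_addgt0Pr => e e0; rewrite add0r.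
(* There are three errors, one of which is multiplied by [a]. *)
pose r : R := e / (2 + `|a|).
have a0 := normr_ge0 a.
have r0 : 0 < r by apply: divr_gt0 => //; lra.
have /cvgrPdist_le /(_ r r0) /nbhs_ballP [d1 /= d10 hd1] := @ch v x.
have /cvgrPdist_le /(_ r r0) /nbhs_ballP [d2 /= d20 hd2] := @ch w x.
have := @dh (v + a *: w) x; rewrite /derivable => cvD.
have /cvgrPdist_le /(_ r r0) := cvD.
rewrite -[lim _]/('D_(v + a *: w) h x) => /nbhs_ballP [d3 /= d30 hd3].
pose K := `|v| + `|a| * `|w| + 1.
have K0 : 0 < K by rewrite /K; have := normr_ge0 v; have := mulr_ge0 a0 (normr_ge0 w); lra.
pose d := Num.min (Num.min (d1 / K) (d2 / K)) d3.
have d0 : 0 < d by rewrite /d !lt_min !divr_gt0.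
pose t := d / 2; have t0 : 0 < t by rewrite /t; lra.
have td : t < d by rewrite /t; lra.
have tK1 : t * K < d1.
  by rewrite -ltr_pdivlMr//; apply: lt_le_trans td _; rewrite /d !ge_min lexx.
have tK2 : t * K < d2.
  by rewrite -ltr_pdivlMr//; apply: lt_le_trans td _; rewrite /d !ge_min lexx !orbT.
have td3 : t < d3 by apply: lt_le_trans td _; rewrite /d !ge_min lexx orbT.
have h3 : `|'D_(v + a *: w) h x - t^-1 * (h (t *: (v + a *: w) + x) - h x)| <= r.
  apply: hd3 => /=; last by rewrite gt_eqF.
  by rewrite /ball /= sub0r normrN gtr0_norm.
have [c1 c1t E1] := gateaux_mvt x v t.
have [c2 c2t E2] := gateaux_mvt (x + t *: v) w (t * a).
have E3 : t^-1 * (h (t *: (v + a *: w) + x) - h x) =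
    'D_v h (x + c1 *: v) + a * 'D_w h (x + t *: v + c2 *: w).
  have -> : t *: (v + a *: w) + x = x + t *: v + (t * a) *: w.
    by rewrite scalerDr scalerA addrC addrA.
  have -> : h (x + t *: v + (t * a) *: w) - h x = (h (x + t *: v + (t * a) *: w) - h (x + t *: v))
     + (h (x + t *: v) - h x) by ring.
  by rewrite E1 E2; field; exact: lt0r_neq0.
have h1 : `|'D_v h x - 'D_v h (x + c1 *: v)| <= r.
  apply: hd1; rewrite -ball_normE /= opprD addrA subrr sub0r normrN normrZ.
  apply: le_lt_trans tK1; rewrite (gtr0_norm t0) in c1t.
  apply: ler_pM => //; rewrite /K; have := mulr_ge0 a0 (normr_ge0 w); lra.
have h2 : `|'D_w h x - 'D_w h (x + t *: v + c2 *: w)| <= r.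
  apply: hd2; rewrite -ball_normE /=.
  have -> : x - (x + t *: v + c2 *: w) = - (t *: v + c2 *: w) by rewrite -addrA opprD addrA subrr sub0r.
  rewrite normrN; apply: le_lt_trans (ler_normD _ _) _.
  have -> : `|t *: v| = t * `|v| by rewrite normrZ gtr0_norm.
  rewrite normrZ.
  rewrite normrM (gtr0_norm t0) in c2t.
  have := ler_wpM2r (normr_ge0 w) c2t; rewrite -mulrA.
  by move: tK2; rewrite /K; nra.
have -> : 'D_(v + a *: w) h x - ('D_v h x + a * 'D_w h x) =
  ('D_(v + a *: w) h x - t^-1 * (h (t *: (v + a *: w) + x) - h x)) -
  ('D_v h x - 'D_v h (x + c1 *: v)) - a * ('D_w h x - 'D_w h (x + t *: v + c2 *: w)).
  by rewrite E3; ring.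
have rE : r * (2 + `|a|) = e by rewrite /r divfK//; apply: lt0r_neq0; lra.
have h2a : `|a * ('D_w h x - 'D_w h (x + t *: v + c2 *: w))| <= `|a| * r.
  by rewrite normrM ler_wpM2l.
apply: le_trans (ler_normB _ _) _.
have := ler_normB ('D_(v + a *: w) h x - t^-1 * (h (t *: (v + a *: w) + x) - h x))
  ('D_v h x - 'D_v h (x + c1 *: v)).
lra.
Qed.

End Gateaux.

Section TestFunctions.
Context {R : realType}.

Lemma compact_supp_bounded {V : normedModType R} (f : V -> R) (K : set V) :
  continuous f -> compact K -> (forall x, ~ K x -> f x = 0) -> exists B : R, forall x, `|f x| <= B.
Proof.
move=> cf cK f0.
have cfK : compact (f @` K).
  by apply: continuous_compact => //; exact: continuous_subspaceT.
have [B [_ hB]] := compact_bounded cfK.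
exists (`|B| + 1) => x; case: (pselect (K x)) => Kx; last first.
  by rewrite f0// normr0 addr_ge0.
by apply: (hB (`|B| + 1)); [rewrite ltr_pwDr// ler_norm|exists x].
Qed.

(** The support is closed, so the function vanishes near any point outside of it. *)
Lemma test_derive_outside {V : normedModType R} (f : V -> R) v x :
  ~ closure [set z | f z != 0] x -> 'D_v f x = 0 /\ f x = 0.
Proof.
move=> nx; have oC : open (~` closure [set z | f z != 0]) by apply: closed_openC; exact: closed_closure.
have fx y : ~ closure [set z | f z != 0] y -> f y = 0.
  by move=> ny; apply/eqP; apply: contrapT => /negP fy; apply: ny; exact: subset_closure.
split; last exact: fx.
have nbh : \forall y \near x, f y = 0.
  by have := open_nbhs_nbhs (conj oC nx); apply: filterS => y /fx.
have nbh0 : \forall y \near x, f y = (cst 0 : V -> R) y by [].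
by rewrite (near_eq_derive v nbh0) derive_cst.
Qed.

Lemma test_C1 {V : normedModType R} (f : V -> R) : test_function f ->
  [/\ continuous f, forall v x, derivable f x v, forall v, continuous (fun x => 'D_v f x) &
    forall v, exists B : R, forall x, `|'D_v f x| <= B].
Proof.
move=> [Cf cs]; have [cf /= dCf] := Cf 1%N.
have dv v : continuous (fun x => 'D_v f x) by have [_ []] := dCf v.
split => //; first by move=> v x; have [+ _] := dCf v; apply.
move=> v; have f0 x : ~ closure [set z | f z != 0] x -> 'D_v f x = 0.
  by move=> /(test_derive_outside v) [].
exact: compact_supp_bounded (@dv v) cs f0.
Qed.

Lemma test_direction (h : R * (R * R) -> R) y (c v1 v2 : R) : test_function h ->
  'D_(c, (v1, v2)) h y =
  c * 'D_(1, (0, 0)) h y + v1 * 'D_(0, (1, 0)) h y + v2 * 'D_(0, (0, 1)) h y.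
Proof.
move=> /test_C1[_ dh ch _].
have -> : (c, (v1, v2)) = 0 + c *: (1, (0, 0)) + v1 *: (0, (1, 0)) + v2 *: (0, (0, 1)) :> R * (R * R).
  rewrite -[RHS]/(0 + c * 1 + v1 * 0 + v2 * 0, (0 + c * 0 + v1 * 1 + v2 * 0, 0 + c * 0 + v1 * 0 + v2 * 1)).
  by congr (_, (_, _)); ring.
by rewrite !gateaux_linear// derive0 add0r.
Qed.

Lemma test_direction2 (g : R * R -> R) x (v1 v2 : R) : test_function g ->
  'D_(v1, v2) g x = v1 * 'D_(1, 0) g x + v2 * 'D_(0, 1) g x.
Proof.
move=> /test_C1[_ dh ch _].
have -> : (v1, v2) = 0 + v1 *: (1, 0) + v2 *: (0, 1) :> R * R.
  rewrite -[RHS]/(0 + v1 * 1 + v2 * 0, 0 + v1 * 0 + v2 * 1).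
  by congr pair; ring.
by rewrite !gateaux_linear// derive0 add0r.
Qed.

Definition reverse_time (y : R * (R * R)) : R * (R * R) := (2 - y.1, y.2).

Lemma reverse_time_cont : continuous reverse_time.
Proof.
move=> y; apply: (@cvg_pair _ _ _ (nbhs y) (nbhs (2 - y.1)) (nbhs y.2) _ _ _
  (fun y => 2 - y.1) snd); last exact: cvg_snd.
by apply: cvgB; [exact: cvg_cst|exact: cvg_fst].
Qed.

(** Test functions are transported along the backward running part of the trajectories,
    hence composed with the time reversal about [1]. *)
Lemma C1_reversed (h : R * (R * R) -> R) : test_function h ->
  C1_with_gradient (h \o reverse_time) (fun y => - 'D_(1, (0, 0)) h (reverse_time y))
    (fun y => 'D_(0, (1, 0)) h (reverse_time y)) (fun y => 'D_(0, (0, 1)) h (reverse_time y)).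
Proof.
move=> th; have [cf df dcf _] := test_C1 th.
have rc := reverse_time_cont.
split.
- by move=> y; apply: continuous_comp; [exact: rc|exact: cf].
- move=> y; apply: cvgN; apply: (@continuous_comp _ _ _ reverse_time (fun x => 'D_(1, (0, 0)) h x));
    [exact: rc|exact: dcf].
- move=> y; apply: (@continuous_comp _ _ _ reverse_time (fun x => 'D_(0, (1, 0)) h x));
    [exact: rc|exact: dcf].
- move=> y; apply: (@continuous_comp _ _ _ reverse_time (fun x => 'D_(0, (0, 1)) h x));
    [exact: rc|exact: dcf].
- move=> y [v1 v2].
  have E : (fun k : R => k^-1 *: (((h \o reverse_time) \o shift y) (k *: (1, (v1, v2))) -
        (h \o reverse_time) y)) =
      (fun k : R => k^-1 *: ((h \o shift (reverse_time y)) (k *: (- 1, (v1, v2))) -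
        h (reverse_time y))).
    apply/funext => k /=; congr (_ *: (h _ - _)).
    rewrite /reverse_time /=; congr pair.
    rewrite -[LHS]/(2 - (k * 1 + y.1)) -[RHS]/(k * - 1 + (2 - y.1)); ring.
  split; first by rewrite /derivable E; exact: df.
  rewrite /derive E -[LHS]/('D_(- 1, (v1, v2)) h (reverse_time y)) test_direction//.
  by rewrite mulN1r.
Qed.

(** A function of the position alone, used against the field at a fixed time. *)
Lemma C1_space (g : R * R -> R) : test_function g ->
  C1_with_gradient (fun y => g y.2) (cst 0) (fun y => 'D_(1, 0) g y.2) (fun y => 'D_(0, 1) g y.2).
Proof.
move=> tg; have [cf df dcf _] := test_C1 tg.
have rc : continuous (@snd R (R * R)) by move=> y; exact: cvg_snd.
split.
- by move=> y; apply: (@continuous_comp _ _ _ snd g); [exact: rc|exact: cf].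
- by move=> y; exact: cvg_cst.
- move=> y; apply: (@continuous_comp _ _ _ snd (fun x => 'D_(1, 0) g x)); [exact: rc|exact: dcf].
- move=> y; apply: (@continuous_comp _ _ _ snd (fun x => 'D_(0, 1) g x)); [exact: rc|exact: dcf].
- move=> y [v1 v2].
  have E : (fun k : R => k^-1 *: (((fun y => g y.2) \o shift y) (k *: (1, (v1, v2))) - g y.2)) =
      (fun k : R => k^-1 *: ((g \o shift y.2) (k *: (v1, v2)) - g y.2)) by [].
  split; first by rewrite /derivable E; exact: df.
  rewrite /derive E -[LHS]/('D_(v1, v2) g y.2) test_direction2//.
  by rewrite /cst add0r.
Qed.

(** With the coordinates as test functions the chain rule becomes the differential
    equation itself. *)
Lemma C1_fst : C1_with_gradient (fun y : R * (R * R) => y.2.1) (cst 0) (cst 1) (cst 0).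
Proof.
split; try by move=> y; exact: cvg_cst.
- by move=> y; apply: (@continuous_comp _ _ _ snd fst); [exact: cvg_snd|exact: cvg_fst].
- move=> y v.
  have E : (fun k : R => k^-1 *: (((fun y : R * (R * R) => y.2.1) \o shift y) (k *: (1, v)) - y.2.1)) @ 0^' --> v.1.
    apply: cvg_near_cst; near=> k; apply/eqP.
    rewrite /= addrK -[k *: _]/(k * v.1) [_ *: _]mulrA mulVf ?mul1r//.
    by near: k; exact: nbhs_dnbhs_neq.
  split; first by apply/cvg_ex; exists v.1.
  by rewrite /cst mulr0 mulr1 addr0 add0r; exact: cvg_lim E.
Unshelve. all: by end_near. Qed.

Lemma C1_snd : C1_with_gradient (fun y : R * (R * R) => y.2.2) (cst 0) (cst 0) (cst 1).
Proof.
split; try by move=> y; exact: cvg_cst.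
- by move=> y; apply: (@continuous_comp _ _ _ snd snd); exact: cvg_snd.
- move=> y v.
  have E : (fun k : R => k^-1 *: (((fun y : R * (R * R) => y.2.2) \o shift y) (k *: (1, v)) - y.2.2)) @ 0^' --> v.2.
    apply: cvg_near_cst; near=> k; apply/eqP.
    rewrite /= addrK -[k *: _]/(k * v.2) [_ *: _]mulrA mulVf ?mul1r//.
    by near: k; exact: nbhs_dnbhs_neq.
  split; first by apply/cvg_ex; exists v.2.
  by rewrite /cst mulr0 mulr1 !add0r; exact: cvg_lim E.
Unshelve. all: by end_near. Qed.

End TestFunctions.

(** * Integrals over the plane and over time strips *)

Lemma continuous_pair {T U V : topologicalType} (a : T -> U) (b : T -> V) :
  continuous a -> continuous b -> continuous (fun t => (a t, b t)).
Proof.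
move=> ca cb t; exact: (@cvg_pair _ _ _ (nbhs t) (nbhs (a t)) (nbhs (b t)) _ _ _ a b (ca t) (cb t)).
Qed.

Section Integration.
Context {R : realType}.
Notation leb := (@lebesgue_measure R).
Notation leb2 := ((@lebesgue_measure R \x @lebesgue_measure R)%E).
Implicit Types (f g s : R * R -> R) (Q : set (R * R)) (u w C : R).

Lemma continuous_measurable2 f : continuous f -> measurable_fun setT f.
Proof.
move=> cf; apply: measurable_left_continuous.
  move=> x; apply: continuous_measurable_fun => y.
  apply: (@continuous_comp _ _ _ (fun y => (x, y)) f); last exact: cf.
  by apply: continuous_pair => y'; [exact: cvg_cst|exact: cvg_id].
move=> x y r r0; have cx : {for x, continuous (fun x => f (x, y))}.
  apply: (@continuous_comp _ _ _ (fun x => (x, y)) f); last exact: cf.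
  by apply: continuous_pair => y'; [exact: cvg_id|exact: cvg_cst].
move/cvgrPdist_le: cx => /(_ r r0) /nbhs_ballP [e /= e0 he].
exists e => // x' hx; rewrite distrC; apply: he.
by rewrite /ball /= ltr_norml; lra.
Qed.

Lemma continuous_measurable3 (f : R * (R * R) -> R) : continuous f -> measurable_fun setT f.
Proof.
move=> cf; apply: measurable_left_continuous.
  move=> x; apply: continuous_measurable2 => y.
  apply: (@continuous_comp _ _ _ (fun y => (x, y)) f); last exact: cf.
  by apply: continuous_pair => y'; [exact: cvg_cst|exact: cvg_id].
move=> x y r r0; have cx : {for x, continuous (fun x => f (x, y))}.
  apply: (@continuous_comp _ _ _ (fun x => (x, y)) f); last exact: cf.
  by apply: continuous_pair => y'; [exact: cvg_id|exact: cvg_cst].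
move/cvgrPdist_le: cx => /(_ r r0) /nbhs_ballP [e /= e0 he].
exists e => // x' hx; rewrite distrC; apply: he.
by rewrite /ball /= ltr_norml; lra.
Qed.

Lemma supp_integrable d (T : measurableType d) (mu : {measure set T -> \bar R}) (h : T -> R)
    (E : set T) C : measurable E -> (mu E < +oo)%E -> measurable_fun setT h ->
  (forall x, `|h x| <= C) -> (forall x, ~ E x -> h x = 0) ->
  mu.-integrable setT (EFin \o h).
Proof.
move=> mE Eoo mh hC h0.
have -> : EFin \o h = (EFin \o h) \_ E.
  apply/funext => x; rewrite patchE; case: ifPn => // /negP xE /=.
  by rewrite h0// => Ex; apply: xE; rewrite inE.
apply/(integrable_mkcond _ mE); apply: measurable_bounded_integrable => //.
  exact: measurable_funTS.
exists C; split; first exact: num_real.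
by move=> x Cx y _; exact: le_trans (hC _) (ltW Cx).
Qed.

Lemma mp_integral T f : measure_preserving T -> measurable_fun setT f ->
  leb2.-integrable setT (EFin \o (f \o T)) ->
  (\int[leb2]_z (f (T z))%:E = \int[leb2]_z (f z)%:E)%E.
Proof.
move=> [mT leT] mf intf.
have mEf : measurable_fun setT (EFin \o f) by exact/measurable_EFinP.
have h := @integral_pushforward _ _ (measurableTypeR R * measurableTypeR R)%type
  (measurableTypeR R * measurableTypeR R)%type R T mT leb2 setT (EFin \o f) mEf.
rewrite preimage_setT in h; rewrite -(h intf measurableT).
by apply: eq_measure_integral => A mA _; exact: leT.
Qed.

(** The product of two Lebesgue measures under a name of its own, to carry the
    sigma-finiteness that Fubini's theorem asks for. *)
Definition plane_measure : set (measurableTypeR R * measurableTypeR R) -> \bar R := leb2.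

HB.instance Definition _ := Measure.on plane_measure.

Lemma plane_measure_sigma_finite : sigma_finite setT plane_measure.
Proof.
have /sigma_finiteP[F [TF ndF Foo]] := sigma_finiteT leb.
exists (fun n => F n `*` F n).
  rewrite -setXTT [X in X `*` _]TF [X in _ `*` X]TF predeqE => -[x y]; split.
    move=> [/= [n _ Fnx] [k _ Gky]]; exists (maxn n k) => //; split.
    - by move: x Fnx; exact/subsetPset/ndF/leq_maxl.
    - by move: y Gky; exact/subsetPset/ndF/leq_maxr.
  by move=> [n _ []/= ? ?]; split; exists n.
move=> k; have [mF Fk] := Foo k; split; first exact: measurableX.
rewrite /plane_measure product_measure1E//; apply: lte_mul_pinfty => //.
by rewrite ge0_fin_numE.
Qed.

HB.instance Definition _ :=
  Measure_isSigmaFinite.Build _ _ _ plane_measure plane_measure_sigma_finite.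

(** The time integral of a quantity that is carried by [z] is moved inside the space
    integral, where the chain rule along the trajectory of [z] computes it. *)
Lemma strip_fubini Q s (k : R * (R * R) -> R) (D : set R) C C' :
  measurable D -> (leb D < +oo)%E -> measurable Q -> (leb2 Q < +oo)%E ->
  measurable_fun setT s -> (forall z, `|s z| <= C) -> (forall z, ~ Q z -> s z = 0) ->
  measurable_fun setT k -> (forall y, `|k y| <= C') ->
  (\int[leb]_(t in D) \int[leb2]_z (s z * k (t, z))%:E =
   \int[leb2]_z (s z * \int[leb]_(t in D) k (t, z))%:E)%E.
Proof.
move=> mD Doo mQ Qoo ms sC s0 mk kC; rewrite integral_mkcond.
pose F (y : R * (R * R)) : R := \1_D y.1 * (s y.2 * k y).
have mF : measurable_fun setT F.
  apply: measurable_funM; last apply: measurable_funM => //.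
    by apply: measurableT_comp; [exact: measurable_indic|exact: measurable_fst].
  by apply: measurableT_comp ms _; exact: measurable_snd.
have iF : (leb \x plane_measure)%E.-integrable setT (EFin \o F).
  have mDQ : measurable (D `*` Q) by exact: measurableX.
  have DQoo : ((leb \x plane_measure)%E (D `*` Q) < +oo)%E.
    rewrite [X in (X < _)%E](@product_measure1E _ _ (measurableTypeR R)
      (measurableTypeR R * measurableTypeR R)%type R leb plane_measure D Q mD mQ); apply: lte_mul_pinfty => //.
    by rewrite ge0_fin_numE.
  have FC y : `|F y| <= C * C'.
    rewrite /F indicE; case: (_ \in _); rewrite ?mul1r ?mul0r ?normrM ?normr0.
      by apply: ler_pM.
    by apply: mulr_ge0; [exact: le_trans (normr_ge0 _) (sC y.2)|exact: le_trans (normr_ge0 _) (kC y)].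
  have F0 y : ~ (D `*` Q) y -> F y = 0.
    move: y => [t z] nDQ; rewrite /F indicE; case: (pselect (D t)) => Dt.
      by rewrite s0 ?mul0r ?mulr0// => Qz; apply: nDQ.
    by rewrite memNset// mul0r.
  exact (@supp_integrable _ (measurableTypeR R * (measurableTypeR R * measurableTypeR R))%type
    (leb \x plane_measure)%E F (D `*` Q) (C * C') mDQ DQoo mF FC F0).
have Fub := @Fubini _ _ (measurableTypeR R)
      (measurableTypeR R * measurableTypeR R)%type R leb plane_measure _ iF; rewrite /F /= in Fub.
transitivity (\int[leb]_t \int[leb2]_z (\1_D t * (s z * k (t, z)))%:E)%E.
  apply: eq_integral => t _; rewrite patchE indicE; case: ifPn => _.
    by apply: eq_integral => z _; rewrite mul1r.
  by under eq_integral do rewrite mul0r; rewrite integral0.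
rewrite Fub; apply: eq_integral => z _.
have mkz : measurable_fun setT (fun t => k (t, z)).
  by apply: measurableT_comp mk _; apply: measurable_fun_pair => //; exact: measurable_cst.
have ikz : leb.-integrable D (EFin \o (fun t => k (t, z))).
  apply: measurable_bounded_integrable => //; first exact: measurable_funTS.
  exists C'; split; first exact: num_real.
  by move=> x C'x y _; exact: le_trans (kC _) (ltW C'x).
rewrite EFinM /Rintegral fineK; last exact: integrable_fin_num.
rewrite -integralZl// [RHS]integral_mkcond.
apply: eq_integral => t _; rewrite patchE indicE; case: ifPn => _; rewrite ?mul1r ?mul0r//.
Qed.

End Integration.

(** * Zero divergence from preservation of area *)

Section Divergence.
Context {R : realType}.
Notation leb := (@lebesgue_measure R).
Notation leb2 := ((@lebesgue_measure R \x @lebesgue_measure R)%E).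
Notation traj := (traj (@stage_flow R) (@stage_time R)).
Notation field := (field (@stage_vel R) (@stage_time R)).
Notation stages := (@concrete_stages R).
Notation Q := (@open_square R).
Implicit Types (t u w C B : R) (z x : R * R) (n : nat).

Lemma leb2_square : (leb2 Q < +oo)%E.
Proof.
have -> : Q = `]0, 1[%classic `*` `]0, 1[%classic.
  by apply/seteqP; split => -[x y]; rewrite /open_square /= !in_itv.
have l01 : leb `]0, 1[%classic = 1%:E by rewrite lebesgue_measure_itv/= lte_fin ltr01 sube0.
by rewrite product_measure1E// [X in (X * _)%E]l01 [X in (_ * X)%E]l01 mule1 ltry.
Qed.

Lemma traj_square t z : t < 1 -> \1_Q (traj t z) = \1_Q z :> R.
Proof.
move=> t1; rewrite !indicE; case: (pselect (Q z)) => Qz.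
  by rewrite !mem_set//; exact: (traj_inside stages).
by rewrite (traj_outside stages).
Qed.

(** The derivative of a function with gradient [H0, H1, H2] along the trajectory of a
    point, as a function of time and of the starting point. *)
Definition along_traj (H0 H1 H2 : R * (R * R) -> R) (y : R * (R * R)) : R :=
  along H0 H1 H2 (field (y.1, traj y.1 y.2)) (y.1, traj y.1 y.2).

Lemma measurable_along_traj H0 H1 H2 : measurable_fun setT H0 -> measurable_fun setT H1 ->
  measurable_fun setT H2 -> measurable_fun setT (along_traj H0 H1 H2).
Proof.
move=> m0 m1 m2.
have mY : measurable_fun setT (fun y : R * (R * R) => (y.1, traj y.1 y.2)).
  by apply: measurable_fun_pair; [exact: measurable_fst|exact (measurable_traj stages)].
have mf : measurable_fun setT (fun y : R * (R * R) => field (y.1, traj y.1 y.2)).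
  exact: measurableT_comp (measurable_field stages) mY.
rewrite /along_traj /along.
apply: measurable_funD; first apply: measurable_funD.
- exact: measurableT_comp m0 mY.
- apply: measurable_funM; last exact: measurableT_comp m1 mY.
  by apply: measurableT_comp mf; exact: measurable_fst.
- apply: measurable_funM; last exact: measurableT_comp m2 mY.
  by apply: measurableT_comp mf; exact: measurable_snd.
Qed.

Lemma along_traj_bound H0 H1 H2 B y : (forall q, `|H0 q| <= B) -> (forall q, `|H1 q| <= B) ->
  (forall q, `|H2 q| <= B) -> `|along_traj H0 H1 H2 y| <= 9 * B.
Proof.
move=> h0 h1 h2; rewrite /along_traj /along; set x := (y.1, _).
have [f1 f2] := field_bound stages x.
have a1 : `|(field x).1 * H1 x| <= 4 * B by rewrite normrM; apply: ler_pM.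
have a2 : `|(field x).2 * H2 x| <= 4 * B by rewrite normrM; apply: ler_pM.
apply: le_trans (ler_normD _ _) _.
have := ler_normD (H0 x) ((field x).1 * H1 x); have := h0 x; lra.
Qed.

(** The integral of [g] over the square is constant along a measure preserving flow, while
    its derivative in time is the integral of the derivative of [g] along the field. At
    an autonomous stage the latter does not depend on time, hence it is zero. *)
Lemma stage_divergence_free n : divergence_free (@stage_vel R n).
Proof.
move=> g tg; have C1 := C1_space tg; have [cg dg dcg bg] := test_C1 tg.
have [B1 hB1] := bg (1, 0); have [B2 hB2] := bg (0, 1).
have [B0 hB0] := compact_supp_bounded cg tg.2 (fun x h => (test_derive_outside 0 h).2).
pose B := `|B1| + `|B2|.
have b1 y : `|'D_(1, 0) g y| <= B.
  by apply: le_trans (hB1 y) _; rewrite /B; have := ler_norm B1; have := normr_ge0 B2; lra.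
have b2 y : `|'D_(0, 1) g y| <= B.
  by apply: le_trans (hB2 y) _; rewrite /B; have := ler_norm B2; have := normr_ge0 B1; lra.
have B00 : 0 <= B by rewrite /B addr_ge0.
pose H0 : R * (R * R) -> R := cst 0.
pose H1 (y : R * (R * R)) : R := 'D_(1, 0) g y.2.
pose H2 (y : R * (R * R)) : R := 'D_(0, 1) g y.2.
have m0 : measurable_fun setT H0 by exact: measurable_cst.
have m1' : measurable_fun setT (fun x => 'D_(1, 0) g x) by exact: continuous_measurable2.
have m2' : measurable_fun setT (fun x => 'D_(0, 1) g x) by exact: continuous_measurable2.
have m1 : measurable_fun setT H1 by apply: measurableT_comp m1' _; exact: measurable_snd.
have m2 : measurable_fun setT H2 by apply: measurableT_comp m2' _; exact: measurable_snd.
have h0 y : `|H0 y| <= B by rewrite normr0.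
have h1 y : `|H1 y| <= B by exact: b1.
have h2 y : `|H2 y| <= B by exact: b2.
(* Half of the stage only, so that the field is that of the stage at both ends. *)
pose u : R := stage_time n; pose w : R := (stage_time n + stage_time n.+1) / 2.
have un : u < stage_time n.+1 :> R by exact: st_lt stages n.
have w1 : w < 1 by have := st_T1 stages n.+1; rewrite /w -/u; lra.
have uw : u < w by rewrite /w -/u; lra.
pose G x := dot2 (stage_vel n x) (grad2 g x).
have mG : measurable_fun setT (fun z => \1_Q z * G z).
  apply: measurable_funM; first by apply: measurable_indic; exact: measurable_square.
  have mb := st_mb stages n.
  apply: measurable_funD; apply: measurable_funM => //.
  - by apply: measurableT_comp mb; exact: measurable_fst.
  - by apply: measurableT_comp mb; exact: measurable_snd.
have GQ z : \1_Q z * G z = G z.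
  rewrite indicE; case: (pselect (Q z)) => Qz; first by rewrite mem_set// mul1r.
  by rewrite memNset// mul0r /G (st_bQ stages)// /dot2 !mul0r addr0.
have alongE t z : u <= t <= w -> along_traj H0 H1 H2 (t, z) = G (traj t z).
  move=> tuw; rewrite /along_traj /along /= (fieldE stages (n := n)) ?add0r//.
  by move: tuw; rewrite /w -/u; lra.
have sq z : `|\1_Q z| <= 1 :> R by rewrite indicE; case: (_ \in _); rewrite ?normr1 ?normr0.
have sq0 z : ~ Q z -> \1_Q z = 0 :> R by move=> nQ; rewrite indicE memNset.
have mQ := @measurable_square R.
have msq : measurable_fun setT (\1_Q : R * R -> R) by exact: measurable_indic.
have aB y : `|along_traj H0 H1 H2 y| <= 9 * B by exact: along_traj_bound.
have ma := measurable_along_traj m0 m1 m2.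
have mD : measurable `[u, w]%classic := measurable_itv _.
have Doo : (leb `[u, w]%classic < +oo)%E.
  by rewrite lebesgue_measure_itv/= lte_fin uw -EFinB ltry.
have Fub := strip_fubini mD Doo mQ leb2_square msq sq sq0 ma aB.
set I := (\int[leb2]_x (G x)%:E)%E.
have iG t : u <= t <= w -> leb2.-integrable setT (EFin \o ((fun z => \1_Q z * G z) \o traj t)).
  move=> tuw; have t1 : t < 1 by lra.
  have mt : measurable_fun setT ((fun z => \1_Q z * G z) \o traj t).
    by apply: measurableT_comp mG _; exact: (mp_traj stages t1).1.
  have bt z : `|((fun z => \1_Q z * G z) \o traj t) z| <= 9 * B.
    by rewrite /= GQ -alongE.
  have zt z : ~ Q z -> ((fun z => \1_Q z * G z) \o traj t) z = 0.
    by move=> nQ /=; rewrite (traj_outside stages)// sq0// mul0r.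
  exact (@supp_integrable _ _ (measurableTypeR R * measurableTypeR R)%type leb2 _ Q _ mQ leb2_square mt bt zt).
have LHS : (\int[leb]_(t in `[u, w]) \int[leb2]_z (\1_Q z * along_traj H0 H1 H2 (t, z))%:E =
    (w - u)%:E * I)%E.
  transitivity (\int[leb]_(t in `[u, w]) I)%E.
    apply: eq_integral => t; rewrite inE /= in_itv /= => tuw; have t1 : t < 1 by lra.
    have -> : I = (\int[leb2]_z (\1_Q z * G z)%:E)%E by apply: eq_integral => z _; rewrite GQ.
    rewrite -(mp_integral (mp_traj stages t1) mG (iG t tuw)).
    by apply: eq_integral => z _; rewrite traj_square// alongE.
  rewrite integral_cst//= muleC lebesgue_measure_itv/= lte_fin uw.
  by rewrite -EFinB.
have mgt t : t < 1 -> measurable_fun setT ((fun z => \1_Q z * g z) \o traj t) /\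
    leb2.-integrable setT (EFin \o ((fun z => \1_Q z * g z) \o traj t)).
  move=> t1; have mg : measurable_fun setT (fun z => \1_Q z * g z).
    by apply: measurable_funM => //; exact: continuous_measurable2.
  have mt : measurable_fun setT ((fun z => \1_Q z * g z) \o traj t).
    by apply: measurableT_comp mg _; exact: (mp_traj stages t1).1.
  split => //.
  have bt z : `|((fun z => \1_Q z * g z) \o traj t) z| <= B0.
    rewrite /= normrM; have := sq (traj t z); have := hB0 (traj t z).
    have := normr_ge0 (g (traj t z)); have := normr_ge0 (\1_Q (traj t z) : R); nra.
  have zt z : ~ Q z -> ((fun z => \1_Q z * g z) \o traj t) z = 0.
    by move=> nQ /=; rewrite (traj_outside stages)// sq0// mul0r.
  exact (@supp_integrable _ _ (measurableTypeR R * measurableTypeR R)%type leb2 _ Q _ mQ leb2_square mt bt zt).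
have mgE t : t < 1 -> (\int[leb2]_z (\1_Q z * g (traj t z))%:E = \int[leb2]_z (\1_Q z * g z)%:E)%E.
  move=> t1; have [mt it] := mgt t t1.
  have mg : measurable_fun setT (fun z => \1_Q z * g z).
    by apply: measurable_funM => //; exact: continuous_measurable2.
  rewrite -(mp_integral (mp_traj stages t1) mg it).
  by apply: eq_integral => z _; rewrite traj_square.
have RHS : (\int[leb2]_z (\1_Q z * \int[leb]_(t in `[u, w]) along_traj H0 H1 H2 (t, z))%:E = 0)%E.
  have u1 : u < 1 by lra.
  transitivity (\int[leb2]_z ((\1_Q z * g (traj w z))%:E - (\1_Q z * g (traj u z))%:E))%E.
    apply: eq_integral => z _; rewrite -EFinB -mulrBr; congr (_ * _)%:E.
    have chain := traj_chain stages z (u := u) (w := w) C1 m0 m1 m2 h0 h1 h2.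
    exact: (esym (chain u w (lexx _) (ltW uw) (lexx _))).
  have i1 : leb2.-integrable setT (fun z => (\1_Q z * g (traj w z))%:E).
    by have := (mgt w w1).2; apply: eq_integrable => // z _ /=; rewrite traj_square.
  have i2 : leb2.-integrable setT (fun z => (\1_Q z * g (traj u z))%:E).
    by have := (mgt u u1).2; apply: eq_integrable => // z _ /=; rewrite traj_square.
  have fin1 := integrable_fin_num measurableT i1; rewrite mgE// in fin1.
  by rewrite integralB// !mgE// subee.
move: Fub; rewrite LHS RHS => /eqP; rewrite mule_eq0 eqe subr_eq0 gt_eqF//=.
by move=> /eqP.
Qed.

End Divergence.

(** * The exchange of the two halves of the square *)

Section HalfSwap.
Context {R : realType}.
Notation traj := (traj (@stage_flow R) (@stage_time R)).
Notation Q := (@open_square R).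
Implicit Types (t u w C B : R) (z x : R * R) (n : nat).

Definition half_piece (i : option bool) : set (R * R) := match i with
  | Some b => [set z | [/\ ~ bad_coords z, Q z & (1 / 2 < z.1) = b]]
  | None => bad_coords `|` ~` Q end.

Definition half_shift (i : option bool) z : R * R := match i with
  | Some true => z + (- (1 / 2), 0) | Some false => z + (1 / 2, 0) | None => z end.

Definition half_index z : option bool :=
  if pselect (~ bad_coords z /\ Q z) is left _ then Some (1 / 2 < z.1) else None.

(** The horizontal translation by [1 / 2] in each half of the square, which exchanges the
    two points of the square with the same image under the limit map. It is extended by
    the identity, also on the null set where the formula for the limit map may fail. *)
Definition half_swap z : R * R := half_shift (half_index z) z.

(** A function that changes sign under [half_swap], hence of mean zero against everything
    that factors through the limit map. *)
Definition half_sign z : R :=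
  match half_index z with Some true => - 1 | Some false => 1 | None => 0 end.

Lemma half_indexP z : half_piece (half_index z) z.
Proof.
rewrite /half_index; case: pselect => [[]//|/not_andP[/contrapT|]]; by [left|right].
Qed.

Lemma half_index_unique i z : half_piece i z -> half_index z = i.
Proof.
rewrite /half_index; case: i => [b [gz Qz <-]|/= h]; case: pselect => //.
- by move=> nh; exfalso; exact: nh.
- by move=> [gz Qz]; case: h.
Qed.

Lemma measurable_half_piece i : measurable (half_piece i).
Proof.
have mb : measurable (~` (@bad_coords R)) by apply: measurableC; exact: measurable_bad.
have mh : measurable_fun setT (fun z : R * R => 1 / 2 < z.1).
  by apply: measurable_fun_ltr => //; exact: measurable_fst.
case: i => [b|] /=; last first.
  by apply: measurableU; [exact: measurable_bad|apply: measurableC; exact: measurable_square].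
have -> : [set z | [/\ ~ bad_coords z, Q z & (1 / 2 < z.1) = b]] =
    ~` (@bad_coords R) `&` (Q `&` (fun z : R * R => 1 / 2 < z.1) @^-1` [set b]).
  by apply/seteqP; split => z /= [? []].
apply: measurableI => //; apply: measurableI; first exact: measurable_square.
by rewrite -[X in measurable X]setTI; exact: mh.
Qed.

Lemma half_shift_piece b z : half_piece (Some b) z ->
  half_piece (Some (~~ b)) (half_shift (Some b) z).
Proof.
have rh : rational_num (1 / 2 : R).
  by rewrite mul1r; apply: rationalV; exact: rational_nat.
move=> [gz Qz zb].
have [g1 g2] := good_coords gz; have [z1 z2] := Qz.
(* The middle line is rational, so a good point is strictly in one half. *)
have n12 : z.1 != 1 / 2 by apply/eqP => zE; apply: g1; rewrite zE.
split.
- move=> bz; case: b {zb} bz => /= -[h|h].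
  + by apply: g1; rewrite -[z.1](subrK (1 / 2)); exact: rationalD.
  + by apply: g2; rewrite -[z.2]addr0.
  + by apply: g1; rewrite -[z.1](addrK (1 / 2)); apply: rationalD => //; exact: rationalN.
  + by apply: g2; rewrite -[z.2]addr0.
- rewrite /open_square /=; case: b zb => /= zb; rewrite addr0; split => //.
    by move: zb z1; set q := z.1; lra.
  have : z.1 < 1 / 2 by rewrite lt_neqAle n12 leNgt zb.
  lra.
- case: b zb => /= zb; first by apply/negbTE; rewrite -leNgt; lra.
  lra.
Qed.

Lemma half_swap_index z : half_index (half_swap z) = omap negb (half_index z).
Proof.
rewrite /half_swap; have := half_indexP z; case E : (half_index z) => [b|] //= h.
by apply: half_index_unique; exact: half_shift_piece.
Qed.

Let half_shift1 : (1 / 2, 0) + (- (1 / 2), 0) = 0 :> R * R.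
Proof. by rewrite -[LHS]/(1 / 2 - 1 / 2, 0 + 0 : R) subrr addr0. Qed.

Let half_shift2 : (- (1 / 2), 0) + (1 / 2, 0) = 0 :> R * R.
Proof. by rewrite addrC half_shift1. Qed.

Lemma half_swapK : involutive half_swap.
Proof.
move=> z; rewrite {1}/half_swap half_swap_index /half_swap.
by case: (half_index z) => [[]|] //=; rewrite -addrA ?half_shift1 ?half_shift2 addr0.
Qed.

Lemma half_sign_swap z : half_sign (half_swap z) = - half_sign z.
Proof.
by rewrite /half_sign half_swap_index; case: (half_index z) => [[]|] /=; rewrite ?opprK ?oppr0.
Qed.

Lemma half_shift_mp i : measure_preserving (half_shift i).
Proof. by case: i => [[]|]; [exact: mp_translation|exact: mp_translation|exact: mp_id]. Qed.

Lemma mp_half_swap : measure_preserving half_swap.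
Proof.
pose L' (i : option bool) z := match i with
  | Some true => z + (1 / 2, 0) | Some false => z + (- (1 / 2), 0) | None => z end.
apply: (@mp_piecewise _ _ half_piece half_shift L').
- exact: measurable_half_piece.
- by move=> z; exists (half_index z); exact: half_indexP.
- by move=> i j z /half_index_unique <- /half_index_unique.
- exact: half_shift_mp.
- by case=> [[]|]; [exact: (mp_translation _).1|exact: (mp_translation _).1|exact: mp_id.1].
- by move=> i z /half_index_unique E; rewrite /half_swap E.
- by case=> [[]|] z //=; rewrite -addrA ?half_shift1 ?half_shift2 addr0.
- by case=> [[]|] z //=; rewrite -addrA ?half_shift1 ?half_shift2 addr0.
- exact: inv_bij half_swapK.
Qed.

Lemma measurable_half_sign : measurable_fun setT half_sign.
Proof.
pose v (i : option bool) (z : R * R) : R :=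
  match i with Some true => - 1 | Some false => 1 | None => 0 end.
apply: (measurable_piecewise (P := half_piece) (FI := v)).
- exact: measurable_half_piece.
- by move=> z; exists (half_index z); exact: half_indexP.
- by move=> i; exact: measurable_cst.
- by move=> i z /half_index_unique E; rewrite /half_sign E.
Qed.

Lemma half_sign_bound z : `|half_sign z| <= 1.
Proof. by rewrite /half_sign; case: half_index => [[]|]; rewrite ?normrN ?normr1 ?normr0. Qed.

Lemma half_sign_outside z : ~ Q z -> half_sign z = 0.
Proof.
by rewrite /half_sign; have := half_indexP z; case: half_index => [b []|].
Qed.

Lemma traj1_half_swap z : traj 1 (half_swap z) = traj 1 z.
Proof.
rewrite /half_swap; have := half_indexP z; case E : (half_index z) => [b|] //= h.
have h' := half_shift_piece h; case: h' => g' Q' b'; case: h => g Qz b0.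
rewrite (traj1E (good_coords g') Q') (traj1E (good_coords g) Qz) b' b0.
by case: b {E g' Q' b' b0} => /=; congr pair; rewrite ?addr0//; lra.
Qed.

End HalfSwap.

(** * A nonzero solution with zero initial value *)

Section Transport.
Context {R : realType}.
Notation leb := (@lebesgue_measure R).
Notation leb2 := ((@lebesgue_measure R \x @lebesgue_measure R)%E).
Notation traj := (traj (@stage_flow R) (@stage_time R)).
Notation trajV := (trajV (@stage_flowV R) (@stage_time R)).
Notation field := (field (@stage_vel R) (@stage_time R)).
Notation stages := (@concrete_stages R).
Notation Q := (@open_square R).
Implicit Types (t u w C B : R) (z x : R * R) (n : nat).

(** After time [1] the field runs the mixing backwards. By symmetry both the reflected
    trajectory and the reflected trajectory of the exchanged point solve the equation. *)
Definition mirror_field (y : R * (R * R)) : R * R :=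
  if y.1 <= 1 then field y else - field (reverse_time y).

(** Nothing before time [1]; afterwards [half_sign] carried by the backward flow, that is,
    a finer and finer pattern of both signs as time decreases to [1]. *)
Definition mirror_density (y : R * (R * R)) : R :=
  if y.1 <= 1 then 0 else half_sign (trajV (2 - y.1) y.2).

Lemma measurable_reverse_time : measurable_fun setT (@reverse_time R).
Proof.
apply: measurable_fun_pair; last exact: measurable_snd.
by apply: measurable_funB; [exact: measurable_cst|exact: measurable_fst].
Qed.

Let measurable_past : measurable_fun setT (fun y : R * (R * R) => y.1 <= 1).
Proof. by apply: measurable_fun_ler; [exact: measurable_fst|exact: measurable_cst]. Qed.

Lemma measurable_mirror_field : measurable_fun setT mirror_field.
Proof.
apply: measurable_fun_ifT => //; first exact: (measurable_field stages).
have m := measurableT_comp (measurable_field stages) measurable_reverse_time.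
have m' : measurable_fun setT (fun y => (- (field (reverse_time y)).1, - (field (reverse_time y)).2)).
  apply: measurable_fun_pair.
  - by apply: measurableT_comp => //; apply: measurableT_comp m; exact: measurable_fst.
  - by apply: measurableT_comp => //; apply: measurableT_comp m; exact: measurable_snd.
exact: m'.
Qed.

Lemma measurable_mirror_density : measurable_fun setT mirror_density.
Proof.
have -> : mirror_density = (fun y => if y.1 <= 1 then 0 else half_sign
    ((fun y : R * (R * R) => if y.1 < 1 then trajV y.1 y.2 else y.2) (reverse_time y))).
  apply/funext => y; rewrite /mirror_density /reverse_time /=; case: ltP => // y1.
  by move: y1; set q : R := y.1 => q1; have -> : q <= 1 by lra.
apply: measurable_fun_ifT => //.
apply: measurableT_comp; first exact: measurable_half_sign.
exact: measurableT_comp (measurable_trajV stages) measurable_reverse_time.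
Qed.

Lemma mirror_density_traj t z : 1 < t -> mirror_density (t, traj (2 - t) z) = half_sign z.
Proof.
move=> t1; rewrite /mirror_density /= leNgt t1 /= (trajK stages)//; lra.
Qed.

Lemma time_derive (h : R * (R * R) -> R) t x :
  derive1 (fun s => h (s, x)) t = 'D_(1, (0, 0)) h (t, x).
Proof.
have E : (fun k : R => k^-1 *: (h (k + t, x) - h (t, x))) =
    (fun k => k^-1 *: ((h \o shift (t, x)) (k *: (1, (0, 0))) - h (t, x))).
  apply/funext => k /=; congr (_ *: (h _ - _)).
  rewrite -[RHS]/(k * 1 + t, k *: (0 : R * R) + x).
  by rewrite mulr1 scaler0 add0r.
exact: (congr1 (fun F : R -> R => lim (F @ 0^')) E).
Qed.

Lemma space_grad (h : R * (R * R) -> R) t x :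
  grad2 (fun y => h (t, y)) x = ('D_(0, (1, 0)) h (t, x), 'D_(0, (0, 1)) h (t, x)).
Proof.
have key v : 'D_v (fun y => h (t, y)) x = 'D_(0, v) h (t, x).
  rewrite /derive.
  have E : (fun k : R => k^-1 *: (((fun y => h (t, y)) \o shift x) (k *: v) - h (t, x))) =
    (fun k => k^-1 *: ((h \o shift (t, x)) (k *: ((0 : R), v)) - h (t, x))).
    apply/funext => k /=; congr (_ *: (h _ - _)).
    by rewrite -[RHS]/(k * 0 + t, k *: v + x) mulr0 add0r.
  exact: (congr1 (fun F : R -> R => lim (F @ 0^')) E).
by rewrite /grad2 !key.
Qed.

(** The integrand changes sign under the measure preserving map [half_swap]. *)
Lemma half_integral (f : R * R -> R) C : measurable_fun setT f -> (forall z, `|f z| <= C) ->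
  (\int[leb2]_z (half_sign z * f (traj 1 z))%:E = 0)%E.
Proof.
move=> mf fC; have ms := @measurable_half_sign R.
pose F z := half_sign z * f (traj 1 z).
have mF : measurable_fun setT F.
  apply: measurable_funM => //; apply: measurableT_comp mf _.
  exact: (@mp_traj1 R).1.
have FC z : `|F z| <= C.
  rewrite normrM; have := half_sign_bound z; have := fC (traj 1 z).
  have := normr_ge0 (f (traj 1 z)); have := normr_ge0 (half_sign z); nra.
have F0 z : ~ Q z -> F z = 0 by move=> /half_sign_outside; rewrite /F => ->; rewrite mul0r.
have FS z : F (half_swap z) = - F z by rewrite /F half_sign_swap traj1_half_swap mulNr.
have iF : leb2.-integrable setT (EFin \o F).
  exact (@supp_integrable _ _ (measurableTypeR R * measurableTypeR R)%type leb2 _ Q _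
    (@measurable_square R) (@leb2_square R) mF FC F0).
have iFN : leb2.-integrable setT (EFin \o (F \o @half_swap R)).
  have -> : F \o @half_swap R = (fun z => - F z) by apply/funext => z; exact: FS.
  exact: (integrableN iF).
have := mp_integral (@mp_half_swap R) mF iFN.
have -> : (\int[leb2]_z (F (half_swap z))%:E = - \int[leb2]_z (F z)%:E)%E.
  under eq_integral do rewrite FS EFinN.
  by rewrite integralN//; exact: integrable_add_def iF.
have := integrable_fin_num measurableT iF.
case: (integral _ _ _) => //= r _ [] rE; congr (_%:E).
by move: rE; rewrite -[LHS]/(- r) => rE; lra.
Qed.

(** Change variables along the flow at each time, integrate in time first, and apply the
    chain rule: only the boundary term at time [1] survives, since the test function
    vanishes for large times. There [half_integral] applies: the solution tends weakly
    to zero. *)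
Lemma mirror_transport : weak_transport_zero mirror_field mirror_density.
Proof.
move=> h th; have [ch dh dch bh] := test_C1 th.
pose D0 q := 'D_(1, (0, 0)) h q; pose D1 q := 'D_(0, (1, 0)) h q; pose D2 q := 'D_(0, (0, 1)) h q.
have [W W1 hW] : exists2 W : R, 1 < W & forall t x, W <= t ->
    [/\ h (t, x) = 0, D0 (t, x) = 0, D1 (t, x) = 0 & D2 (t, x) = 0].
  have [M [_ hM]] := compact_bounded th.2.
  exists (`|M| + 2); first by have := normr_ge0 M; lra.
  move=> t x tM; have nc : ~ closure [set z | h z != 0] (t, x).
    move=> cl; have M1 : M < `|M| + 1 by rewrite ltr_pwDr ?ler_norm.
    have tx : Num.max `|t| `|x| <= `|M| + 1 := hM (`|M| + 1) M1 (t, x) cl.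
    by move: tx; rewrite ge_max => /andP[+ _]; have := ler_norm t; lra.
  by split; [exact: (test_derive_outside 0 nc).2|exact: (test_derive_outside _ nc).1..].
have C1 := C1_reversed th.
pose H0 y := - D0 (reverse_time y); pose H1 y := D1 (reverse_time y); pose H2 y := D2 (reverse_time y).
have [B [B00 B0 B1 B2]] : exists B : R, [/\ forall y, `|h y| <= B, forall y, `|H0 y| <= B, forall y, `|H1 y| <= B & forall y, `|H2 y| <= B].
  have [b hb] := compact_supp_bounded ch th.2 (fun y hy => (test_derive_outside 0 hy).2).
  have [b0 hb0] := bh (1, (0, 0)); have [b1 hb1] := bh (0, (1, 0)); have [b2 hb2] := bh (0, (0, 1)).
  exists (`|b| + `|b0| + `|b1| + `|b2|).
  have := normr_ge0 b; have := normr_ge0 b0; have := normr_ge0 b1; have := normr_ge0 b2 => p2 p1 p0 p.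
  have := ler_norm b; have := ler_norm b0; have := ler_norm b1; have := ler_norm b2 => q2 q1 q0 q.
  split=> y; [apply: le_trans (hb y) _|rewrite normrN; apply: le_trans (hb0 _) _|
    apply: le_trans (hb1 _) _|apply: le_trans (hb2 _) _]; lra.
have cont_rev (D : R * (R * R) -> R) : continuous D -> measurable_fun setT (fun y => D (reverse_time y)).
  by move=> cD; exact: measurableT_comp (continuous_measurable3 cD) measurable_reverse_time.
have m0 : measurable_fun setT H0.
  by apply: measurableT_comp; [|exact: cont_rev (dch _)].
have m1 : measurable_fun setT H1 by exact: cont_rev (dch _).
have m2 : measurable_fun setT H2 by exact: cont_rev (dch _).
pose K (y : R * (R * R)) := - along_traj H0 H1 H2 (reverse_time y).
have mK : measurable_fun setT K.
  apply: measurableT_comp => //.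
  exact: measurableT_comp (measurable_along_traj m0 m1 m2) measurable_reverse_time.
have KB y : `|K y| <= 9 * B.
  rewrite /K (normrN (along_traj H0 H1 H2 (reverse_time y))).
  exact (@along_traj_bound R H0 H1 H2 B (reverse_time y) B0 B1 B2).
pose k (y : R * (R * R)) := D0 y + dot2 (mirror_field y) (D1 y, D2 y).
have kK t z : 1 < t -> k (t, traj (2 - t) z) = K (t, z).
  move=> t1; rewrite /k /K /along_traj /along /mirror_field /= leNgt t1 /=.
  rewrite /H0 /H1 /H2 /reverse_time /= subKr /dot2 /=; ring.
have mk : measurable_fun setT k.
  have mm := measurable_mirror_field.
  have md0 : measurable_fun setT D0 := continuous_measurable3 (dch _).
  have md1 : measurable_fun setT D1 := continuous_measurable3 (dch _).
  have md2 : measurable_fun setT D2 := continuous_measurable3 (dch _).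
  apply: measurable_funD; first exact: md0.
  apply: measurable_funD; apply: measurable_funM; [|exact: md1| |exact: md2].
  - by apply: measurableT_comp mm; exact: measurable_fst.
  - by apply: measurableT_comp mm; exact: measurable_snd.
pose inner t := (\int[leb2]_x (mirror_density (t, x) * k (t, x))%:E)%E.
(* Change of variables along the flow at time [t]. *)
have innerE t : 1 < t -> inner t = (\int[leb2]_z (half_sign z * K (t, z))%:E)%E.
  move=> t1; have t1' : 2 - t < 1 by lra.
  pose f x := mirror_density (t, x) * k (t, x).
  have mx : measurable_fun setT (fun x : R * R => (t, x)).
    by apply: measurable_fun_pair => //; exact: measurable_cst.
  have mf : measurable_fun setT f.
    by apply: measurable_funM; [exact: measurableT_comp measurable_mirror_density mx|exact: measurableT_comp mk mx].
  have fE z : f (traj (2 - t) z) = half_sign z * K (t, z).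
    by rewrite /f mirror_density_traj// kK.
  have mft : measurable_fun setT (f \o traj (2 - t)).
    by apply: measurableT_comp mf _; exact: (mp_traj stages t1').1.
  have ftB z : `|(f \o traj (2 - t)) z| <= 9 * B.
    rewrite /= fE normrM; have := half_sign_bound z; have := KB (t, z).
    have := normr_ge0 (K (t, z)); have := normr_ge0 (half_sign z); nra.
  have ft0 z : ~ Q z -> (f \o traj (2 - t)) z = 0.
    by move=> /half_sign_outside s0; rewrite /= fE s0 mul0r.
  have ift : leb2.-integrable setT (EFin \o (f \o traj (2 - t))).
    exact (@supp_integrable _ _ (measurableTypeR R * measurableTypeR R)%type leb2 _ Q _
      (@measurable_square R) (@leb2_square R) mft ftB ft0).
  rewrite /inner -(mp_integral (mp_traj stages t1') mf ift).
  by apply: eq_integral => z _; rewrite -fE.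
have mD : measurable `]1, W]%classic := measurable_itv _.
have Doo : (leb `]1%R, W]%classic < +oo)%E.
  by rewrite lebesgue_measure_itv/= lte_fin W1 -EFinB ltry.
have Fub := strip_fubini mD Doo (@measurable_square R) (@leb2_square R) (@measurable_half_sign R)
  (@half_sign_bound R) (@half_sign_outside R) mK KB.
transitivity (\int[leb]_(t in `]1%R, W]) \int[leb2]_z (half_sign z * K (t, z))%:E)%E.
  rewrite integral_mkcond [RHS]integral_mkcond; apply: eq_integral => t _.
  rewrite !patchE.
  have -> : (\int[leb2]_x (mirror_density (t, x) * (derive1 (fun s => h (s, x)) t +
      dot2 (mirror_field (t, x)) (grad2 (fun y => h (t, y)) x)))%:E)%E = inner t.
    by apply: eq_integral => x _; rewrite time_derive space_grad.
  case: (boolP (t \in `]1, W]%classic)) => tW.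
    move: (tW); rewrite inE /= in_itv /= => /andP[t1 _]; rewrite mem_set ?innerE//=.
    by rewrite in_itv /= andbT; lra.
  case: ifP => // _; move: tW; rewrite notin_setE /= in_itv /= => /negP.
  rewrite negb_and -leNgt -ltNge => /orP[t1|tW].
    by rewrite /inner; under eq_integral do rewrite /mirror_density /= t1 mul0r; rewrite integral0.
  rewrite /inner; under eq_integral => x _.
    have [_ d0 d1 d2] := hW t x (ltW tW).
    rewrite /k d0 d1 d2 /dot2 /= !mulr0 !addr0 mulr0; over.
  by rewrite integral0.
rewrite Fub.
have KE z : \int[leb]_(t in `]1, W]) K (t, z) = - h (1, traj 1 z).
  have mKz : measurable_fun setT (fun t => K (t, z)).
    by apply: measurableT_comp mK _; apply: measurable_fun_pair => //; exact: measurable_cst.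
  have chain := traj_chain stages z (u := 2 - W) (w := 1) C1 m0 m1 m2 B0 B1 B2.
  have maz : measurable_fun setT (fun t => along_traj H0 H1 H2 (t, z)).
    apply: measurableT_comp (measurable_along_traj m0 m1 m2) _.
    by apply: measurable_fun_pair => //; exact: measurable_cst.
  have aB t : `|along_traj H0 H1 H2 (t, z)| <= 9 * B.
    exact (@along_traj_bound R H0 H1 H2 B (t, z) B0 B1 B2).
  have := primitive_reflect (c := 2) maz aB chain.
  have -> : 2 - 1 = 1 :> R by lra.
  rewrite subKr => /(_ 1 W (lexx _) (ltW W1) (lexx _)).
  rewrite /reverse_time /= !subKr (_ : 2 - 1 = 1 :> R); last by lra.
  have [-> _ _ _] := hW W (traj (2 - W) z) (lexx _); rewrite sub0r.
  move=> ->; rewrite /segint Rintegral_itv_obnd_cbnd//.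
  have ig : leb.-integrable `[1, W] (EFin \o (fun t => K (t, z))).
    exact: (bounded_integrable mKz (fun t _ => KB (t, z))).
  by apply: integrableS ig => //; apply: subset_itvr; rewrite bnd_simp.
have m1h : measurable_fun setT (fun x => - h (1, x)).
  apply: measurableT_comp => //; apply: measurableT_comp (continuous_measurable3 ch) _.
  by apply: measurable_fun_pair => //; exact: measurable_cst.
rewrite -[RHS](half_integral m1h (C := B)); last by move=> x; rewrite normrN.
by apply: eq_integral => z _; rewrite KE.
Qed.

End Transport.

(** * Admissibility of the fields *)

Section Flows.
Context {R : realType}.
Notation leb := (@lebesgue_measure R).
Notation leb2 := ((@lebesgue_measure R \x @lebesgue_measure R)%E).
Notation leb3 := ((@lebesgue_measure R \x (@lebesgue_measure R \x @lebesgue_measure R))%E).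
Notation traj := (traj (@stage_flow R) (@stage_time R)).
Notation trajV := (trajV (@stage_flowV R) (@stage_time R)).
Notation field := (field (@stage_vel R) (@stage_time R)).
Notation stages := (@concrete_stages R).
Notation Q := (@open_square R).
Implicit Types (t u w C B : R) (z x : R * R) (n : nat).

(** Up to a null set this is a rectangle. *)
Lemma half_piece_pos : (0 < leb2 (half_piece (Some false)))%E.
Proof.
pose H : set (R * R) := `]0, 1 / 2[%classic `*` `]0, 1[%classic.
have mP := @measurable_half_piece R (Some false).
have mbad := @measurable_bad R.
have HE : leb2 H = (2^-1)%:E.
  have l1 : leb `]0%R, (1 / 2)[%classic = (2^-1)%:E.
    by rewrite lebesgue_measure_itv/= lte_fin divr_gt0// sube0 mul1r.
  have l2 : leb `]0%R, 1%R[%classic = 1%:E by rewrite lebesgue_measure_itv/= lte_fin ltr01 sube0.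
  by rewrite product_measure1E// [X in (X * _)%E]l1 [X in (_ * X)%E]l2 mule1.
apply: (@lt_le_trans _ _ (leb2 H)); first by rewrite [X in (_ < X)%E]HE lte_fin invr_gt0.
apply: (@le_trans _ _ (leb2 (half_piece (Some false) `|` @bad_coords R))).
  apply: le_measure; rewrite ?inE; first exact: measurableX.
    exact (measurableU _ _ mP mbad).
  move=> [a b] [/=]; rewrite !in_itv /= => ha hb.
  case: (pselect (bad_coords (a, b))) => hbad; [by right|left; split=> //].
    by rewrite /open_square /=; lra.
  by apply/negbTE; rewrite -leNgt /=; lra.
apply: (le_trans (measureU2 leb2 mP mbad)).
by rewrite [X in (_ + X)%E](@leb2_bad R) adde0.
Qed.

Lemma mirror_density_Linfty : Linfty_half_space (@mirror_density R).
Proof.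
split; first exact: measurable_funTS (@measurable_mirror_density R).
exists 1; exists set0; split; [exact: measurable0|exact (measure0 (leb \x @plane_measure R)%E)|].
move=> z /=; apply => _; rewrite /mirror_density; case: ifP => _; last exact: half_sign_bound.
by rewrite normr0.
Qed.

Lemma mirror_density_nonzero : ~ {ae leb3, forall y, half_space y -> mirror_density y = 0}.
Proof.
move=> [N [mN N0 hN]].
pose E : set (R * (R * R)) := `[2, 3]%classic `*` half_piece (Some false).
have mP := @measurable_half_piece R (Some false).
have mI : measurable (`[2, 3]%classic : set R) := measurable_itv _.
have mE : measurable E by exact: measurableX.
have EN : E `<=` N.
  move=> [t z] [/=]; rewrite in_itv /= => /andP[t2 t3] hz; apply: hN => /=.
  have t0 : half_space (t, z) by rewrite /half_space /=; lra.
  move=> /(_ t0); rewrite /mirror_density /= leNgt; have -> : 1 < t by lra.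
  rewrite /= (trajV_le0 stages); last by lra.
  by rewrite /half_sign (@half_index_unique R (Some false) z hz); apply/eqP; exact: oner_neq0.
have : (leb3 E <= leb3 N)%E.
  exact (@le_measure _ _ _ (leb \x @plane_measure R)%E E N (mem_set mE) (mem_set mN) EN).
rewrite [X in (_ <= X)%E]N0.
rewrite [X in (X <= _)%E](@product_measure1E _ _ (measurableTypeR R)
  (measurableTypeR R * measurableTypeR R)%type R leb (@plane_measure R) _ _ mI mP).
apply/negP; rewrite -ltNge; apply: mule_gt0; last exact: half_piece_pos.
have L : leb `[2%R, 3%R]%classic = (3 - 2)%:E.
  by rewrite lebesgue_measure_itv/= lte_fin; have -> : 2 < 3 :> R by lra.
by rewrite [X in (_ < X)%E]L lte_fin; lra.
Qed.

Lemma divergence_freeN (b : R * R -> R * R) C : measurable_fun setT b ->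
  (forall x, `|(b x).1| <= C /\ `|(b x).2| <= C) -> (forall x, ~ Q x -> b x = 0) ->
  divergence_free b -> divergence_free (fun x => - b x).
Proof.
move=> mb bC b0 db g tg; have [cg dg dcg bg] := test_C1 tg.
have [B1 hB1] := bg (1, 0); have [B2 hB2] := bg (0, 1).
pose G x := dot2 (b x) (grad2 g x).
have GN x : dot2 (- b x) (grad2 g x) = - G x by rewrite /G /dot2 /=; ring.
have m1 : measurable_fun setT (fun x => 'D_(1, 0) g x) by exact: continuous_measurable2.
have m2 : measurable_fun setT (fun x => 'D_(0, 1) g x) by exact: continuous_measurable2.
have mG : measurable_fun setT G.
  apply: measurable_funD; apply: measurable_funM; [|exact: m1| |exact: m2].
  - by apply: measurableT_comp mb; exact: measurable_fst.
  - by apply: measurableT_comp mb; exact: measurable_snd.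
have GB x : `|G x| <= C * B1 + C * B2.
  have [c1 c2] := bC x; apply: le_trans (ler_normD _ _) _; rewrite !normrM.
  by apply: lerD; apply: ler_pM => //; [exact: hB1|exact: hB2].
have G0 x : ~ Q x -> G x = 0 by move=> /b0 bx; rewrite /G bx /dot2 !mul0r addr0.
have iG : leb2.-integrable setT (EFin \o G).
  exact (@supp_integrable _ _ (measurableTypeR R * measurableTypeR R)%type leb2 _ Q _
    (@measurable_square R) (@leb2_square R) mG GB G0).
under eq_integral do rewrite GN EFinN.
rewrite integralN//; last exact: integrable_add_def iG.
by rewrite [X in (- X)%E](db g tg) oppe0.
Qed.

(** At each time the field is that of one stage, or zero. *)
Lemma divergence_free_field t : divergence_free (fun x => field (t, x)).
Proof.
case: (pselect (0 <= t < 1)) => [/(T_bracket stages)[n nt]|nt].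
  have -> : (fun x => field (t, x)) = @stage_vel R n.
    by apply/funext => x; exact: (fieldE stages).
  exact: stage_divergence_free.
move=> g tg; under eq_integral do rewrite (field0 stages _ nt) /dot2 !mul0r addr0.
by rewrite integral0.
Qed.

Let measurable_slice t : measurable_fun setT (fun x => field (t, x)).
Proof.
apply: measurableT_comp (measurable_field stages) _.
by apply: measurable_fun_pair => //; exact: measurable_cst.
Qed.

Lemma divergence_free_mirror t : divergence_free (fun x => mirror_field (t, x)).
Proof.
rewrite /mirror_field /=; case: leP => _; first exact: divergence_free_field.
apply: (@divergence_freeN (fun x => field (2 - t, x)) 4).
- exact: measurable_slice.
- by move=> x; exact: (field_bound stages).
- by move=> x; exact: (field_outside stages).
- exact: divergence_free_field.
Qed.

Lemma box_support (a : R * (R * R) -> R * R) :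
  (forall t x, a (t, x) != 0 -> 0 <= t <= 2 /\ Q x) -> compactly_supported a.
Proof.
move=> ha; pose K : set (R * (R * R)) := `[0, 2]%classic `*` (`[0, 1]%classic `*` `[0, 1]%classic).
have cK : compact K.
  apply: compact_setX; first exact: segment_compact.
  by apply: compact_setX; exact: segment_compact.
apply: (subclosed_compact _ cK); first exact: closed_closure.
have clK : closed K by apply: compact_closed => //; exact: norm_hausdorff.
rewrite [X in _ `<=` X](closure_id K).1//; apply: closure_subset => -[t [x y]] /= /ha[t02 [x1 x2]].
by rewrite /K /= !in_itv /=; split => //; split; rewrite /= in x1 x2; lra.
Qed.

Lemma admissible_forward : admissible_field field.
Proof.
split; first exact: (measurable_field stages).
- by exists 4 => z; rewrite -[X in X <= _]/(Num.max _ _) ge_max; have [-> ->] := field_bound stages z.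
- apply: box_support => t x f0; split.
    apply: contrapT => nt; move/eqP: f0; apply; apply: (field0 stages).
    by move=> h; apply: nt; lra.
  by apply: contrapT => nx; move/eqP: f0; apply; exact: (field_outside stages).
- exists set0; split; [exact: measurable0|exact: measure0|].
  by move=> t /=; apply; exact: divergence_free_field.
Qed.

Lemma admissible_mirror : admissible_field (@mirror_field R).
Proof.
split; first exact: measurable_mirror_field.
- exists 4 => z; rewrite -[X in X <= _]/(Num.max _ _) ge_max /mirror_field; case: ifP => _.
    by have [-> ->] := field_bound stages z.
  by rewrite /= !normrN; have [-> ->] := field_bound stages (reverse_time z).
- apply: box_support => t x f0; split.
    apply: contrapT => nt; move/eqP: f0; apply; rewrite /mirror_field /=; case: leP => t1.
      by apply: (field0 stages) => h; apply: nt; lra.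
    by rewrite (field0 stages) ?oppr0// => h; rewrite /= in h; apply: nt; lra.
  apply: contrapT => nx; move/eqP: f0; apply.
  by rewrite /mirror_field !(field_outside stages)// oppr0; case: ifP.
- exists set0; split; [exact: measurable0|exact: measure0|].
  by move=> t /=; apply; exact: divergence_free_mirror.
Qed.

End Flows.

(** * Two flows of the mirrored field *)

Section Flows.
Context {R : realType}.
Notation traj := (traj (@stage_flow R) (@stage_time R)).
Notation trajV := (trajV (@stage_flowV R) (@stage_time R)).
Notation field := (field (@stage_vel R) (@stage_time R)).
Notation stages := (@concrete_stages R).
Implicit Types (t u w C B : R) (z x : R * R) (n : nat).

Section Evolution.
Variables (a : R * (R * R) -> R * R) (E E' : R -> R * R -> R * R) (M : R).
Hypotheses (ma : measurable_fun setT a)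
  (aM : forall y, `|(a y).1| <= M /\ `|(a y).2| <= M)
  (EK : forall t, t != 1 -> cancel (E t) (E' t))
  (EK' : forall t, t != 1 -> cancel (E' t) (E t))
  (mpE : forall t, measure_preserving (E t))
  (mpE' : forall t, t != 1 -> measure_preserving (E' t))
  (mE : forall z, measurable_fun setT (fun t => E t z))
  (ode1 : forall z u w, primitive_on (fun t => (E t z).1) (fun t => (a (t, E t z)).1) u w)
  (ode2 : forall z u w, primitive_on (fun t => (E t z).2) (fun t => (a (t, E t z)).2) u w).

(** Go back to time [0] and then forward to time [t + alpha]. The backward map exists for
    [alpha != 1] only. *)
Definition flow_of_evolution t alpha x : R * R := E (t + alpha) (E' alpha x).

Lemma evolution_everywhere_flow : everywhere_flow a flow_of_evolution.
Proof.
split.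
- move=> t alpha x a1; rewrite /integral_curve_at /flow_of_evolution.
  set z := E' alpha x.
  have mY : measurable_fun setT (fun t => a (t, E t z)).
    apply: measurableT_comp ma _; exact: measurable_fun_pair.
  have m1 : measurable_fun setT (fun t => (a (t, E t z)).1).
    by apply: measurableT_comp mY; exact: measurable_fst.
  have m2 : measurable_fun setT (fun t => (a (t, E t z)).2).
    by apply: measurableT_comp mY; exact: measurable_snd.
  have [i1 e1] := oriented_integralE alpha t m1 (fun t => (aM (t, E t z)).1) (ode1 z).
  have [i2 e2] := oriented_integralE alpha t m2 (fun t => (aM (t, E t z)).2) (ode2 z).
  split; [exact: i1|exact: i2|].
  rewrite e1 e2.
  have -> : E alpha z = x by exact: EK'.
  rewrite -[RHS]/(x.1 + ((E (t + alpha) z).1 - x.1), x.2 + ((E (t + alpha) z).2 - x.2)).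
  by rewrite !subrKC -surjective_pairing.
- move=> alpha t a1; apply: mp_preserves_lebesgue.
  exact: mp_comp (mpE (t + alpha)) (mpE' a1).
- move=> t1 t2 alpha x a1 ta1; rewrite /flow_of_evolution [alpha + t2]addrC EK//.
  by rewrite addrA.
Qed.

End Evolution.

Section Mirror.
Variable tau : R * R -> R * R.
Hypotheses (tauK : involutive tau) (mtau : measure_preserving tau)
  (traj1_tau : forall z, traj 1 (tau z) = traj 1 z).

Definition mirror_evolution t z : R * R :=
  if t <= 1 then traj t z else traj (2 - t) (tau z).

Definition mirror_evolutionV t x : R * R :=
  if t <= 1 then trajV t x else tau (trajV (2 - t) x).

Let past t : t != 1 -> t <= 1 -> t < 1.
Proof. by rewrite lt_neqAle => ->. Qed.

Lemma mirror_evolution_past t z : t <= 1 -> mirror_evolution t z = traj t z.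
Proof. by rewrite /mirror_evolution => ->. Qed.

Lemma mirror_evolution_future t z : 1 <= t -> mirror_evolution t z = traj (2 - t) (tau z).
Proof.
rewrite le_eqVlt /mirror_evolution => /orP[/eqP <-|t1]; last by rewrite leNgt t1.
by rewrite lexx (_ : 2 - 1 = 1 :> R) ?traj1_tau//; lra.
Qed.

Lemma mirror_field_future t x : 1 <= t -> mirror_field (t, x) = - field (2 - t, x).
Proof.
rewrite le_eqVlt /mirror_field /= => /orP[/eqP <-|t1]; last by rewrite leNgt t1.
by rewrite lexx /reverse_time !(field0 stages) ?oppr0//; lra.
Qed.

Lemma mirror_evolutionK t : t != 1 -> cancel (mirror_evolution t) (mirror_evolutionV t).
Proof.
move=> t1 z; rewrite /mirror_evolution /mirror_evolutionV; case: leP => ht.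
  by rewrite (trajK stages)//; exact: past.
by rewrite (trajK stages) ?tauK//; lra.
Qed.

Lemma mirror_evolutionVK t : t != 1 -> cancel (mirror_evolutionV t) (mirror_evolution t).
Proof.
move=> t1 z; rewrite /mirror_evolution /mirror_evolutionV; case: leP => ht.
  by rewrite (trajVK stages)//; exact: past.
by rewrite tauK (trajVK stages)//; lra.
Qed.

Lemma mp_mirror_evolution t : measure_preserving (mirror_evolution t).
Proof.
rewrite /mirror_evolution; case: leP => ht.
  have [->|t1] := eqVneq t 1; first exact: mp_traj1.
  by apply: (mp_traj stages); exact: past.
by apply: (@mp_comp _ (traj (2 - t)) tau) => //; apply: (mp_traj stages); lra.
Qed.

Lemma mp_mirror_evolutionV t : t != 1 -> measure_preserving (mirror_evolutionV t).
Proof.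
move=> t1; rewrite /mirror_evolutionV; case: leP => ht.
  by apply: (mp_trajV stages); exact: past.
by apply: (@mp_comp _ tau (trajV (2 - t))) => //; apply: (mp_trajV stages); lra.
Qed.

Lemma measurable_mirror_evolution z : measurable_fun setT (fun t => mirror_evolution t z).
Proof.
have m0 : measurable_fun setT (fun t : R => t <= 1).
  by apply: measurable_fun_ler => //; exact: measurable_cst.
rewrite /mirror_evolution; apply: measurable_fun_ifT => //.
  exact: (measurable_traj_time stages).
apply: measurableT_comp (measurable_traj_time stages (tau z)) _.
by apply: measurable_funB; first exact: measurable_cst.
Qed.

(** Both sides of time [1] are instances of the chain rule, the second one reflected; the
    two parts match at time [1] because [tau] does not change the limit map. *)
Lemma mirror_ode (p : R * R -> R) (c1 c2 : R) z u w :
  (forall v, p v = v.1 * c1 + v.2 * c2) ->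
  C1_with_gradient (fun y : R * (R * R) => p y.2) (cst 0) (cst c1) (cst c2) ->
  primitive_on (fun t => p (mirror_evolution t z))
    (fun t => p (mirror_field (t, mirror_evolution t z))) u w.
Proof.
move=> pE C1; pose B : R := `|c1| + `|c2|.
have B0 : 0 <= B by rewrite addr_ge0.
have m c : measurable_fun setT (cst c : R * (R * R) -> R) by exact: measurable_cst.
have b0 (y : R * (R * R)) : `|(cst 0 : R * (R * R) -> R) y| <= B by rewrite normr0.
have b1 (y : R * (R * R)) : `|(cst c1 : R * (R * R) -> R) y| <= B by rewrite /B /= lerDl.
have b2 (y : R * (R * R)) : `|(cst c2 : R * (R * R) -> R) y| <= B by rewrite /B /= lerDr.
have chain z' u' w' := traj_chain stages z' (u := u') (w := w') C1 (m 0) (m c1) (m c2) b0 b1 b2.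
have alongE v y : along (cst 0) (cst c1) (cst c2) v y = p v by rewrite /along /= pE add0r.
have mp' : measurable_fun setT p.
  have -> : p = (fun v => v.1 * c1 + v.2 * c2) by apply/funext.
  apply: measurable_funD; apply: measurable_funM; try exact: measurable_cst.
    exact: measurable_fst.
  exact: measurable_snd.
have mf z' : measurable_fun setT (fun t => p (field (t, traj t z'))).
  apply: measurableT_comp mp' _; apply: measurableT_comp (measurable_field stages) _.
  by apply: measurable_fun_pair => //; exact: (measurable_traj_time stages).
have mg : measurable_fun setT (fun t => p (mirror_field (t, mirror_evolution t z))).
  apply: measurableT_comp mp' _; apply: measurableT_comp (@measurable_mirror_field R) _.
  by apply: measurable_fun_pair => //; exact: measurable_mirror_evolution.
have pB (v : R * R) : `|v.1| <= 4 -> `|v.2| <= 4 -> `|p v| <= 4 * B.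
  move=> v1 v2; rewrite pE; apply: le_trans (ler_normD _ _) _; rewrite !normrM.
  rewrite /B mulrDr; apply: lerD; exact: ler_wpM2r.
have fB y : `|p (field y)| <= 4 * B.
  by have [f1 f2] := field_bound stages y; exact: pB.
have pN v : p (- v) = - p v by rewrite !pE /=; ring.
have gB t : `|p (mirror_field (t, mirror_evolution t z))| <= 4 * B.
  by rewrite /mirror_field; case: ifP => _; rewrite ?pN ?normrN; exact: fB.
have before u' w' : w' <= 1 -> primitive_on (fun t => p (mirror_evolution t z))
    (fun t => p (mirror_field (t, mirror_evolution t z))) u' w'.
  move=> w1 s t us st tw; rewrite !mirror_evolution_past; [|lra|lra].
  rewrite (chain z u' w' s t us st tw); apply: eq_Rintegral => r.
  rewrite inE /= in_itv /= => sr; rewrite alongE mirror_evolution_past; last by lra.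
  by rewrite /mirror_field /=; have -> : r <= 1 by lra.
have after u' w' : 1 <= u' -> primitive_on (fun t => p (mirror_evolution t z))
    (fun t => p (mirror_field (t, mirror_evolution t z))) u' w'.
  move=> u1 s t us st tw; rewrite !mirror_evolution_future; [|lra|lra].
  have chain' : primitive_on (fun t => p (traj t (tau z))) (fun t => p (field (t, traj t (tau z))))
      (2 - w') (2 - u').
    move=> s' t' us' st' tw'; rewrite (chain (tau z) _ _ s' t' us' st' tw').
    by apply: eq_Rintegral => r _; rewrite alongE.
  have := primitive_reflect (c := 2) (mf (tau z)) (fun t => fB _) chain'.
  rewrite !subKr => /(_ s t us st tw) ->; apply: eq_Rintegral => r.
  rewrite inE /= in_itv /= => sr; rewrite mirror_evolution_future; last by lra.
  by rewrite mirror_field_future ?pN//; lra.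
have [w1|w1] := leP w 1; first exact: before.
have [u1|u1] := leP 1 u; first exact: after.
apply: (@primitive_cat _ _ _ u 1 w).
- by apply: (bounded_integrable (K := 4 * B)) => // t _; exact: gB.
- lra.
- exact: before.
- exact: after.
Qed.

Definition mirror_flow := flow_of_evolution mirror_evolution mirror_evolutionV.

Lemma mirror_everywhere_flow : everywhere_flow (@mirror_field R) mirror_flow.
Proof.
apply: (@evolution_everywhere_flow _ _ _ 4).
- exact: measurable_mirror_field.
- move=> y; rewrite /mirror_field; case: ifP => _ /=; rewrite ?normrN; exact: (field_bound stages).
- exact: mirror_evolutionK.
- exact: mirror_evolutionVK.
- exact: mp_mirror_evolution.
- exact: mp_mirror_evolutionV.
- exact: measurable_mirror_evolution.
- move=> z u w; apply: (@mirror_ode fst 1 0); last exact: C1_fst.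
  by move=> v; rewrite mulr1 mulr0 addr0.
- move=> z u w; apply: (@mirror_ode snd 0 1); last exact: C1_snd.
  by move=> v; rewrite mulr1 mulr0 add0r.
Qed.

(** At time [2] the mixing has been undone, and only [tau] remains. *)
Lemma mirror_flow_period x : mirror_flow 2 0 x = tau x.
Proof.
rewrite /mirror_flow /flow_of_evolution /mirror_evolutionV ler01 (trajV_le0 stages)// addr0.
rewrite mirror_evolution_future; last by lra.
by rewrite subrr (traj_le0 stages).
Qed.

End Mirror.

Lemma mirror_flows_distinct : distinct_flows (mirror_flow id) (mirror_flow (@half_swap R)).
Proof.
exists 0, 2; split; first by rewrite eq_sym oner_eq0.
have mP := @measurable_half_piece R (Some false).
apply: (@lt_le_trans _ _ (area (half_piece (Some false)))).
  by rewrite area_borel//; exact: half_piece_pos.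
apply: area_le => z hz /=; rewrite !mirror_flow_period//; last exact: traj1_half_swap.
rewrite /half_swap (@half_index_unique R (Some false) z hz) /=.
apply/eqP => /(congr1 fst) /=; lra.
Qed.

End Flows.

(** * Leaving a point of a rotating square *)

Section Shear.
Context {R : realType}.
Notation leb := (@lebesgue_measure R).
Implicit Types (X Y f g : R -> R) (u w t s M d r c : R).

Lemma segint_ext f g s t : (forall r, s <= r <= t -> f r = g r) -> segint f s t = segint g s t.
Proof. by move=> fg; apply: eq_Rintegral => r; rewrite inE /= in_itv /=; exact: fg. Qed.

Lemma segint_cst c s t : s <= t -> segint (cst c) s t = c * (t - s).
Proof.
move=> st; rewrite /segint Rintegral_cst//= lebesgue_measure_itv/= lte_fin.
case: ltP => [_|ts]; first by rewrite -EFinB.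
by rewrite (_ : t = s) ?subrr//; apply/eqP; rewrite eq_le st ts.
Qed.

Record driven X f M u w : Prop := {
  driven_measurable : measurable_fun setT f;
  driven_speed : forall r, `|f r| <= M;
  driven_primitive : primitive_on X f u w }.

Lemma driven_lipschitz X f M u w s t : driven X f M u w -> u <= s -> s <= t -> t <= w ->
  `|X t - X s| <= M * (t - s).
Proof. by case=> mf fM pX us st tw; rewrite pX//; exact: segint_bound. Qed.

Lemma driven_le X f M M' u w : M <= M' -> driven X f M u w -> driven X f M' u w.
Proof. by move=> MM [mf fM pX]; split => // r; exact: le_trans (fM r) MM. Qed.

Lemma driven_affine X f M u w r c : driven X f M u w ->
  driven (fun t => r * X t + c) (fun t => r * f t) (`|r| * M) u w.
Proof.
move=> [mf fM pX]; split.
- by apply: measurable_funM => //; exact: measurable_cst.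
- by move=> t; rewrite normrM ler_wpM2l.
- move=> s t us st tw; have -> : r * X t + c - (r * X s + c) = r * (X t - X s) by ring.
  rewrite (pX _ _ us st tw) /segint RintegralZl//.
  exact: (bounded_integrable mf (fun x _ => fM x)).
Qed.

(** For a velocity that is the vertical shear [(0, k X)] on one side of an antidiagonal
    through the initial point, and that points to this same side everywhere nearby, the
    curve cannot cross the antidiagonal, and so it follows the shear. When the velocity is
    continuous near the point, the condition on the sum of the components is harmless. *)
Lemma shear_drift X Y f g M (k : R -> R) d u w : 0 < d ->
  driven X f M u w -> driven Y g M u w ->
  (forall t, u <= t < w -> `|X t - X u| < d -> `|Y t - Y u| < d -> 0 <= f t + g t /\
     (0 <= (X t - X u) + (Y t - Y u) -> f t = 0 /\ g t = k (X t))) ->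
  exists2 e : R, 0 < e & forall t, u <= t < w -> t < u + e ->
    X t = X u /\ Y t = Y u + (t - u) * k (X u).
Proof.
move=> d0 dX dY H; have M0 : 0 <= M := le_trans (normr_ge0 _) (driven_speed dX 0).
(* Within this time the curve stays in the box where the hypothesis on velocities holds. *)
exists (d / (M + 1)); first by apply: divr_gt0 => //; lra.
move=> t utw te; have te' : (t - u) * (M + 1) < d by rewrite -ltr_pdivlMr; lra.
have close s : u <= s <= t -> `|X s - X u| < d /\ `|Y s - Y u| < d.
  move=> ust; have small : M * (s - u) < d by nra.
  split; apply: le_lt_trans small; [apply: (driven_lipschitz dX)|apply: (driven_lipschitz dY)]; lra.
have sum s : u <= s <= t -> 0 <= (X s - X u) + (Y s - Y u).
  move=> ust; rewrite (driven_primitive dX) ?(driven_primitive dY); [|lra..].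
  rewrite /segint -RintegralD//; first last.
  - exact: (bounded_integrable (driven_measurable dY) (fun x _ => driven_speed dY x)).
  - exact: (bounded_integrable (driven_measurable dX) (fun x _ => driven_speed dX x)).
  apply: Rintegral_ge0 => r; rewrite /= in_itv /= => usr.
  have [cX cY] : `|X r - X u| < d /\ `|Y r - Y u| < d by apply: close; lra.
  by have [|] := H r _ cX cY; lra.
have vel s : u <= s <= t -> f s = 0 /\ g s = k (X s).
  move=> ust; have [cX cY] := close s ust.
  by have [|_ h] := H s _ cX cY; [lra|exact: h (sum s ust)].
have Xc s : u <= s <= t -> X s = X u.
  move=> ust; apply/eqP; rewrite -subr_eq0 (driven_primitive dX); [|lra..].
  rewrite (@segint_ext _ (cst 0)) ?segint_cst ?mul0r//; first by lra.
  by move=> r usr; have [] := vel r; [lra|].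
split; first by apply: Xc; lra.
have -> : Y t = Y u + (Y t - Y u) by rewrite subrKC.
rewrite (driven_primitive dY); [|lra..]; congr (_ + _).
rewrite (@segint_ext _ (cst (k (X u)))) ?segint_cst; [by rewrite mulrC|lra|].
by move=> r usr /=; have [_ ->] := vel r usr; rewrite Xc.
Qed.

Implicit Types (Z V : R -> R * R).

Definition plane_driven Z V M u w : Prop :=
  driven (fun t => (Z t).1) (fun t => (V t).1) M u w /\
  driven (fun t => (Z t).2) (fun t => (V t).2) M u w.

(** The germ to the right of the curve is prescribed; two solutions from the same point
    then agree for a while. *)
Definition departs Z (v : R * R) u w : Prop := exists2 e : R, 0 < e &
  forall t, u <= t < w -> t < u + e -> Z t = Z u + (t - u) *: v.

Lemma plane_driven_qturnV Z V M u w : plane_driven Z V M u w ->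
  plane_driven (fun t => qturnV (Z t)) (fun t => qturnV (V t)) M u w.
Proof.
move=> [d1 d2]; split; first exact: d2.
have := driven_affine (-1) 0 d1; rewrite normrN1 mul1r.
by congr driven; apply/funext => t; rewrite mulN1r ?addr0.
Qed.

Lemma departs_qturnV Z v u w : departs (fun t => qturnV (Z t)) (qturnV v) u w -> departs Z v u w.
Proof.
move=> [e e0 he]; exists e => // t utw te.
have := he t utw te; rewrite /qturnV => /pair_equal_spec[/= h2 h1].
rewrite [LHS]surjective_pairing -[RHS]/((Z u).1 + (t - u) * v.1, (Z u).2 + (t - u) * v.2) h2.
congr pair; apply: oppr_inj; rewrite h1 -[X in _ + X]/((t - u) * - v.1); ring.
Qed.

Definition square_driven om Z V u w : Prop :=
  forall t, u <= t < w -> sqnorm (Z t) < 1 -> V t = om *: sqvel (Z t).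

Lemma sqnorm_qturnV z : sqnorm (qturnV z) = sqnorm z :> R.
Proof. by rewrite /sqnorm /qturnV /= normrN maxC. Qed.

Lemma sqvel_qturnV z : sqvel (qturnV z) = qturnV (sqvel z) :> R * R.
Proof. by rewrite -{2}(qturnVK z) sqvel_qturn qturnK. Qed.

Lemma qturnVZ (a : R) z : qturnV (a *: z) = a *: qturnV z.
Proof. by rewrite /qturnV -[RHS]/(a * z.2, a * - z.1) mulrN. Qed.

Lemma square_driven_qturnV om Z V u w : square_driven om Z V u w ->
  square_driven om (fun t => qturnV (Z t)) (fun t => qturnV (V t)) u w.
Proof.
by move=> H t utw; rewrite sqnorm_qturnV => Z1; rewrite H// qturnVZ sqvel_qturnV.
Qed.

(** In the right sector the velocity is vertical, and below its lower boundary it is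
    horizontal towards the sector; in both cases its components have a nonnegative sum. *)
Lemma departs_right om Z V M u w : 0 < om -> plane_driven Z V M u w ->
  square_driven om Z V u w -> right_sector (Z u) -> sqnorm (Z u) < 1 ->
  departs Z (om *: sqvel (Z u)) u w.
Proof.
move=> om0 [d1 d2] H rs n1.
have velR : sqvel (Z u) = (0, (Z u).1) by rewrite /sqvel rs.
move: (rs); rewrite /right_sector => /andP[r1 r2].
move: (n1); rewrite /sqnorm; set nu := Num.max _ _ => n1'.
have nu1 : `|(Z u).1| <= nu by rewrite /nu le_max lexx.
have nu2 : `|(Z u).2| <= nu by rewrite /nu le_max lexx orbT.
(* Three smallness conditions: stay in the open square, to the right of the vertical
   axis, and below the main diagonal. *)
pose d := Num.min (1 - nu) (((Z u).1 - (Z u).2) / 2).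
have d0 : 0 < d by rewrite /d lt_min; apply/andP; split; lra.
have da : d <= 1 - nu by rewrite /d ge_min lexx.
have db : d <= ((Z u).1 - (Z u).2) / 2 by rewrite /d ge_min lexx orbT.
have dd : 0 < Num.min d (Z u).1 by rewrite lt_min d0; lra.
have [|e e0 he] := @shear_drift _ _ _ _ M (fun x => om * x) (Num.min d (Z u).1) u w dd d1 d2.
- move=> t utw; rewrite !lt_min => /andP[x1 x2] /andP[y1 y2].
  have Z1 : sqnorm (Z t) < 1.
    rewrite /sqnorm gt_max; apply/andP; split.
      by have := ler_normD ((Z t).1 - (Z u).1) (Z u).1; rewrite subrK; lra.
    by have := ler_normD ((Z t).2 - (Z u).2) (Z u).2; rewrite subrK; lra.
  rewrite (H t utw Z1) -[(om *: _).1]/(om * _) -[(om *: _).2]/(om * _).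
  move: x1 x2 y1 y2; rewrite !ltr_norml => x1 x2 y1 y2.
  have xp : 0 < (Z t).1 by lra.
  have yx : (Z t).2 < (Z t).1 by lra.
  rewrite /sqvel /right_sector /=.
  have -> : - - (Z t).1 <= - (Z t).2 < - (Z t).1 = false by apply/negbTE/negP; lra.
  rewrite orbF; case: ifPn => [h|]; first by rewrite mulr0 add0r; split=> //; apply: mulr_ge0; lra.
  rewrite yx andbT -ltNge => yn /=; rewrite mulr0 addr0; split; first by apply: mulr_ge0; lra.
  by move=> h; exfalso; lra.
- exists e => // t utw te; have [X1 X2] := he t utw te.
  rewrite velR [LHS]surjective_pairing X1 X2.
  rewrite -[RHS]/((Z u).1 + (t - u) * (om * 0), (Z u).2 + (t - u) * (om * (Z u).1)).
  by rewrite !mulr0 addr0.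
Qed.

(** The other sectors follow by quarter turns, which commute with the velocity. *)
Lemma departs_square om Z V M u w : 0 < om -> plane_driven Z V M u w ->
  square_driven om Z V u w -> Z u != 0 -> sqnorm (Z u) < 1 ->
  departs Z (om *: sqvel (Z u)) u w.
Proof.
move=> om0.
have step (Z' V' : R -> R * R) : (plane_driven (fun t => qturnV (Z' t)) (fun t => qturnV (V' t)) M u w ->
      square_driven om (fun t => qturnV (Z' t)) (fun t => qturnV (V' t)) u w ->
      sqnorm (qturnV (Z' u)) < 1 ->
      departs (fun t => qturnV (Z' t)) (om *: sqvel (qturnV (Z' u))) u w) ->
    plane_driven Z' V' M u w -> square_driven om Z' V' u w -> sqnorm (Z' u) < 1 ->
    departs Z' (om *: sqvel (Z' u)) u w.
  move=> H p q n; apply: departs_qturnV; rewrite qturnVZ -sqvel_qturnV; apply: H.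
  - exact: plane_driven_qturnV.
  - exact: square_driven_qturnV.
  - by rewrite sqnorm_qturnV.
have N z : qturnV (qturnV z) = - z :> R * R by case: z.
move=> p q z0 n; have [r|r|r|r] := right_sector_cover z0.
- exact: departs_right om0 p q r n.
- by apply: (step Z V) p q n => p q n; exact: departs_right om0 p q r n.
- apply: (step Z V) p q n => p q n.
  apply: (step (fun t => qturnV (Z t)) (fun t => qturnV (V t))) p q n => p q n.
  by apply: departs_right om0 p q _ n; rewrite N.
- apply: (step Z V) p q n => p q n.
  apply: (step (fun t => qturnV (Z t)) (fun t => qturnV (V t))) p q n => p q n.
  apply: (step (fun t => qturnV (qturnV (Z t))) (fun t => qturnV (qturnV (V t)))) p q n => p q n.
  apply: departs_right om0 p q _ n; rewrite N.
  by rewrite -[X in right_sector X]/(- (Z u).2, - - (Z u).1) opprK.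
Qed.

End Shear.

(** * Uniqueness of trajectories before time one *)

Section Uniqueness.
Context {R : realType}.
Notation traj := (traj (@stage_flow R) (@stage_time R)).
Notation field := (field (@stage_vel R) (@stage_time R)).
Notation stages := (@concrete_stages R).
Notation Q := (@open_square R).
Notation in_cell n :=
  (tile_cell (@cell_dom n) (@cell_center R n) (@half_w R n) (@half_h R n)).
Implicit Types (t u w d M : R) (x y z : R * R) (n : nat) (c G : R -> R * R).

(** The points from which a stage leaves no choice: those inside a cell but not at its
    center, and those with a neighbourhood at rest. The remaining points are
    centers of cells or lie on their boundaries, and so have a rational coordinate. *)
Definition regular n y : Prop :=
  (exists i, in_cell n i y /\ y <> cell_center n i) \/
  (exists2 d : R, 0 < d & forall z, `|z.1 - y.1| < d -> `|z.2 - y.2| < d ->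
     ~ exists i, in_cell n i z).

Lemma stage_departs n c G M u w : plane_driven c G M u w -> u < w ->
  (forall t, u <= t < w -> G t = stage_vel n (c t)) ->
  regular n (c u) -> departs c (stage_vel n (c u)) u w.
Proof.
move=> dc uw GE [[i [ci nc]]|[d d0 hd]]; last first.
  have vel0 z : ~ (exists i, in_cell n i z) -> stage_vel n z = 0.
    by move=> nz; rewrite /stage_vel tile_vel0// scaler0.
  have [d1 d2] := dc.
  have [|e e0 he] := @shear_drift _ _ _ _ _ M (cst 0) d u w d0 d1 d2.
    move=> t utw c1 c2; rewrite GE// vel0; last exact: hd.
    by rewrite /= addr0.
  exists e => // t utw te; have [c1 c2] := he t utw te.
  rewrite vel0 ?scaler0 ?addr0; last by apply: hd; rewrite subrr normr0.
  by rewrite [LHS]surjective_pairing c1 c2 /= mulr0 addr0 -surjective_pairing.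
have p0 := @half_w_gt0 R n; have q0 := @half_h_gt0 R n; have w0 := @width_gt0 R n.
set p : R := half_w n in p0; set q : R := half_h n in q0.
pose k := cell_center n i : R * R.
pose om : R := 4 / width n.
have om0 : 0 < om by apply: divr_gt0.
pose Z t := scale_chartV k p q (c t).
pose V t := ((G t).1 / p, (G t).2 / q).
have [Di n1] := ci; have [d1 d2] := dc.
pose M' := Num.max (`|p^-1| * M) (`|q^-1| * M).
have dZ : plane_driven Z V M' u w.
  split.
    have := driven_affine p^-1 (- (k.1 / p)) d1.
    move/(@driven_le _ _ _ _ M'); rewrite /M' le_max lexx => /(_ isT).
    by congr driven; apply/funext => t; rewrite /Z /V /=; ring.
  have := driven_affine q^-1 (- (k.2 / q)) d2.
  move/(@driven_le _ _ _ _ M'); rewrite /M' le_max lexx orbT => /(_ isT).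
  by congr driven; apply/funext => t; rewrite /Z /V /=; ring.
have velE z : sqnorm (scale_chartV k p q z) < 1 -> stage_vel n z =
    (om * (p * (sqvel (scale_chartV k p q z)).1), om * (q * (sqvel (scale_chartV k p q z)).2)).
  by move=> z1; rewrite /stage_vel (@tile_velE _ _ _ _ _ _ (@in_cell_disj R n) i).
have sZ : square_driven om Z V u w.
  move=> t utw Zt; rewrite /V GE// velE// -[RHS]/(om * _, om * _) /=.
  congr pair; rewrite -!/(Z t); field; exact: lt0r_neq0.
have Z0 : Z u != 0.
  apply/eqP => Zu; apply: nc; rewrite -(scale_chartVK k p0 q0 (c u)) -/(Z u) Zu.
  by rewrite -[LHS]/(p * 0 + k.1, q * 0 + k.2) !mulr0 !add0r -surjective_pairing.
have [e e0 he] := departs_square om0 dZ sZ Z0 n1.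
exists e => // t utw te; have := he t utw te.
rewrite -[c t](scale_chartVK k p0 q0) -/(Z t) => ->.
rewrite velE// -!/(Z u) -[X in _ = X + _](scale_chartVK k p0 q0) -/(Z u).
rewrite /scale_chart -[RHS]/(_ + (t - u) * _, _ + (t - u) * _) /=.
congr pair; rewrite -[(t - u) *: _]/((t - u) * (om * _)); ring.
Qed.

Lemma regular_traj n t x : irrational_coords x -> Q x ->
  stage_time n <= t < stage_time n.+1 -> regular n (traj t x).
Proof.
move=> ix Qx nt; set y := traj (stage_time n) x.
have iy : irrational_coords y by exact: irrational_traj.
have Qy : Q y by apply: (traj_inside stages) => //; exact: stage_time_lt1.
have p0 := @half_w_gt0 R n; have q0 := @half_h_gt0 R n; have w0 := @width_gt0 R n.
have -> : traj t x = stage_flow n (t - stage_time n) y.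
  by apply: (traj_stage stages); lra.
have s0 : 0 <= 4 / width n * (t - stage_time n) :> R.
  by apply: mulr_ge0; [apply: ltW; exact: divr_gt0|lra].
case: (pselect (exists i, in_cell n i y)) => [[i ci]|nc].
  left; exists i; split.
    exact: (tile_cell_flow p0 q0 (@in_cell_disj R n) s0 ci).
  rewrite /stage_flow (tile_flowE (@in_cell_disj R n) _ ci) => E.
  set Z := scale_chartV _ _ _ y in E.
  have n0 : sqnorm (sqrot (4 / width n * (t - stage_time n)) Z) = 0.
    rewrite -[sqrot _ _](scale_chartK (cell_center n i) p0 q0) E.
    by rewrite /sqnorm /scale_chartV /= !subrr !mul0r !normr0 maxxx.
  have {n0}Zn : sqnorm Z = 0 by rewrite -n0 sqnorm_rot.
  have Z0 := sqnorm_eq0 Zn.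
  have yE : y = cell_center n i.
    rewrite -(scale_chartVK (cell_center n i) p0 q0 y) -/Z Z0.
    rewrite -[LHS]/(half_w n * 0 + (cell_center n i).1, half_h n * 0 + (cell_center n i).2).
    by rewrite !mulr0 !add0r -surjective_pairing.
  by apply: iy.1; rewrite yE; have [] := @rational_center R n i.
right; rewrite /stage_flow tile_flow_id//.
have [y1 y2] := Qy; have [i1 i2] := iy.
have [a _ az] := grid_exists n y1 i1; have [b _ bz] := grid_exists n y2 i2.
have := az; have := bz; rewrite /grid => bz' az'.
pose d : R := Num.min (Num.min (y.1 - width n * a%:R) (width n * a.+1%:R - y.1))
  (Num.min (y.2 - width n * b%:R) (width n * b.+1%:R - y.2)).
have d0 : 0 < d by rewrite /d !lt_min; apply/andP; split; apply/andP; split; lra.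
exists d => // z; rewrite /d !lt_min => /andP[/andP[h1 h2] _] /andP[_ /andP[h3 h4]] [i ci].
have za : grid n a z.1.
  by rewrite /grid; move: h1 h2; rewrite !ltr_norml; lra.
have zb : grid n b z.2.
  by rewrite /grid; move: h3 h4; rewrite !ltr_norml; lra.
apply: nc; exists i; move: ci; rewrite !in_cell_natP => -[Di [c2 c1]]; split => //.
split; first by have -> := grid_uniq c2 zb.
move: c1; case: ifP => on; first by move=> /(grid_uniq za) <-.
move: za => /andP[k1 k2] /andP[l1 l2].
have g1 := grid_lt l1 k2; have g2 := grid_lt k1 l2.
have m1 : width n * (4 * i.1.1 + 1)%:R <= width n * a%:R :> R.
  by rewrite ler_pM2l// ler_nat -ltnS.
have m2 : width n * a.+1%:R <= width n * (4 * i.1.1 + 3)%:R :> R.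
  by rewrite ler_pM2l// ler_nat.
lra.
Qed.

Lemma pair_small_eq (v v' : R * R) (K : R) : (forall r : R, 0 < r ->
    `|v.1 - v'.1| <= K * r /\ `|v.2 - v'.2| <= K * r) -> v = v'.
Proof.
move=> H; have small (a : R) : (forall r : R, 0 < r -> `|a| <= K * r) -> a = 0.
  move=> ha; have K0 : 0 <= K.
    by have := ha 1 ltr01; rewrite mulr1; exact: le_trans.
  apply/eqP; rewrite -normr_le0; apply/ler_addgt0Pr => e e0; rewrite add0r.
  have eK : 0 < e / (K + 1) by apply: divr_gt0 => //; lra.
  apply: le_trans (ha _ eK) _; rewrite mulrA ler_pdivrMr; [nra|lra].
rewrite [v]surjective_pairing [v']surjective_pairing; congr pair; apply/eqP;
  rewrite -subr_eq0; apply/eqP; apply: small => r r0; by have [] := H r r0.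
Qed.

Lemma left_limit_unique c G M x u t w : plane_driven c G M u w -> u < t <= w ->
  (forall s : R, u <= s < t -> c s = traj s x) -> c t = traj t x.
Proof.
move=> [d1 d2] utw H; have M0 : 0 <= M := le_trans (normr_ge0 _) (driven_speed d1 0).
apply: (@pair_small_eq _ _ (M + 1)) => r r0.
have [e e0 he] := traj_left_cont stages t x r0.
(* A time before [t], close enough for both curves to be within [r] of their values. *)
pose s : R := Num.max u (Num.max (t - r) (t - e / 2)).
have su : u <= s by rewrite /s le_max lexx.
have sr : t - r <= s by rewrite /s !le_max lexx orbT.
have se : t - e < s by rewrite /s !lt_max; apply/orP; right; apply/orP; right; lra.
have st : s < t by rewrite /s !gt_max; apply/and3P; split; lra.
have [|h1 h2] := he s; first by rewrite se ltW.
have Hs : c s = traj s x by apply: H; rewrite su st.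
rewrite -Hs in h1 h2.
have l1 := driven_lipschitz d1 su (ltW st) (andP utw).2.
have l2 := driven_lipschitz d2 su (ltW st) (andP utw).2.
have Mr : M * (t - s) <= M * r by apply: ler_wpM2l => //; lra.
split.
- have := ler_normD ((c t).1 - (c s).1) ((c s).1 - (traj t x).1); rewrite subrKA; lra.
- have := ler_normD ((c t).2 - (c s).2) ((c s).2 - (traj t x).2); rewrite subrKA; lra.
Qed.

Lemma plane_drivenS c G M u w u' w' : u <= u' -> w' <= w ->
  plane_driven c G M u w -> plane_driven c G M u' w'.
Proof.
by move=> uu ww [[m1 b1 p1] [m2 b2 p2]]; split; split => // s t us st tw;
  [apply: p1|apply: p2]; lra.
Qed.

(** Right germs are unique by [stage_departs] at regular points, and left limits are
    determined by continuity. *)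
Lemma stage_unique n c G M x : irrational_coords x -> Q x ->
  plane_driven c G M (stage_time n) (stage_time n.+1) ->
  (forall t, stage_time n <= t < stage_time n.+1 -> G t = stage_vel n (c t)) ->
  c (stage_time n) = traj (stage_time n) x ->
  forall t, stage_time n <= t <= stage_time n.+1 -> c t = traj t x.
Proof.
move=> ix Qx dc GE c0.
have key t : stage_time n <= t < stage_time n.+1 -> c t = traj t x.
  move=> nt; apply: (@real_induction _ (fun t => c t = traj t x) (stage_time n) t) => //.
  - by lra.
  - move=> s ns cs; have [ns1 ns2] : stage_time n <= s /\ s < stage_time n.+1 by split; lra.
    have dc' := plane_drivenS ns1 (lexx _) dc.
    have [|||e e0 he] := @stage_departs n c G M s (stage_time n.+1) dc'.
    + by [].
    + by move=> r sr; apply: GE; lra.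
    + by rewrite cs; apply: regular_traj; rewrite ?ns1.
    have [e' e'0 he'] := traj_right stages s x.
    exists (Num.min e e'); first by rewrite lt_min e0.
    move=> r; rewrite -ltrBlDl lt_min => /andP[sr /andP[re re']] rt.
    have [|h _] := he' (r - s); first by lra.
    have {2}-> : r = s + (r - s) by rewrite subrKC.
    rewrite h he; [|lra..].
    by rewrite cs (fieldE stages (n := n)) ?ns1.
  - move=> s ns H; apply: (left_limit_unique (u := stage_time n) dc); [lra|exact: H].
move=> t nt; have [tn|tn] := ltP t (stage_time n.+1); first by apply: key; lra.
apply: (left_limit_unique (u := stage_time n) dc).
  by have := st_lt stages n; lra.
by move=> s sn; apply: key; lra.
Qed.

End Uniqueness.

(** * Trajectories cannot come back from time two *)

Section NonExistence.
Context {R : realType}.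
Notation leb := (@lebesgue_measure R).
Notation leb2 := ((@lebesgue_measure R \x @lebesgue_measure R)%E).
Notation traj := (traj (@stage_flow R) (@stage_time R)).
Notation field := (field (@stage_vel R) (@stage_time R)).
Notation stages := (@concrete_stages R).
Notation Q := (@open_square R).
Implicit Types (t u w : R) (x y z : R * R) (n : nat) (c : R -> R * R).

Lemma oriented_integral_segint (f : R -> R) t : 0 <= t -> oriented_integral f t = segint f 0 t.
Proof.
rewrite /oriented_integral /segment_to le_eqVlt => /orP[/eqP <-|t0].
  by rewrite sgr0 mul0r segint_point.
by rewrite gtr0_sg// mul1r min_l ?max_r ?ltW.
Qed.

Lemma integral_driven (f X : R -> R) (a M w : R) : 0 <= w -> (forall t, `|f t| <= M) ->
  leb.-integrable `[0, w] (EFin \o f) ->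
  (forall t, 0 <= t <= w -> X t = a + oriented_integral f t) ->
  driven X (fun t => if 0 <= t <= w then f t else 0) M 0 w.
Proof.
move=> w0 fM ifw XE; set g := fun t => _.
have M0 : 0 <= M := le_trans (normr_ge0 _) (fM 0).
have mg : measurable_fun setT g.
  apply/measurable_EFinP.
  have -> : EFin \o g = (EFin \o f) \_ `[0, w].
    apply/funext => t; rewrite patchE /g /=.
    have -> : (t \in `[0, w]%classic) = (0 <= t <= w) by rewrite mem_setE in_itv.
    by case: ifP.
  have mI : measurable (`[0, w]%classic : set (measurableTypeR R)) := measurable_itv _.
  exact (measurable_int leb
    ((@integrable_mkcond _ (measurableTypeR R) R leb _ (EFin \o f) mI).1 ifw)).
have gM t : `|g t| <= M by rewrite /g; case: ifP => _; rewrite ?normr0.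
split => // s t s0 st tw.
rewrite !XE; [|lra..]; rewrite !oriented_integral_segint; [|lra..].
have fg u v : 0 <= u -> v <= w -> segint f u v = segint g u v.
  by move=> u0 vw; apply: segint_ext => r urv; rewrite /g; have -> : 0 <= r <= w by lra.
rewrite !fg; [|lra..].
rewrite (@segint_cat _ g 0 s t); first by ring.
- exact: (bounded_integrable mg (fun r _ => gM r)).
- lra.
Qed.

(** The field vanishes from time [1] on, so the value at time [2] is the value of the
    limit map. *)
Lemma field_curve_limit x c : irrational_coords x -> Q x ->
  (forall t, integral_curve_at field 0 x c t) -> c 2 = traj 1 x.
Proof.
move=> ix Qx H.
pose f1 s := (field (s + 0, c s)).1; pose f2 s := (field (s + 0, c s)).2.
have f1M t : `|f1 t| <= 4 by have [] := field_bound stages (t + 0, c t).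
have f2M t : `|f2 t| <= 4 by have [] := field_bound stages (t + 0, c t).
have seg2 : segment_to (2 : R) = `[0, 2]%classic by rewrite /segment_to min_l ?max_r.
have [i1 i2 _] := H 2; rewrite seg2 in i1 i2.
have c1 t : 0 <= t <= 2 -> (c t).1 = x.1 + oriented_integral f1 t.
  by move=> _; have [_ _ ->] := H t.
have c2 t : 0 <= t <= 2 -> (c t).2 = x.2 + oriented_integral f2 t.
  by move=> _; have [_ _ ->] := H t.
(* The velocity along the curve, cut off outside the interval where measurability is known. *)
pose G t := if 0 <= t <= 2 then field (t, c t) else 0.
have dG : plane_driven c G 4 0 2.
  split.
    have := integral_driven (ler0n R 2) f1M i1 c1.
    by congr driven; apply/funext => t; rewrite /G /f1 addr0; case: ifP.
  have := integral_driven (ler0n R 2) f2M i2 c2.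
  by congr driven; apply/funext => t; rewrite /G /f2 addr0; case: ifP.
have T0 n : 0 <= stage_time n :> R.
  elim: n => [|n IH]; first by rewrite (st_T0 stages).
  by apply: le_trans IH _; exact: ltW (st_lt stages n).
have T1 n := st_T1 stages n.
have stage n : c (stage_time n) = traj (stage_time n) x ->
    forall t, stage_time n <= t <= stage_time n.+1 -> c t = traj t x.
  move=> cn; have Tn2 : stage_time n.+1 <= 2 :> R by have := T1 n.+1; lra.
  apply: (stage_unique ix Qx (plane_drivenS (T0 n) Tn2 dG)) => // t nt.
  have := T0 n => Tn; rewrite /G (fieldE stages (n := n))//.
  by have -> : 0 <= t <= 2 by lra.
have atT n : c (stage_time n) = traj (stage_time n) x.
  elim: n => [|n IH].
    rewrite (st_T0 stages) (traj_le0 stages)//.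
    have [_ _ ->] := H 0; rewrite /oriented_integral sgr0 !mul0r.
    by rewrite -[RHS]addr0.
  by apply: stage IH _ _; have := st_lt stages n; lra.
have before t : 0 <= t < 1 -> c t = traj t x.
  by move=> /(T_bracket stages)[n nt]; apply: stage (atT n) _ _; lra.
have at1 : c 1 = traj 1 x.
  by apply: (left_limit_unique (u := 0) dG); [lra|move=> s s01; apply: before].
rewrite -at1; have [d1 d2] := dG.
have G0 r : 1 <= r <= 2 -> G r = 0.
  by move=> r12; rewrite /G; case: ifP => // _; apply: (field0 stages); lra.
have e1 : (c 2).1 - (c 1).1 = 0.
  rewrite (driven_primitive d1); [|lra..].
  by rewrite (@segint_ext _ _ (cst 0)) ?segint_cst ?mul0r; [|lra|move=> r /G0 ->].
have e2 : (c 2).2 - (c 1).2 = 0.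
  rewrite (driven_primitive d2); [|lra..].
  by rewrite (@segint_ext _ _ (cst 0)) ?segint_cst ?mul0r; [|lra|move=> r /G0 ->].
rewrite [LHS]surjective_pairing [RHS]surjective_pairing.
by congr pair; apply/eqP; rewrite -subr_eq0 ?e1 ?e2.
Qed.

(** By the group law the flow would bring almost every point back from its image under
    the limit map; but that map takes the same value at a point and at its image under
    [half_swap]. *)
Lemma no_ae_flow : ~ exists phi : R -> R -> R * R -> R * R, ae_flow field phi.
Proof.
move=> [phi [ode _ grp]].
have n01 : (0 : R) != 1 by rewrite eq_sym oner_eq0.
have n21 : 2 + 0 != 1 :> R by rewrite addr0; apply/eqP; lra.
have [N1 [mN1 N10 h1]] := ode 0 n01.
have [N2 [mN2 N20 h2]] := grp (-2) 2 0 n01 n21.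
pose N := N1 `|` N2.
have mN : measurable N by exact: measurableU.
have N0 : leb2 N = 0%E.
  apply/eqP; rewrite eq_le measure_ge0 andbT.
  apply: (le_trans (measureU2 leb2 mN1 mN2)).
  by rewrite [X in (X + _)%E]N10 [X in (_ + X)%E]N20 adde0.
pose psi y := phi (-2) (0 + 2) y.
have back x : ~ N x -> irrational_coords x -> Q x -> psi (traj 1 x) = x.
  move=> Nx ix Qx.
  have cx : forall t, integral_curve_at field 0 x (fun s => phi s 0 x) t.
    by apply: contrapT => nc; apply: Nx; left; exact: h1.
  have gx : phi (-2) (0 + 2) (phi 2 0 x) = phi (-2 + 2) 0 x.
    by apply: contrapT => nc; apply: Nx; right; exact: h2.
  rewrite /psi -(field_curve_limit ix Qx cx) gx addNr.
  have [_ _ ->] := cx 0; rewrite /oriented_integral sgr0 !mul0r.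
  by rewrite -[RHS]addr0.
have mP := @measurable_half_piece R (Some false).
have mS := (@mp_half_swap R).
have sub : half_piece (Some false) `<=` N `|` @half_swap R @^-1` N.
  move=> z hz; have sz : half_piece (Some true) (half_swap z).
    by rewrite /half_swap (@half_index_unique R _ _ hz); exact: (half_shift_piece hz).
  have zs : half_swap z <> z.
    rewrite /half_swap (@half_index_unique R _ _ hz) => /(congr1 fst) /=; lra.
  apply: contrapT => /not_orP[nz nsz]; apply: zs.
  have [g Qz _] := hz; have [g' Qz' _] := sz.
  rewrite -(back _ nsz (good_coords g') Qz') traj1_half_swap.
  exact: (back _ nz (good_coords g) Qz).
have mSN : measurable (@half_swap R @^-1` N) by exact: mp_preimage.
have SN0 : leb2 (@half_swap R @^-1` N) = 0%E by rewrite mS.2.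
have : (leb2 (half_piece (Some false)) <= 0)%E.
  apply: (@le_trans _ _ (leb2 (N `|` @half_swap R @^-1` N))).
    apply: le_measure; rewrite ?inE; [exact mP|exact (measurableU _ _ mN mSN)|exact: sub].
  apply: (le_trans (measureU2 leb2 mN mSN)).
  by rewrite [X in (X + _)%E]N0 [X in (_ + X)%E]SN0 adde0.
by rewrite leNgt half_piece_pos.
Qed.

End NonExistence.

(** * Non-uniqueness and non-existence *)

Theorem theorem6 (R : realType) :
  (exists a : R * (R * R) -> R * R,
     [/\ admissible_field a,
         exists phi psi : R -> R -> R * R -> R * R,
           [/\ distinct_flows phi psi,
               everywhere_flow a phi &
               everywhere_flow a psi] &
         exists u : R * (R * R) -> R,
           [/\ Linfty_half_space u,
               ~ {ae leb3 R, forall z, half_space z -> u z = 0} &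
               weak_transport_zero a u]]) /\
  (exists a : R * (R * R) -> R * R,
     admissible_field a /\
     ~ exists phi : R -> R -> R * R -> R * R, ae_flow a phi).
Proof.
split.
- exists (@mirror_field R); split; first exact: admissible_mirror.
  + exists (mirror_flow id), (mirror_flow (@half_swap R)).
    split; first exact: mirror_flows_distinct.
      by apply: mirror_everywhere_flow => //; exact: mp_id.
    apply: mirror_everywhere_flow; first exact: half_swapK.
      exact: mp_half_swap.
    exact: traj1_half_swap.
  + exists (@mirror_density R); split; first exact: mirror_density_Linfty.
      exact: mirror_density_nonzero.
    exact: mirror_transport.
- exists (field (@stage_vel R) (@stage_time R)); split; first exact: admissible_forward.
  exact: no_ae_flow.
Qed.
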